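(* Let $f$ be a slice regular function on $\mathbb{B}$ such that the function $q\mapsto qf'(q)$ belongs to $\mathcal{S}^{*}$. Then $$\frac{1}{(1+|q|)^{2}}\leq|f'(q)|\leq\frac{1}{(1-|q|)^{2}},\qquad\forall\, q\in\mathbb{B}.$$ The estimates are sharp: for each point $q_0\in\mathbb{B}\setminus\{0\}$ and each of the two inequalities, equality at $q_0$ occurs for the function $f(q)=q(1-qu)^{-\ast}$, $q\in\mathbb{B}$, for some $u\in\partial\mathbb{B}$.
   Context: $\mathbb{H}$ denotes the quaternions, $\mathbb{B}=\{q\in\mathbb{H}:|q|<1\}$, $\mathbb{S}=\{q\in\mathbb{H}:q^2=-1\}$; for $I\in\mathbb{S}$, $\mathbb{C}_I=\mathbb{R}\oplus I\mathbb{R}$ and $\mathbb{B}_I=\mathbb{B}\cap\mathbb{C}_I$. A function $f:\mathbb{B}\to\mathbb{H}$ is (left) slice regular if for every $I\in\mathbb{S}$ the restriction $f_I=f|_{\mathbb{B}_I}$ has continuous partial derivatives and $\frac12\left(\frac{\partial}{\partial x}+I\frac{\partial}{\partial y}\right)f_I(x+yI)=0$ on $\mathbb{B}_I$; equivalently $f(q)=\sum_{n\ge0}q^na_n$ on $\mathbb{B}$ with $a_n\in\mathbb{H}$. Its slice derivative is $f'(x+yI)=\frac12\left(\frac{\partial}{\partial x}-I\frac{\partial}{\partial y}\right)f_I(x+yI)$, i.e. $f'(q)=\sum_{n\ge1}q^{n-1}na_n$. For slice regular $f=\sum q^na_n$, $g=\sum q^nb_n$ on $\mathbb{B}$: the regular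 product is $f\ast g(q)=\sum_n q^n\sum_{k=0}^n a_kb_{n-k}$; the regular conjugate is $f^c(q)=\sum q^n\overline{a_n}$; the symmetrization is $f^s=f\ast f^c$; the regular reciprocal is $f^{-\ast}(q)=f^s(q)^{-1}f^c(q)$ off the zero set of $f^s$. In particular $q(1-qu)^{-\ast}=\sum_{n\ge1}q^nu^{n-1}$. $\mathcal{S}$ is the set of slice regular $g:\mathbb{B}\to\mathbb{H}$ whose zero set is $\mathcal{Z}_g=\{0\}$ and with $g'(0)=1$. The class of slice starlike functions $\mathcal{S}^{*}$ is the set of $g\in\mathcal{S}$ such that $\mathrm{Re}\big(g(q)^{-1}qg'(q)\big)>0$ for $q\in\mathbb{B}$ (pointwise products; at $q=0$ the expression is understood as its limit value $1$). *)

(* Defs.v *)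
From Stdlib Require Import Reals ClassicalEpsilon.
From Coquelicot Require Import Coquelicot.

Set Implicit Arguments.
Unset Strict Implicit.

Local Open Scope R_scope.

(** * Quaternions *)

(** The nested product [(((a, b), c), d)] stands for a + b i + c j + d k.  Being a
    product of copies of [R], [quat] inherits Coquelicot's normed module structure
    over [R] (hence [ex_derive], [continuous], [is_series]), whose norm is the
    Euclidean one. *)
Definition quat : Type := (R * R * R * R)%type.

Declare Scope quat_scope.
Delimit Scope quat_scope with quat.
Bind Scope quat_scope with quat.

Definition mkq (a b c d : R) : quat := (a, b, c, d).

Definition q_re (q : quat) : R := fst (fst (fst q)).
Definition q_i (q : quat) : R := snd (fst (fst q)).
Definition q_j (q : quat) : R := snd (fst q).
Definition q_k (q : quat) : R := snd q.

Definition qreal (x : R) : quat := mkq x 0 0 0.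

Definition qadd (p q : quat) : quat :=
  mkq (q_re p + q_re q) (q_i p + q_i q) (q_j p + q_j q) (q_k p + q_k q).

Definition qopp (q : quat) : quat := mkq (- q_re q) (- q_i q) (- q_j q) (- q_k q).

Definition qmul (p q : quat) : quat :=
  mkq (q_re p * q_re q - q_i p * q_i q - q_j p * q_j q - q_k p * q_k q)
      (q_re p * q_i q + q_i p * q_re q + q_j p * q_k q - q_k p * q_j q)
      (q_re p * q_j q - q_i p * q_k q + q_j p * q_re q + q_k p * q_i q)
      (q_re p * q_k q + q_i p * q_j q - q_j p * q_i q + q_k p * q_re q).

Definition qconj (q : quat) : quat := mkq (q_re q) (- q_i q) (- q_j q) (- q_k q).

Definition qnorm (q : quat) : R :=
  sqrt (q_re q ^ 2 + q_i q ^ 2 + q_j q ^ 2 + q_k q ^ 2).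

Notation "p + q" := (qadd p q) : quat_scope.
Notation "- q" := (qopp q) : quat_scope.
Notation "p - q" := (qadd p (qopp q)) : quat_scope.
Notation "p * q" := (qmul p q) : quat_scope.

(** With Stdlib's convention for division by zero, [qinv (qreal 0) = qreal 0]. *)
Definition qinv (q : quat) : quat := (qreal (/ qnorm q ^ 2) * qconj q)%quat.

Fixpoint qpow (q : quat) (n : nat) : quat :=
  match n with
  | O => qreal 1
  | S m => (q * qpow q m)%quat
  end.

(** The open unit ball.  Functions on it are represented by total functions
    [quat -> quat]; all the notions below depend only on their values on the ball. *)
Definition in_ball (q : quat) : Prop := qnorm q < 1.

(** The sphere of imaginary units. *)
Definition imag_unit (I : quat) : Prop := (I * I)%quat = qreal (-1).

Definition slice_pt (I : quat) (x y : R) : quat := (qreal x + qreal y * I)%quat.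

(** * Slice regular functions *)

(** Derivative of a curve in [quat]; junk where [h] is not differentiable. *)
Definition qDerive (h : R -> quat) (t : R) : quat :=
  mkq (Derive (fun s => q_re (h s)) t) (Derive (fun s => q_i (h s)) t)
      (Derive (fun s => q_j (h s)) t) (Derive (fun s => q_k (h s)) t).

Definition slice_dx (f : quat -> quat) (I : quat) (x y : R) : quat :=
  qDerive (fun s => f (slice_pt I s y)) x.

Definition slice_dy (f : quat -> quat) (I : quat) (x y : R) : quat :=
  qDerive (fun s => f (slice_pt I x s)) y.

Definition slice_regular (f : quat -> quat) : Prop :=
  forall I : quat, imag_unit I ->
  forall x y : R, in_ball (slice_pt I x y) ->
  ex_derive (fun s => f (slice_pt I s y)) x /\
  ex_derive (fun s => f (slice_pt I x s)) y /\
  continuous (fun z : R * R => slice_dx f I (fst z) (snd z)) (x, y) /\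
  continuous (fun z : R * R => slice_dy f I (fst z) (snd z)) (x, y) /\
  (qreal (1 / 2) * (slice_dx f I x y + I * slice_dy f I x y))%quat = qreal 0.

(** Every [q] is [slice_pt (slice_unit q) (q_re q) (im_norm q)].  For non-real [q] the
    only other way to write [q] as x + y I flips the signs of both y and I, which does
    not affect the slice derivative.  For real [q] any unit I may be used: if [f] is
    slice regular, the slice derivative is then the derivative along the real axis. *)
Definition im_norm (q : quat) : R := sqrt (q_i q ^ 2 + q_j q ^ 2 + q_k q ^ 2).

Definition slice_unit (q : quat) : quat :=
  if Req_EM_T (im_norm q) 0 then mkq 0 1 0 0
  else mkq 0 (q_i q / im_norm q) (q_j q / im_norm q) (q_k q / im_norm q).

Definition slice_derivative (f : quat -> quat) (q : quat) : quat :=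
  let I := slice_unit q in
  let x := q_re q in
  let y := im_norm q in
  (qreal (1 / 2) * (slice_dx f I x y - I * slice_dy f I x y))%quat.

(** * Regular product, conjugate, symmetrization and reciprocal *)

Definition has_expansion (f : quat -> quat) (a : nat -> quat) : Prop :=
  forall q : quat, in_ball q -> is_series (fun n => (qpow q n * a n)%quat) (f q).

(** The (unique) coefficients of the expansion of a slice regular [f] on the ball. *)
Definition coef (f : quat -> quat) : nat -> quat :=
  epsilon (inhabits (fun _ : nat => qreal 0)) (has_expansion f).

(** The sum of the series of the q^n a_n; junk where it diverges. *)
Definition qseries (a : nat -> quat) (q : quat) : quat :=
  mkq (Series (fun n => q_re (qpow q n * a n)))
      (Series (fun n => q_i (qpow q n * a n)))
      (Series (fun n => q_j (qpow q n * a n)))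
      (Series (fun n => q_k (qpow q n * a n))).

Definition regular_mul (f g : quat -> quat) : quat -> quat :=
  qseries (fun n => sum_n (fun k => (coef f k * coef g (n - k))%quat) n).

Definition regular_conj (f : quat -> quat) : quat -> quat :=
  qseries (fun n => qconj (coef f n)).

Definition symmetrization (f : quat -> quat) : quat -> quat :=
  regular_mul f (regular_conj f).

Definition regular_recip (f : quat -> quat) (q : quat) : quat :=
  (qinv (symmetrization f q) * regular_conj f q)%quat.

(** * Slice starlike functions *)

Definition class_S (g : quat -> quat) : Prop :=
  slice_regular g /\
  (forall q : quat, in_ball q -> (g q = qreal 0 <-> q = qreal 0)) /\
  slice_derivative g (qreal 0) = qreal 1.

(** At q = 0 the expression g(q)^{-1} q g'(q) is understood as its limit 1, so the
    condition there holds automatically. *)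
Definition slice_starlike (g : quat -> quat) : Prop :=
  class_S g /\
  forall q : quat, in_ball q -> q <> qreal 0 ->
    0 < q_re (qinv (g q) * q * slice_derivative g q).

(** The function q (1 - q u)^{-*}. *)
Definition extremal (u q : quat) : quat :=
  (q * regular_recip (fun p => qreal 1 - p * u) q)%quat.

(* Main.v *)
(** Write [phi] for f' and g for q f'.  On a sphere x + y S one has
    phi (x + y I) = b + I c, where b + i c is the stem function, a holomorphic function
    of x + i y with values in the complexified quaternions.  Put p = conj b + I conj c
    (the regular conjugate of phi at x + y I) and let I' be the unit with p I' = I p.
    Then the regular quotient phi^{-*} * (q phi') at x + y I equals the pointwise quotient
    phi^{-1} q phi' at x + y I'.  As phi has no zeros, I and I' determine each other, so
    starlikeness says exactly that 1 + phi^{-*} * (q phi') has positive real part.  On a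
    slice this real part is that of a complex holomorphic function with value 1 at 0, and
    Harnack's inequality gives (1-r)/(1+r) <= Re (g^{-1} q g') <= (1+r)/(1-r) for |q| = r.
    Since 2 Re (g^{-1} q g') - 2 is r times the logarithmic derivative of |phi|^2 along a
    ray, (1+r)^4 |phi|^2 increases and (1-r)^4 |phi|^2 decreases from the value 1.

    The extremal function is the sum of the q^n u^{n-1}, whose coefficients lie in the
    slice of u.  For q = x + y I the inner products of such series are convex combinations,
    with weights given by the cosine of the angle between I and the unit of u, of the inner
    products at two points of the slice of u, where f' is the complex function
    1 / (1 - w)^2.  For q0 one takes u = conj q0 / |q0| or its opposite. *)

Require Import Defs.
From Stdlib Require Import Reals Lra Lia Psatz ClassicalEpsilon.
From Coquelicot Require Import Coquelicot.

Local Open Scope R_scope.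

(** * Complex differentiability *)

(* Coquelicot hides [R] and [C] behind structure projections, which [ring] does not
   see through. *)
Ltac carriers :=
  repeat match goal with
  | w : UniformSpace.sort _ |- _ => first [change R in w | change C in w]
  end;
  match goal with
  | |- @eq _ ?a ?b => first [change (@eq R a b) | change (@eq C a b)]
  | _ => idtac
  end.
Ltac Cring := carriers; ring.

(** The hypothesis on f is differential, C^1 with Cauchy-Riemann equations on each slice, whereas
    stem functions and regular products are read off coefficients. The expansion in powers of q is
    therefore derived, and with it Cauchy's formula and Taylor's theorem on a disc; continuity of
    the derivative lets one differentiate under the integral sign. All integrals and series stay
    real: a complex identity is stated for Re (d * ...) with a free constant d, and a quaternionic
    series becomes four real coefficient sequences summed at a complex point. The obstacle in the
    growth estimate is that the unit I' paired with I varies with the point z. Harnack's inequality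
    is applied on one fixed slice, chosen for the point under consideration, while positivity at
    other points of that slice draws on starlikeness at varying units, hence on the whole ball. The
    exponent 4 comes from the lower bound (1-r)/(1+r), for which 2 Re (g^{-1} q g') - 2 >=
    -4r/(1+r), and symmetrically from the upper one. *)

Lemma Cmod_ge_Re_Im (z : C) : Rabs (Re z) <= Cmod z /\ Rabs (Im z) <= Cmod z.
Proof.
destruct z as [x y]; unfold Cmod; simpl.
rewrite <- !sqrt_Rsqr_abs.
split; apply sqrt_le_1_alt; unfold Rsqr; nra.
Qed.

Lemma Cmod_le_Re_Im (z : C) : Cmod z <= Rabs (Re z) + Rabs (Im z).
Proof.
destruct z as [x y]; unfold Cmod; simpl.
pose proof (Rabs_pos x); pose proof (Rabs_pos y).
apply Rle_trans with (sqrt (Rsqr (Rabs x + Rabs y))).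
  apply sqrt_le_1_alt.
  assert (H1 := Rsqr_abs x); assert (H2 := Rsqr_abs y); unfold Rsqr in *; nra.
rewrite sqrt_Rsqr; lra.
Qed.

(** Neighbourhoods in [C] are boxes in a product of two copies of [R]; comparing [Cmod] with the
    coordinates and with the sum of their absolute values trades boxes for discs. *)
Lemma locally_Cmod (z : C) (P : C -> Prop) :
  locally z P <-> exists d : posreal, forall w : C, Cmod (w - z) < d -> P w.
Proof.
split; intros [d Hd].
- exists d; intros w Hw; apply Hd.
  destruct (Cmod_ge_Re_Im (w - z)) as [H1 H2].
  destruct w as [w1 w2], z as [z1 z2]; simpl in *.
  split; simpl; unfold ball; simpl; unfold AbsRing_ball, abs, minus, plus, opp; simpl; unfold Rminus in *; lra.
- assert (Hd2 : 0 < d / 2) by (destruct d; simpl; lra).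
  exists (mkposreal _ Hd2); intros w [H1 H2]; apply Hd.
  apply Rle_lt_trans with (1 := Cmod_le_Re_Im _).
  destruct w as [w1 w2], z as [z1 z2]; simpl in *.
  unfold ball in H1, H2; simpl in H1, H2.
  unfold AbsRing_ball, abs, minus, plus, opp in H1, H2; simpl in H1, H2.
  unfold Rminus in *; lra.
Qed.

Lemma continuous_Cmod (U : UniformSpace) (Q : U -> C) (x : U) :
  continuous Q x <->
  forall eps : posreal, locally x (fun y => Cmod (Q y - Q x) < eps).
Proof.
split.
- intros H eps.
  apply (H (fun w => Cmod (w - Q x) < eps)).
  apply locally_Cmod; exists eps; auto.
- intros H P HP.
  apply locally_Cmod in HP; destruct HP as [d Hd].
  unfold filtermap; generalize (H d); apply filter_imp; auto.
Qed.

Section Continuity.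

Context {U : UniformSpace}.
Implicit Types (f g : U -> R) (F G : U -> C).

Lemma continuous_Cpair f g x :
  continuous f x -> continuous g x -> continuous (fun y => (f y, g y) : C) x.
Proof.
intros Hf Hg.
apply continuous_Cmod; intros eps.
assert (He : 0 < eps / 2) by (destruct eps; simpl; lra).
apply (proj1 (filterlim_locally f (f x))) with (eps := mkposreal _ He) in Hf.
apply (proj1 (filterlim_locally g (g x))) with (eps := mkposreal _ He) in Hg.
generalize (filter_and _ _ Hf Hg); apply filter_imp; intros y [H1 H2].
apply Rle_lt_trans with (1 := Cmod_le_Re_Im _); simpl.
unfold ball in H1, H2; simpl in H1, H2.
unfold AbsRing_ball, abs, minus, plus, opp in H1, H2; simpl in H1, H2.
unfold Rminus in *; lra.
Qed.

Lemma continuous_CRe F x : continuous F x -> continuous (fun y => Re (F y)) x.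
Proof. intros H; apply (continuous_comp F Re); [exact H|]; apply (continuous_fst (Re (F x)) (Im (F x))). Qed.

Lemma continuous_CIm F x : continuous F x -> continuous (fun y => Im (F y)) x.
Proof. intros H; apply (continuous_comp F Im); [exact H|]; apply (continuous_snd (Re (F x)) (Im (F x))). Qed.

Lemma continuous_Cplus F G x :
  continuous F x -> continuous G x -> continuous (fun y => F y + G y)%C x.
Proof.
intros HF HG; apply continuous_Cpair.
- apply (continuous_plus (V := R_NormedModule) (fun y => Re (F y)) (fun y => Re (G y))); apply continuous_CRe; auto.
- apply (continuous_plus (V := R_NormedModule) (fun y => Im (F y)) (fun y => Im (G y))); apply continuous_CIm; auto.
Qed.

Lemma continuous_Cmult F G x :
  continuous F x -> continuous G x -> continuous (fun y => F y * G y)%C x.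
Proof.
intros HF HG.
pose proof (continuous_CRe _ _ HF); pose proof (continuous_CRe _ _ HG).
pose proof (continuous_CIm _ _ HF); pose proof (continuous_CIm _ _ HG).
apply continuous_Cpair.
- apply (continuous_minus (V := R_NormedModule) (fun y => Re (F y) * Re (G y)) (fun y => Im (F y) * Im (G y)));
  apply (continuous_mult (K := R_AbsRing)); auto.
- apply (continuous_plus (V := R_NormedModule) (fun y => Re (F y) * Im (G y)) (fun y => Im (F y) * Re (G y)));
  apply (continuous_mult (K := R_AbsRing)); auto.
Qed.

Lemma continuous_Rinv_fun f x : continuous f x -> f x <> 0 -> continuous (fun y => / f y) x.
Proof.
intros H H0; apply (continuous_comp f Rinv); auto.
apply continuous_Rinv; auto.
Qed.

Lemma Cmod_sqr_nz (z : C) : z <> 0 -> Re z ^ 2 + Im z ^ 2 <> 0.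
Proof.
intros Hz H; apply Hz.
destruct z as [a b]; simpl in *.
assert (a = 0) by nra; assert (b = 0) by nra; subst; reflexivity.
Qed.

Lemma continuous_Cinv F x :
  continuous F x -> F x <> 0 -> continuous (fun y => / F y)%C x.
Proof.
intros HF H0.
pose proof (continuous_CRe _ _ HF); pose proof (continuous_CIm _ _ HF).
assert (HN : continuous (fun y => / (Re (F y) ^ 2 + Im (F y) ^ 2)) x).
{ apply continuous_Rinv_fun; [|apply Cmod_sqr_nz; auto].
  apply (continuous_plus (V := R_NormedModule) (fun y => Re (F y) ^ 2) (fun y => Im (F y) ^ 2)).
  - apply continuous_ext with (fun y => Re (F y) * Re (F y)); [intros; simpl; ring|].
    apply (continuous_mult (K := R_AbsRing)); auto.
  - apply continuous_ext with (fun y => Im (F y) * Im (F y)); [intros; simpl; ring|].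
    apply (continuous_mult (K := R_AbsRing)); auto. }
apply continuous_Cpair.
- apply (continuous_mult (K := R_AbsRing)); auto.
- apply (continuous_mult (K := R_AbsRing)); auto.
  apply (continuous_opp (V := R_NormedModule)); auto.
Qed.

End Continuity.

Lemma continuous_Cid (z : C) : continuous (fun w : C => w) z.
Proof. apply continuous_id. Qed.

(** Caratheodory's form of complex differentiability, which reduces the calculus
    rules to continuity. *)
Definition cdiff (F : C -> C) (z l : C) : Prop :=
  exists Q : C -> C, continuous Q z /\ Q z = l /\
    locally z (fun w => F w = F z + Q w * (w - z))%C.

(** The difference quotient, completed by l at z, is the function [Q]; the estimate divided by |w -
    z| is its continuity at z. The inequality is weak because both sides vanish at w = z. *)
Lemma cdiff_of_estimate (F : C -> C) (z l : C) :
  (forall eps : posreal,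
     locally z (fun w => Cmod (F w - F z - l * (w - z)) <= eps * Cmod (w - z))) ->
  cdiff F z l.
Proof.
intros H.
assert (dec : forall w : C, {w = z} + {w <> z}) by (intros w; apply Ceq_dec).
set (Q := fun w : C => if dec w then l else ((F w - F z) / (w - z))%C).
assert (Qz : Q z = l) by (unfold Q; destruct (dec z); congruence).
exists Q; repeat split; auto.
- apply continuous_Cmod; intros eps.
  assert (He : 0 < eps / 2) by (destruct eps; simpl; lra).
  generalize (H (mkposreal _ He)); apply filter_imp; intros w Hw.
  rewrite Qz; unfold Q; destruct (dec w) as [e|e].
    replace (l - l)%C with (RtoC 0) by ring; rewrite Cmod_0; apply eps.
  assert (e' : (w - z)%C <> 0).
  { intros h; apply e; replace w with ((w - z) + z)%C by ring; rewrite h; ring. }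
  assert (e2 : 0 < Cmod (w - z)) by (apply Cmod_gt_0; auto).
  replace ((F w - F z) / (w - z) - l)%C with ((F w - F z - l * (w - z)) / (w - z))%C
    by (field; auto).
  rewrite Cmod_div; auto.
  apply Rle_lt_trans with (eps / 2); [|destruct eps; simpl; lra].
  apply Rmult_le_reg_r with (Cmod (w - z)); auto.
  unfold Rdiv at 1; rewrite Rmult_assoc, Rinv_l, Rmult_1_r; [exact Hw|lra].
- apply filter_forall; intros w; unfold Q; destruct (dec w) as [e|e].
    subst w; Cring.
  carriers; field; intros h; apply e; replace w with ((w - z) + z)%C by ring; rewrite h; ring.
Qed.

Lemma cdiff_continuous F z l : cdiff F z l -> continuous F z.
Proof.
intros (Q & HQ & Ql & HF).
apply continuous_ext_loc with (fun w => F z + Q w * (w - z))%C.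
  revert HF; apply filter_imp; intros; auto.
apply continuous_Cplus; [apply continuous_const|].
apply continuous_Cmult; auto.
apply continuous_Cplus; [apply continuous_Cid|apply continuous_const].
Qed.

Lemma cdiff_ext_loc F G z l : locally z (fun w => F w = G w) -> cdiff F z l -> cdiff G z l.
Proof.
intros H (Q & HQ & Ql & HF); exists Q; repeat split; auto.
generalize (filter_and _ _ H HF); apply filter_imp; intros w [h1 h2].
rewrite <- h1, h2, (locally_singleton _ _ H); reflexivity.
Qed.

Lemma cdiff_const c z : cdiff (fun _ => c) z 0.
Proof.
exists (fun _ => RtoC 0); repeat split; [apply continuous_const|].
apply filter_forall; intros; Cring.
Qed.

Lemma cdiff_id z : cdiff (fun w => w) z 1.
Proof.
exists (fun _ => RtoC 1); repeat split; [apply continuous_const|].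
apply filter_forall; intros; Cring.
Qed.

Lemma cdiff_plus F G z l m :
  cdiff F z l -> cdiff G z m -> cdiff (fun w => F w + G w)%C z (l + m)%C.
Proof.
intros (Q & HQ & Ql & HF) (S & HS & Sl & HG).
exists (fun w => Q w + S w)%C; repeat split.
- apply continuous_Cplus; auto.
- congruence.
- generalize (filter_and _ _ HF HG); apply filter_imp; intros w [h1 h2].
  rewrite h1, h2; Cring.
Qed.

Lemma cdiff_mult F G z l m :
  cdiff F z l -> cdiff G z m -> cdiff (fun w => F w * G w)%C z (l * G z + F z * m)%C.
Proof.
intros HF0 HG0; generalize HF0 HG0.
intros (Q & HQ & Ql & HF) (S & HS & Sl & HG).
exists (fun w => Q w * G w + F z * S w)%C; repeat split.
- apply continuous_Cplus; apply continuous_Cmult; auto.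
    apply cdiff_continuous with (1 := HG0).
  apply continuous_const.
- congruence.
- generalize (filter_and _ _ HF HG); apply filter_imp; intros w [h1 h2].
  rewrite h1 at 1; rewrite h2; Cring.
Qed.

Lemma cdiff_inv F z l :
  cdiff F z l -> F z <> 0 -> cdiff (fun w => / F w)%C z (- l / (F z * F z))%C.
Proof.
intros HF0 H0; generalize HF0; intros (Q & HQ & Ql & HF).
pose proof (cdiff_continuous _ _ _ HF0) as HFc.
exists (fun w => Q w * (- / F z) * / F w)%C; repeat split.
- apply continuous_Cmult; [apply continuous_Cmult; auto|].
    apply continuous_const.
  apply continuous_Cinv; auto.
- rewrite Ql; field; auto.
- assert (Hnz : locally z (fun w => F w <> 0)).
  { apply continuous_Cmod with (eps := mkposreal _ (proj1 (Cmod_gt_0 _) H0)) in HFc.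
    revert HFc; apply filter_imp; intros w Hw e; simpl in Hw.
    rewrite e in Hw; replace (0 - F z)%C with (- F z)%C in Hw by ring.
    rewrite Cmod_opp in Hw; lra. }
  generalize (filter_and _ _ HF Hnz); apply filter_imp; intros w [h1 h2].
  apply (f_equal (fun u => (u - F z)%C)) in h1.
  replace (F z + Q w * (w - z) - F z)%C with (Q w * (w - z))%C in h1 by ring.
  transitivity (/ F z - (F w - F z) * / F z * / F w)%C; [field; auto|].
  rewrite h1; Cring.
Qed.

Lemma is_derive_Caratheodory (f : R -> R) (x l : R) :
  is_derive f x l <->
  exists q : R -> R, continuous q x /\ q x = l /\
    locally x (fun y => f y = f x + q y * (y - x)).
Proof.
split.
- intros H.
  set (q := fun y => if Req_EM_T y x then l else (f y - f x) / (y - x)).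
  assert (qx : q x = l) by (unfold q; destruct (Req_EM_T x x); congruence).
  exists q; repeat split; auto.
  + apply is_derive_Reals in H.
    apply continuity_pt_filterlim.
    apply continuity_pt_locally; intros eps.
    destruct (H eps (cond_pos eps)) as [d Hd].
    exists d; intros y Hy; carriers.
    rewrite qx; unfold q; destruct (Req_EM_T y x) as [e|e].
      rewrite Rminus_diag, Rabs_R0; apply eps.
    specialize (Hd (y - x)); replace (x + (y - x)) with y in Hd by ring.
    apply Hd; [lra|exact Hy].
  + apply filter_forall; intros y; carriers; unfold q; destruct (Req_EM_T y x) as [e|e].
      rewrite e; ring.
    field; lra.
- intros (q & Hq & ql & Hf).
  apply is_derive_Reals; intros eps He.
  apply continuity_pt_filterlim in Hq.
  generalize (proj1 (continuity_pt_locally q x) Hq (mkposreal _ He)); intros Hl.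
  destruct (filter_and _ _ Hl Hf) as [d Hd].
  exists d; intros h h0 hd.
  destruct (Hd (x + h)) as [h1 h2].
  { unfold ball; simpl; unfold AbsRing_ball, abs, minus, plus, opp; simpl.
    replace (x + h + - x) with h by ring; exact hd. }
  rewrite h2; replace ((f x + q (x + h) * (x + h - x) - f x) / h) with (q (x + h))
    by (field; auto).
  rewrite <- ql; exact h1.
Qed.

(** Chain rule along a plane curve: in Caratheodory's form the slope of the composite is the slope
    [Q] of F along the curve times the slopes (q1, q2) of the curve. *)
Lemma is_derive_cdiff_comp (F : C -> C) (l : C) (g1 g2 : R -> R) (t d1 d2 : R) :
  cdiff F (g1 t, g2 t) l -> is_derive g1 t d1 -> is_derive g2 t d2 ->
  is_derive (fun s => Re (F (g1 s, g2 s))) t (Re (l * (d1, d2))%C) /\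
  is_derive (fun s => Im (F (g1 s, g2 s))) t (Im (l * (d1, d2))%C).
Proof.
intros (Q & HQ & Ql & HF) H1 H2.
assert (Hc : continuous (fun s => (g1 s, g2 s) : C) t).
{ apply continuous_Cpair.
  - apply (ex_derive_continuous (V := R_NormedModule) g1); eexists; eauto.
  - apply (ex_derive_continuous (V := R_NormedModule) g2); eexists; eauto. }
apply is_derive_Caratheodory in H1; destruct H1 as (q1 & Hq1 & qd1 & Hg1).
apply is_derive_Caratheodory in H2; destruct H2 as (q2 & Hq2 & qd2 & Hg2).
assert (HQc : continuous (fun s => Q (g1 s, g2 s) * (q1 s, q2 s))%C t).
{ apply continuous_Cmult.
  - apply (continuous_comp (fun s => (g1 s, g2 s) : C) Q); auto.
  - apply continuous_Cpair; auto. }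
assert (HE : locally t (fun s => F (g1 s, g2 s) =
   F (g1 t, g2 t) + (Q (g1 s, g2 s) * (q1 s, q2 s)) * (s - t)%R)%C).
{ specialize (Hc _ HF); unfold filtermap in Hc.
  generalize (filter_and _ _ Hc (filter_and _ _ Hg1 Hg2)).
  apply filter_imp; intros s (h1 & h2 & h3); rewrite h1.
  rewrite <- Cmult_assoc; apply (f_equal (fun v => F (g1 t, g2 t) + Q (g1 s, g2 s) * v)%C).
  carriers; apply injective_projections; simpl; [rewrite h2|rewrite h3]; ring. }
split; apply is_derive_Caratheodory.
- exists (fun s => Re (Q (g1 s, g2 s) * (q1 s, q2 s))%C); repeat split.
  + apply continuous_CRe; auto.
  + rewrite Ql, qd1, qd2; reflexivity.
  + revert HE; apply filter_imp; intros s Hs; rewrite Hs; carriers; unfold Re, Im; simpl; ring.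
- exists (fun s => Im (Q (g1 s, g2 s) * (q1 s, q2 s))%C); repeat split.
  + apply continuous_CIm; auto.
  + rewrite Ql, qd1, qd2; reflexivity.
  + revert HE; apply filter_imp; intros s Hs; rewrite Hs; carriers; unfold Re, Im; simpl; ring.
Qed.

(** The derivative travels along as data, and its continuity is part of the notion because Cauchy's
    formula is proved by differentiating under the integral sign. *)
Definition holo (R0 : R) (F F' : C -> C) : Prop :=
  forall z : C, Cmod z < R0 -> cdiff F z (F' z) /\ continuous F' z.

Lemma holo_const R0 c : holo R0 (fun _ => c) (fun _ => RtoC 0).
Proof. intros z _; split; [apply cdiff_const|apply continuous_const]. Qed.

Lemma holo_id R0 : holo R0 (fun z => z) (fun _ => RtoC 1).
Proof. intros z _; split; [apply cdiff_id|apply continuous_const]. Qed.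

Lemma holo_plus R0 F F' G G' : holo R0 F F' -> holo R0 G G' ->
  holo R0 (fun z => F z + G z)%C (fun z => F' z + G' z)%C.
Proof.
intros HF HG z Hz; destruct (HF z Hz), (HG z Hz); split.
- apply cdiff_plus; auto.
- apply continuous_Cplus; auto.
Qed.

Lemma holo_mult R0 F F' G G' : holo R0 F F' -> holo R0 G G' ->
  holo R0 (fun z => F z * G z)%C (fun z => F' z * G z + F z * G' z)%C.
Proof.
intros HF HG z Hz; destruct (HF z Hz), (HG z Hz); split.
- apply cdiff_mult; auto.
- apply continuous_Cplus; apply continuous_Cmult; auto; eapply cdiff_continuous; eauto.
Qed.

Lemma holo_inv R0 F F' : holo R0 F F' -> (forall z, Cmod z < R0 -> F z <> 0) ->
  holo R0 (fun z => / F z)%C (fun z => F' z * (- / F z) * / F z)%C.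
Proof.
intros HF H0 z Hz; destruct (HF z Hz) as [h1 h2]; pose proof (H0 z Hz) as h0.
assert (hc : continuous F z) by (eapply cdiff_continuous; eauto).
split.
- replace (F' z * (- / F z) * / F z)%C with (- F' z / (F z * F z))%C by (field; auto).
  apply cdiff_inv; auto.
- apply continuous_Cmult; [apply continuous_Cmult; auto|].
  + apply continuous_ext with (fun w => (RtoC (-1)) * / F w)%C; [intros w; apply injective_projections; simpl; ring|].
    apply continuous_Cmult; [apply continuous_const|apply continuous_Cinv; auto].
  + apply continuous_Cinv; auto.
Qed.

Lemma holo_restrict r R0 F F' : r <= R0 -> holo R0 F F' -> holo r F F'.
Proof. intros H HF z Hz; apply HF; lra. Qed.

Lemma holo_ext R0 F G F' : (forall z, Cmod z < R0 -> F z = G z) -> holo R0 F F' -> holo R0 G F'.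
Proof.
intros H HF z Hz; destruct (HF z Hz) as [h1 h2]; split; auto.
apply cdiff_ext_loc with (2 := h1).
apply locally_Cmod.
assert (Hd : 0 < R0 - Cmod z) by lra.
exists (mkposreal _ Hd); simpl; intros w Hw; apply H.
replace w with ((w - z) + z)%C by ring.
apply Rle_lt_trans with (1 := Cmod_triangle _ _); lra.
Qed.

(** * Cauchy's formula *)

Definition circ (rho t : R) : C := (rho * cos t, rho * sin t).

Lemma Cmod_circ rho t : 0 <= rho -> Cmod (circ rho t) = rho.
Proof.
intros H; unfold Cmod, circ; simpl.
transitivity (sqrt (Rsqr rho)); [f_equal|apply sqrt_Rsqr; auto].
generalize (sin2_cos2 t); unfold Rsqr; intros E; nra.
Qed.

Lemma is_derive_circ rho t :
  is_derive (fun s => Re (circ rho s)) t (Re (Ci * circ rho t)%C) /\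
  is_derive (fun s => Im (circ rho s)) t (Im (Ci * circ rho t)%C).
Proof.
split; simpl.
- auto_derive; auto; ring.
- auto_derive; auto; ring.
Qed.

Lemma continuous_circ rho t : continuous (circ rho) t.
Proof.
destruct (is_derive_circ rho t) as [h1 h2].
apply continuous_Cpair.
- apply (ex_derive_continuous (V := R_NormedModule) (fun s => Re (circ rho s))); eexists; eauto.
- apply (ex_derive_continuous (V := R_NormedModule) (fun s => Im (circ rho s))); eexists; eauto.
Qed.

Lemma circ_minus_nz rho z t : 0 <= Cmod z < rho -> (circ rho t - z)%C <> 0.
Proof.
intros H e.
assert (E : circ rho t = z) by (replace (circ rho t) with ((circ rho t - z) + z)%C by ring; rewrite e; ring).
generalize (Cmod_circ rho t); rewrite E; lra.
Qed.

Section Homotopy.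

Variables (R0 rho : R) (F F' : C -> C) (z : C).
Hypothesis (HF : holo R0 F F') (Hz : Cmod z < rho) (Hrho : rho < R0).

Let seg (s t : R) : C := (z + s * (circ rho t - z))%C.
(** An open condition on s that keeps the circle with parameter s inside the disc of holomorphy. It
    holds around every point of [0, 1], as two-sided derivatives in s are taken at the end points
    too. *)
Let good (s : R) : Prop := Rabs (1 - s) * Cmod z + Rabs s * rho < R0.

Let rho_pos : 0 < rho.
Proof. pose proof (Cmod_ge_0 z); lra. Qed.

Let seg_in (s t : R) : good s -> Cmod (seg s t) < R0.
Proof.
intros H; unfold good in H; unfold seg.
replace (z + s * (circ rho t - z))%C with (RtoC (1 - s) * z + s * circ rho t)%C.
2: rewrite RtoC_minus; ring.
apply Rle_lt_trans with (1 := Cmod_triangle _ _).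
rewrite !Cmod_mult, Cmod_circ, !Cmod_R; lra.
Qed.

Let good_loc (s : R) : 0 <= s <= 1 -> locally s good.
Proof.
intros Hs; pose proof (Cmod_ge_0 z) as H0.
(* On [0, 1] the bound |1 - s| |z| + |s| rho is at most rho; a change of s by less than d raises it
   by at most 2 rho d = R0 - rho. *)
assert (Hd : 0 < (R0 - rho) / (2 * rho)).
{ apply Rdiv_lt_0_compat; lra. }
exists (mkposreal _ Hd); intros u Hu.
unfold ball in Hu; simpl in Hu; unfold AbsRing_ball, abs, minus, plus, opp in Hu; simpl in Hu.
unfold good.
set (d := (R0 - rho) / (2 * rho)) in *.
assert (Ed : 2 * rho * d = R0 - rho) by (unfold d; field; lra).
assert (H1 : Rabs (1 - u) <= (1 - s) + d).
{ replace (1 - u) with ((1 - s) + - (u + - s)) by ring.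
  apply Rle_trans with (1 := Rabs_triang _ _); rewrite Rabs_Ropp, (Rabs_pos_eq (1 - s)); lra. }
assert (H2 : Rabs u <= s + d).
{ replace u with (s + (u + - s)) at 1 by ring.
  apply Rle_trans with (1 := Rabs_triang _ _); rewrite (Rabs_pos_eq s); lra. }
pose proof (Rabs_pos (1 - u)) as P1; pose proof (Rabs_pos u) as P2.
assert (Rabs (1 - u) * Cmod z <= (1 - s + d) * Cmod z) by nra.
assert (Rabs u * rho <= (s + d) * rho) by nra.
destruct (Rle_lt_or_eq_dec 0 (1 - s + d)) as [h|h]; [lra| |].
- assert ((1 - s + d) * Cmod z < (1 - s + d) * rho) by nra.
  nra.
- lra.
Qed.

Let seg_cont (s t : R) : continuous (fun y : R * R => seg (fst y) (snd y)) (s, t).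
Proof.
unfold seg.
apply continuous_Cplus; [apply continuous_const|apply continuous_Cmult].
- apply continuous_Cpair; [apply continuous_fst|apply continuous_const].
- apply continuous_Cplus; [|apply continuous_const].
  apply (continuous_comp (fun y : R * R => snd y) (circ rho)); [apply continuous_snd|apply continuous_circ].
Qed.

Let seg_cont_r (s t : R) : continuous (fun y => seg s y) t.
Proof.
unfold seg.
apply continuous_Cplus; [apply continuous_const|apply continuous_Cmult; [apply continuous_const|]].
apply continuous_Cplus; [apply continuous_circ|apply continuous_const].
Qed.

(** Cauchy's kernel: since d zeta = i zeta dt on the circle, d zeta / (i (zeta - z)) is [kap t]
    dt. *)
Let kap (t : R) : C := (circ rho t / (circ rho t - z))%C.

Let kap_cont (t : R) : continuous kap t.
Proof.
unfold kap; apply continuous_Cmult; [apply continuous_circ|].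
apply continuous_Cinv; [|apply circ_minus_nz; pose proof (Cmod_ge_0 z); lra].
apply continuous_Cplus; [apply continuous_circ|apply continuous_const].
Qed.

(** The velocity of [seg] in s is [circ rho t - z], which cancels the denominator of the kernel. *)
Let deriv_s (s t : R) : good s ->
  is_derive (fun u => Re (F (seg u t) * kap t)%C) s (Re (F' (seg s t) * circ rho t)%C).
Proof.
intros Hs.
destruct (HF _ (seg_in s t Hs)) as [Hd _].
set (g1 := fun u => Re (seg u t)); set (g2 := fun u => Im (seg u t)).
assert (Hg : forall u, seg u t = (g1 u, g2 u)) by (intros; apply injective_projections; reflexivity).
assert (E : Re (F' (seg s t) * circ rho t)%C =
  Re ((F' (seg s t) * kap t + F (seg s t) * 0) * (Re (circ rho t - z), Im (circ rho t - z)))%C).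
{ replace (Re (circ rho t - z), Im (circ rho t - z)) with (circ rho t - z)%C
    by (apply injective_projections; reflexivity).
  apply (f_equal Re); unfold kap; field.
  apply circ_minus_nz; pose proof (Cmod_ge_0 z); lra. }
rewrite E.
apply (is_derive_ext (fun u => Re ((fun w => F w * kap t)%C (g1 u, g2 u)))).
  intros u; simpl; rewrite <- Hg; reflexivity.
apply (is_derive_cdiff_comp (fun w => F w * kap t)%C _ g1 g2).
- rewrite <- Hg; apply cdiff_mult; auto; apply cdiff_const.
- unfold g1, seg; simpl; auto_derive; auto; ring.
- unfold g2, seg; simpl; auto_derive; auto; ring.
Qed.

(** The velocity of [seg] in t is s i [circ rho t]. The factor i turns the real part met in
    [deriv_s] into an imaginary part, so that up to the factor s that integrand is an exact
    derivative in t. *)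
Let deriv_t (s t : R) : good s ->
  is_derive (fun u => Im (F (seg s u))) t (s * Re (F' (seg s t) * circ rho t)%C).
Proof.
intros Hs.
destruct (HF _ (seg_in s t Hs)) as [Hd _].
set (g1 := fun u => Re (seg s u)); set (g2 := fun u => Im (seg s u)).
assert (Hg : forall u, seg s u = (g1 u, g2 u)) by (intros; apply injective_projections; reflexivity).
assert (E : s * Re (F' (seg s t) * circ rho t)%C =
  Im (F' (seg s t) * (Re (s * (Ci * circ rho t)), Im (s * (Ci * circ rho t))))%C).
{ destruct (F' (seg s t)); simpl; ring. }
rewrite E.
apply (is_derive_ext (fun u => Im (F (g1 u, g2 u)))).
  intros u; rewrite <- Hg; reflexivity.
apply (is_derive_cdiff_comp F _ g1 g2).
- rewrite <- Hg; auto.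
- unfold g1, seg; simpl; auto_derive; auto; ring.
- unfold g2, seg; simpl; auto_derive; auto; ring.
Qed.

Let der_cont_r (s t : R) : good s -> continuous (fun u => Re (F' (seg s u) * circ rho u)%C) t.
Proof.
intros Hs; apply continuous_CRe, continuous_Cmult; [|apply continuous_circ].
apply (continuous_comp (fun u => seg s u) F'); [apply seg_cont_r|].
apply HF; apply seg_in; auto.
Qed.

Let J (s : R) : R := RInt (fun t => Re (F (seg s t) * kap t)%C) 0 (2 * PI).

Let int_ex (s : R) : good s -> ex_RInt (fun t => Re (F (seg s t) * kap t)%C) 0 (2 * PI).
Proof.
intros Hs; apply (ex_RInt_continuous (V := R_CompleteNormedModule)); intros t _.
apply continuous_CRe, continuous_Cmult; [|apply kap_cont].
apply (continuous_comp (fun u => seg s u) F); [apply seg_cont_r|].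
eapply cdiff_continuous; apply HF; apply seg_in; auto.
Qed.

Let J_deriv (s : R) : 0 <= s <= 1 ->
  is_derive J s (RInt (fun t => Re (F' (seg s t) * circ rho t)%C) 0 (2 * PI)).
Proof.
intros Hs.
assert (Hg := locally_singleton _ _ (good_loc s Hs)).
replace (RInt (fun t => Re (F' (seg s t) * circ rho t)%C) 0 (2 * PI))
  with (RInt (fun t => Derive (fun u => Re (F (seg u t) * kap t)%C) s) 0 (2 * PI)).
2:{ apply RInt_ext; intros t _; apply is_derive_unique, deriv_s; auto. }
apply (is_derive_RInt_param (fun u t => Re (F (seg u t) * kap t)%C)).
- generalize (good_loc s Hs); apply filter_imp; intros u Hu t _.
  eexists; apply deriv_s; auto.
- intros t _.
  apply continuity_2d_pt_ext_loc with (fun u v => Re (F' (seg u v) * circ rho v)%C).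
  + destruct (good_loc s Hs) as [d Hd]; exists d; intros u v Hu _.
    symmetry; apply is_derive_unique, deriv_s, Hd; exact Hu.
  + apply continuity_2d_pt_filterlim.
    apply (continuous_CRe (fun y : R * R => F' (seg (fst y) (snd y)) * circ rho (snd y))%C (s, t)).
    apply continuous_Cmult.
    * apply (continuous_comp (fun y : R * R => seg (fst y) (snd y)) F'); [apply seg_cont|].
      apply HF; apply seg_in; auto.
    * apply (continuous_comp (fun y : R * R => snd y) (circ rho)); [apply continuous_snd|apply continuous_circ].
- generalize (good_loc s Hs); apply filter_imp; intros u Hu; apply int_ex; auto.
Qed.

Let J_deriv0 (s : R) : 0 < s <= 1 -> is_derive J s 0.
Proof.
intros Hs.
assert (Hg : good s) by (apply locally_singleton, good_loc; lra).
replace 0 with (RInt (fun t => Re (F' (seg s t) * circ rho t)%C) 0 (2 * PI)); [apply J_deriv; lra|].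
apply is_RInt_unique.
(* The circle is closed: the primitive takes the same value at both ends of the parameter
   interval. *)
replace 0 with (/ s * Im (F (seg s (2 * PI))) - / s * Im (F (seg s 0))) at 2.
2:{ unfold seg, circ; rewrite cos_2PI, sin_2PI, cos_0, sin_0; ring. }
apply (is_RInt_derive (V := R_CompleteNormedModule) (fun u => / s * Im (F (seg s u)))).
- intros t _.
  replace (Re (F' (seg s t) * circ rho t)%C) with (/ s * (s * Re (F' (seg s t) * circ rho t)%C)) by (field; lra).
  apply (is_derive_scal (fun u => Im (F (seg s u)))); apply deriv_t; auto.
- intros t _; apply der_cont_r; auto.
Qed.

(* Shrinking the circle to the point [z] does not change the integral, because the
   derivative in [s] is, up to the factor [s], the integral of a derivative in [t]. *)
Lemma Cauchy_homotopy :
  RInt (fun t => Re (F (circ rho t) * (circ rho t / (circ rho t - z)))%C) 0 (2 * PI) =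
  RInt (fun t => Re (F z * (circ rho t / (circ rho t - z)))%C) 0 (2 * PI) /\
  ex_RInt (fun t => Re (F (circ rho t) * (circ rho t / (circ rho t - z)))%C) 0 (2 * PI).
Proof.
assert (E1 : forall t, seg 1 t = circ rho t) by (intros; unfold seg; ring).
assert (E0 : forall t, seg 0 t = z) by (intros; unfold seg; ring).
split.
2:{ assert (Hg : good 1) by (apply locally_singleton, good_loc; lra).
    generalize (int_ex 1 Hg); apply ex_RInt_ext; intros t _; rewrite E1; reflexivity. }
transitivity (J 1).
  apply RInt_ext; intros t _; rewrite E1; reflexivity.
transitivity (J 0).
2: apply RInt_ext; intros t _; rewrite E0; reflexivity.
(* The division by s leaves out s = 0; there differentiability of J is used only to get
   continuity. *)
destruct (MVT_gen J 0 1 (fun _ => 0)) as [c [_ Hc]].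
- rewrite Rmin_left, Rmax_right; try lra; intros s Hs; apply J_deriv0; lra.
- rewrite Rmin_left, Rmax_right; try lra; intros s Hs.
  apply continuity_pt_filterlim, (ex_derive_continuous (V := R_NormedModule) J).
  eexists; apply J_deriv; auto.
- lra.
Qed.

End Homotopy.

Lemma mean_value R0 rho F F' : holo R0 F F' -> 0 < rho < R0 ->
  RInt (fun t => Re (F (circ rho t))) 0 (2 * PI) = 2 * PI * Re (F 0).
Proof.
intros HF Hr.
destruct (Cauchy_homotopy R0 rho F F' 0) as [H _]; auto; try lra.
  rewrite Cmod_0; lra.
assert (E : forall (c : C) t, (c * (circ rho t / (circ rho t - 0)) = c)%C).
{ intros c t; field.
  replace (circ rho t) with (circ rho t - 0)%C by ring.
  apply circ_minus_nz; rewrite Cmod_0; lra. }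
transitivity (RInt (fun t => Re (F (circ rho t) * (circ rho t / (circ rho t - 0)))%C) 0 (2 * PI)).
  apply RInt_ext; intros t _; rewrite E; reflexivity.
rewrite H; transitivity (RInt (fun _ => Re (F 0)) 0 (2 * PI)).
  apply RInt_ext; intros t _; rewrite E; reflexivity.
rewrite RInt_const.
change (scal (2 * PI - 0) (Re (F 0))) with ((2 * PI - 0) * Re (F 0)); Cring.
Qed.

(** The radius is the harmonic mean of rho and rho^2 / r, the modulus of the mirror image in the
    circle of a point of modulus r; written in this way it also makes sense at r = 0. *)
Lemma mirror_radius (rho r : R) : 0 <= r < rho ->
  exists R0, rho < R0 /\ forall s, s < R0 -> s * r < rho ^ 2.
Proof.
intros H; exists (2 * rho ^ 2 / (rho + r)).
assert (E : 2 * rho ^ 2 / (rho + r) * (rho + r) = 2 * rho ^ 2) by (field; lra).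
set (q := 2 * rho ^ 2 / (rho + r)) in *.
assert (Hq : rho < q) by nra.
split; auto; intros s Hs.
destruct (Rle_lt_dec s 0); [nra|].
assert (s * r <= q * r) by nra.
assert (q * r < rho ^ 2) by nra.
lra.
Qed.

Lemma circ_conj rho t : (circ rho t * Cconj (circ rho t))%C = RtoC (rho ^ 2).
Proof.
apply injective_projections; simpl; [|ring].
generalize (sin2_cos2 t); unfold Rsqr; intros E; nra.
Qed.

Lemma mirror_nz rho z w : Cmod w * Cmod z < rho ^ 2 -> (RtoC (rho ^ 2) - Cconj z * w)%C <> 0.
Proof.
intros H e.
assert (E : Cmod (RtoC (rho ^ 2)) = Cmod (Cconj z * w)).
{ f_equal; replace (RtoC (rho ^ 2)) with ((RtoC (rho ^ 2) - Cconj z * w) + Cconj z * w)%C by ring; rewrite e; ring. }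
rewrite Cmod_mult, Cmod_conj, Cmod_R, Rabs_pos_eq in E; nra.
Qed.

(** The only possible pole is rho^2 / conj z, the mirror image of z in the circle, which the
    hypothesis keeps out of the open disc of radius [R0]. *)
Lemma holo_mirror (R0 rho : R) (z : C) : (forall s, s < R0 -> s * Cmod z < rho ^ 2) ->
  exists D, holo R0 (fun w => / (RtoC (rho ^ 2) - Cconj z * w))%C D.
Proof.
intros H; eexists.
apply holo_ext with (fun w => / (RtoC (rho ^ 2) + (- Cconj z) * w))%C.
  intros w _; f_equal; ring.
apply holo_inv.
- apply holo_plus; [apply holo_const|apply holo_mult; [apply holo_const|apply holo_id]].
- intros w Hw.
  replace (RtoC (rho ^ 2) + (- Cconj z) * w)%C with (RtoC (rho ^ 2) - Cconj z * w)%C by ring.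
  apply mirror_nz; auto.
Qed.

(* The conjugate of the kernel is [rho^2 / (rho^2 - conj z * zeta)], which is
   holomorphic in [zeta] on a disc containing the circle. *)
Lemma Cauchy_kernel_integral rho z c : Cmod z < rho ->
  RInt (fun t => Re (c * (circ rho t / (circ rho t - z)))%C) 0 (2 * PI) = 2 * PI * Re c.
Proof.
intros Hz; pose proof (Cmod_ge_0 z) as H0.
destruct (mirror_radius rho (Cmod z)) as (R0 & h1 & h2); [lra|].
destruct (holo_mirror R0 rho z h2) as [D HD].
generalize (mean_value R0 rho _ _ (holo_mult _ _ _ _ _ (holo_const R0 (Cconj c * RtoC (rho ^ 2))%C) HD)).
intros H; specialize (H ltac:(lra)).
assert (Hr : RtoC (rho ^ 2) <> 0) by (intros e; apply RtoC_inj in e; nra).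
replace (Re c) with (Re (Cconj c * RtoC (rho ^ 2) * / (RtoC (rho ^ 2) - Cconj z * 0))%C).
2:{ transitivity (Re (Cconj c)); [apply f_equal; field; auto|apply re_conj]. }
rewrite <- H; apply RInt_ext; intros t _.
rewrite <- re_conj; apply f_equal.
assert (Hc : (circ rho t - z)%C <> 0) by (apply circ_minus_nz; lra).
rewrite Cmult_conj, Cdiv_conj, Cminus_conj; auto.
assert (Hw : (RtoC (rho ^ 2) - Cconj z * circ rho t)%C <> 0).
{ apply mirror_nz; rewrite Cmod_circ; [|lra]; nra. }
assert (Hct : circ rho t <> 0).
{ intros e; generalize (Cmod_circ rho t); rewrite e, Cmod_0; lra. }
generalize (circ_conj rho t); intros E.
rewrite <- E in *.
field; repeat split; auto.
- rewrite <- Cminus_conj; intros e; apply Hc.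
  rewrite <- (Cconj_conj (circ rho t - z)), e; apply injective_projections; simpl; ring.
Qed.

Lemma Cauchy_formula R0 rho F F' z : holo R0 F F' -> Cmod z < rho -> rho < R0 ->
  is_RInt (fun t => Re (F (circ rho t) * (circ rho t / (circ rho t - z)))%C) 0 (2 * PI)
    (2 * PI * Re (F z)).
Proof.
intros HF Hz Hr.
destruct (Cauchy_homotopy R0 rho F F' z) as [H1 H2]; auto.
rewrite <- (Cauchy_kernel_integral rho z (F z)), <- H1; auto.
apply (RInt_correct (V := R_CompleteNormedModule)); auto.
Qed.

(** * Harnack's inequality *)

Lemma PI2_pos : 0 < 2 * PI.
Proof. pose proof PI_RGT_0; lra. Qed.

Lemma Re_mult_RtoC (c : C) (r : R) : Re (c * RtoC r)%C = Re c * r.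
Proof. unfold Re; simpl; ring. Qed.

Lemma Cmod_minus_bounds (w z : C) : Cmod w - Cmod z <= Cmod (w - z) <= Cmod w + Cmod z.
Proof.
split.
- generalize (Cmod_triangle (w - z) z); replace (w - z + z)%C with w by ring; lra.
- generalize (Cmod_triangle w (- z)); rewrite Cmod_opp; intros H; exact H.
Qed.

Lemma ex_RInt_circ R0 rho F F' : holo R0 F F' -> 0 < rho < R0 ->
  ex_RInt (fun t => Re (F (circ rho t))) 0 (2 * PI).
Proof.
intros HF Hr; apply (ex_RInt_continuous (V := R_CompleteNormedModule)); intros t _.
apply continuous_CRe, (continuous_comp (circ rho) F); [apply continuous_circ|].
eapply cdiff_continuous; apply HF; rewrite Cmod_circ; lra.
Qed.

(** Cauchy's formula for w |-> P w (rho^2 - |z|^2) / (rho^2 - conj z w), whose value at w = z is P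
    z. On the circle rho^2 - conj z zeta = zeta conj (zeta - z), so its product with the kernel zeta
    / (zeta - z) contains exactly the Poisson kernel. *)
Lemma Poisson_formula P P' rho z : holo 1 P P' -> Cmod z < rho -> rho < 1 ->
  is_RInt (fun t => Re (P (circ rho t)) * ((rho ^ 2 - Cmod z ^ 2) / Cmod (circ rho t - z) ^ 2))
    0 (2 * PI) (2 * PI * Re (P z)).
Proof.
intros HP Hz Hr; pose proof (Cmod_ge_0 z) as H0.
destruct (mirror_radius rho (Cmod z)) as (R0 & h1 & h2); [lra|].
destruct (holo_mirror R0 rho z h2) as [D HD].
assert (HG := holo_mult _ _ _ _ _
  (holo_mult _ _ _ _ _ (holo_restrict _ _ _ _ (Rmin_r R0 1) HP)
     (holo_const _ (RtoC (rho ^ 2 - Cmod z ^ 2))))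
  (holo_restrict _ _ _ _ (Rmin_l R0 1) HD)).
assert (Hm : rho < Rmin R0 1) by (apply Rmin_glb_lt; lra).
generalize (Cauchy_formula _ rho _ _ z HG Hz Hm).
assert (Ez : (RtoC (rho ^ 2) - Cconj z * z)%C = RtoC (rho ^ 2 - Cmod z ^ 2)).
{ rewrite RtoC_minus, Cmod2_conj; ring. }
rewrite Ez.
replace (P z * RtoC (rho ^ 2 - Cmod z ^ 2) * / RtoC (rho ^ 2 - Cmod z ^ 2))%C with (P z).
2: { field; intros e; apply RtoC_inj in e; nra. }
apply is_RInt_ext; intros t _.
assert (Hc : (circ rho t - z)%C <> 0) by (apply circ_minus_nz; lra).
assert (Hc2 : (Cconj (circ rho t) - Cconj z)%C <> 0).
{ rewrite <- Cminus_conj; intros e; apply Hc.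
  rewrite <- (Cconj_conj (circ rho t - z)), e; apply injective_projections; simpl; ring. }
assert (Hct : circ rho t <> 0).
{ intros e; generalize (Cmod_circ rho t); rewrite e, Cmod_0; lra. }
transitivity (Re (P (circ rho t) * RtoC ((rho ^ 2 - Cmod z ^ 2) / Cmod (circ rho t - z) ^ 2))%C).
2: apply Re_mult_RtoC.
apply f_equal.
assert (HM : Cmod (circ rho t - z) ^ 2 <> 0).
{ apply pow_nonzero; intros e; apply Cmod_eq_0 in e; auto. }
rewrite RtoC_div, Cmod2_conj, Cminus_conj; auto.
set (k := RtoC (rho ^ 2 - Cmod z ^ 2)).
rewrite <- (circ_conj rho t).
field; repeat split; auto.
intros e; apply Hc2.
replace (circ rho t * Cconj (circ rho t) - Cconj z * circ rho t)%C
  with (circ rho t * (Cconj (circ rho t) - Cconj z))%C in e by ring.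
destruct (Ceq_dec (Cconj (circ rho t) - Cconj z) 0) as [h|h]; auto.
exfalso; revert e; apply Cmult_neq_0; auto.
Qed.

Lemma Poisson_kernel_bounds rho r m : 0 <= r < rho -> rho - r <= m <= rho + r ->
  (rho - r) / (rho + r) <= (rho ^ 2 - r ^ 2) / m ^ 2 <= (rho + r) / (rho - r).
Proof.
intros H Hm.
assert (0 < m ^ 2) by nra.
split.
- apply Rmult_le_reg_r with (m ^ 2 * (rho + r)); [nra|].
  replace ((rho - r) / (rho + r) * (m ^ 2 * (rho + r))) with ((rho - r) * m ^ 2) by (field; lra).
  replace ((rho ^ 2 - r ^ 2) / m ^ 2 * (m ^ 2 * (rho + r))) with ((rho - r) * (rho + r) ^ 2) by (field; lra).
  apply Rmult_le_compat_l; nra.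
- apply Rmult_le_reg_r with (m ^ 2 * (rho - r)); [nra|].
  replace ((rho + r) / (rho - r) * (m ^ 2 * (rho - r))) with ((rho + r) * m ^ 2) by (field; lra).
  replace ((rho ^ 2 - r ^ 2) / m ^ 2 * (m ^ 2 * (rho - r))) with ((rho + r) * (rho - r) ^ 2) by (field; lra).
  apply Rmult_le_compat_l; nra.
Qed.

(** Poisson's formula integrates the nonnegative Re P against a kernel lying between (rho - |z|) /
    (rho + |z|) and its inverse, and the mean value property evaluates the integral of Re P alone.
    The circle has radius rho < 1 because P is given on the open disc. *)
Lemma Harnack_rho P P' rho z : holo 1 P P' -> (forall w, Cmod w < 1 -> 0 <= Re (P w)) ->
  Cmod z < rho -> rho < 1 ->
  (rho - Cmod z) / (rho + Cmod z) * Re (P 0) <= Re (P z) <= (rho + Cmod z) / (rho - Cmod z) * Re (P 0).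
Proof.
intros HP Hpos Hz Hr; pose proof (Cmod_ge_0 z) as H0; pose proof PI2_pos as Hpi.
assert (Hi := Poisson_formula P P' rho z HP Hz Hr).
assert (Hmv := mean_value 1 rho P P' HP ltac:(lra)).
assert (Hex := ex_RInt_circ 1 rho P P' HP ltac:(lra)).
assert (HP0 : forall t, 0 <= Re (P (circ rho t))) by (intros; apply Hpos; rewrite Cmod_circ; lra).
assert (Hk : forall t, (rho - Cmod z) / (rho + Cmod z) <= (rho ^ 2 - Cmod z ^ 2) / Cmod (circ rho t - z) ^ 2
   <= (rho + Cmod z) / (rho - Cmod z)).
{ intros t; apply Poisson_kernel_bounds; [lra|].
  generalize (Cmod_minus_bounds (circ rho t) z); rewrite Cmod_circ; lra. }
assert (Hs : forall k, is_RInt (fun t => k * Re (P (circ rho t))) 0 (2 * PI) (k * (2 * PI * Re (P 0)))).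
{ intros k; rewrite <- Hmv; apply (is_RInt_scal (V := R_NormedModule)).
  apply (RInt_correct (V := R_CompleteNormedModule)); auto. }
split; apply Rmult_le_reg_l with (2 * PI); auto.
- apply Rle_trans with ((rho - Cmod z) / (rho + Cmod z) * (2 * PI * Re (P 0))); [right; ring|].
  apply (is_RInt_le _ _ 0 (2 * PI) _ _ (Rlt_le _ _ Hpi) (Hs _) Hi).
  intros t _; rewrite Rmult_comm; apply Rmult_le_compat_l; [auto|apply Hk].
- apply Rle_trans with ((rho + Cmod z) / (rho - Cmod z) * (2 * PI * Re (P 0))); [|right; ring].
  apply (is_RInt_le _ _ 0 (2 * PI) _ _ (Rlt_le _ _ Hpi) Hi (Hs _)).
  intros t _; rewrite (Rmult_comm _ (Re _)); apply Rmult_le_compat_l; [auto|apply Hk].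
Qed.

(** The limit rho -> 1 with cleared denominators: for rho = 1 - e both inequalities hold up to an
    error e * S, and a positive gap g in the wrong direction contradicts this for small e. *)
Lemma Harnack P P' z : holo 1 P P' -> (forall w, Cmod w < 1 -> 0 <= Re (P w)) -> Cmod z < 1 ->
  (1 - Cmod z) * Re (P 0) <= (1 + Cmod z) * Re (P z) /\
  (1 - Cmod z) * Re (P z) <= (1 + Cmod z) * Re (P 0).
Proof.
intros HP Hpos Hz; pose proof (Cmod_ge_0 z) as H0.
assert (A0 : 0 <= Re (P 0)) by (apply Hpos; rewrite Cmod_0; lra).
assert (Az : 0 <= Re (P z)) by (apply Hpos; auto).
set (S := Re (P 0) + Re (P z)).
assert (key : forall e, 0 < e < 1 - Cmod z ->
  (1 - Cmod z) * Re (P 0) <= (1 + Cmod z) * Re (P z) + e * S /\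
  (1 - Cmod z) * Re (P z) <= (1 + Cmod z) * Re (P 0) + e * S).
{ intros e He.
  destruct (Harnack_rho P P' (1 - e) z HP Hpos) as [h1 h2]; try lra.
  set (rho := 1 - e) in *.
  apply (Rmult_le_compat_l (rho + Cmod z)) in h1; [|unfold rho; lra].
  replace ((rho + Cmod z) * ((rho - Cmod z) / (rho + Cmod z) * Re (P 0)))
    with ((rho - Cmod z) * Re (P 0)) in h1 by (field; unfold rho; lra).
  apply (Rmult_le_compat_l (rho - Cmod z)) in h2; [|unfold rho; lra].
  replace ((rho - Cmod z) * ((rho + Cmod z) / (rho - Cmod z) * Re (P 0)))
    with ((rho + Cmod z) * Re (P 0)) in h2 by (field; unfold rho; lra).
  unfold rho, S in *; split; nra. }
assert (HS : 0 <= S) by (unfold S; lra).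
split; apply Rnot_lt_le; intros h.
- set (g := (1 - Cmod z) * Re (P 0) - (1 + Cmod z) * Re (P z)).
  assert (Hg : 0 < g) by (unfold g; lra).
  (* This e keeps rho above |z| and the error below half of the gap; S + 1 stands in for S, which
     may vanish. *)
  assert (h3 : 0 < Rmin ((1 - Cmod z) / 2) (g / (2 * (S + 1)))).
  { apply Rmin_glb_lt; [lra|apply Rdiv_lt_0_compat; lra]. }
  set (e := Rmin _ _) in h3.
  destruct (key e) as [k1 _].
  { split; auto; generalize (Rmin_l ((1 - Cmod z) / 2) (g / (2 * (S + 1)))); fold e; lra. }
  assert (e * (S + 1) <= g / 2).
  { apply Rle_trans with (g / (2 * (S + 1)) * (S + 1)); [|right; field; lra].
    apply Rmult_le_compat_r; [lra|apply Rmin_r]. }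
  unfold g in *; nra.
- set (g := (1 - Cmod z) * Re (P z) - (1 + Cmod z) * Re (P 0)).
  assert (Hg : 0 < g) by (unfold g; lra).
  assert (h3 : 0 < Rmin ((1 - Cmod z) / 2) (g / (2 * (S + 1)))).
  { apply Rmin_glb_lt; [lra|apply Rdiv_lt_0_compat; lra]. }
  set (e := Rmin _ _) in h3.
  destruct (key e) as [_ k1].
  { split; auto; generalize (Rmin_l ((1 - Cmod z) / 2) (g / (2 * (S + 1)))); fold e; lra. }
  assert (e * (S + 1) <= g / 2).
  { apply Rle_trans with (g / (2 * (S + 1)) * (S + 1)); [|right; field; lra].
    apply Rmult_le_compat_r; [lra|apply Rmin_r]. }
  unfold g in *; nra.
Qed.

(** * Taylor expansion *)

Section Taylor.

Variables (R0 rho : R) (F F' : C -> C).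
Hypothesis (HF : holo R0 F F') (Hrho : 0 < rho < R0).

(** The integral of F zeta^(-n-1) d zeta / (2 pi i) over the circle, with real and imaginary part
    integrated separately. F and rho are arguments of their own, so that different radii can be
    compared. *)
Definition taylor_coef (F : C -> C) (rho : R) (n : nat) : C :=
  (/ (2 * PI) * RInt (fun t => Re (F (circ rho t) * / circ rho t ^ n)%C) 0 (2 * PI),
   / (2 * PI) * RInt (fun t => Im (F (circ rho t) * / circ rho t ^ n)%C) 0 (2 * PI)).

Let circ_nz t : circ rho t <> 0.
Proof. intros e; generalize (Cmod_circ rho t); rewrite e, Cmod_0; lra. Qed.

Let F_cont t : continuous (fun t => F (circ rho t)) t.
Proof.
apply (continuous_comp (circ rho) F); [apply continuous_circ|].
eapply cdiff_continuous; apply HF; rewrite Cmod_circ; lra.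
Qed.

Let pow_cont n t : continuous (fun t => circ rho t ^ n)%C t.
Proof.
induction n as [|n IH]; simpl; [apply continuous_const|].
apply continuous_Cmult; auto; apply continuous_circ.
Qed.

Let coef_cont n t : continuous (fun t => F (circ rho t) * / circ rho t ^ n)%C t.
Proof.
apply continuous_Cmult; auto; apply continuous_Cinv; auto; apply Cpow_nz; auto.
Qed.

(** The free constant d recovers complex information from real integrals; it will be multiplied by
    z^n to give a term of the Taylor series. *)
Let coef_RInt n d :
  is_RInt (fun t => Re (d * (F (circ rho t) * / circ rho t ^ n))%C) 0 (2 * PI)
    (2 * PI * Re (d * taylor_coef F rho n)%C).
Proof.
pose proof PI2_pos as Hpi.
assert (E : 2 * PI * Re (d * taylor_coef F rho n)%C =
  minus (scal (Re d) (RInt (fun t => Re (F (circ rho t) * / circ rho t ^ n)%C) 0 (2 * PI)))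
    (scal (Im d) (RInt (fun t => Im (F (circ rho t) * / circ rho t ^ n)%C) 0 (2 * PI)))).
{ unfold minus, plus, opp, scal; simpl; unfold mult; simpl; unfold Re, Im, taylor_coef; simpl; field.
  apply PI_neq0. }
rewrite E.
apply (is_RInt_ext (fun t => minus (scal (Re d) (Re (F (circ rho t) * / circ rho t ^ n)%C))
  (scal (Im d) (Im (F (circ rho t) * / circ rho t ^ n)%C)))).
  intros t _; set (A := Cmult (F _) _); destruct A, d.
  unfold minus, plus, opp, scal; simpl; unfold mult; simpl; ring.
apply (is_RInt_minus (V := R_NormedModule)); apply (is_RInt_scal (V := R_NormedModule));
  apply (RInt_correct (V := R_CompleteNormedModule)), (ex_RInt_continuous (V := R_CompleteNormedModule)); intros t _.
- apply continuous_CRe; auto.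
- apply continuous_CIm; auto.
Qed.

Variables (z d : C).
Hypothesis (Hz : Cmod z < rho).

Let kap t : C := (circ rho t / (circ rho t - z))%C.

(** The sum over k < n, one term fewer than [sum_n] takes, to match a geometric sum with n terms. *)
Let partial (n : nat) : R :=
  match n with O => 0 | S m => sum_n (fun k => Re (d * z ^ k * taylor_coef F rho k)%C) m end.

Let partial_S n : partial (S n) = partial n + Re (d * z ^ n * taylor_coef F rho n)%C.
Proof.
destruct n as [|n]; unfold partial.
- rewrite sum_O; ring.
- rewrite sum_Sn; reflexivity.
Qed.

Let circ_z t : (circ rho t - z)%C <> 0.
Proof. apply circ_minus_nz; pose proof (Cmod_ge_0 z); lra. Qed.

(** The geometric sum: (1 - (z / zeta)^n) zeta / (zeta - z) is the sum of the (z / zeta)^k over k <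
    n, integrated term by term. *)
Let partial_RInt n :
  is_RInt (fun t => Re (d * F (circ rho t) * ((1 - (z / circ rho t) ^ n) * kap t))%C) 0 (2 * PI)
    (2 * PI * partial n).
Proof.
induction n as [|n IH].
- apply (is_RInt_ext (fun _ => 0)).
    intros t _; replace (1 - (z / circ rho t) ^ 0)%C with (RtoC 0) by (simpl; ring).
    rewrite Cmult_0_l, Cmult_0_r; reflexivity.
  replace (2 * PI * partial 0) with (scal (2 * PI - 0) 0); [apply (is_RInt_const (V := R_NormedModule))|].
  unfold scal; simpl; unfold mult; simpl; ring.
- rewrite partial_S, Rmult_plus_distr_l.
  generalize (is_RInt_plus (V := R_NormedModule) _ _ _ _ _ _ IH (coef_RInt n (d * z ^ n)%C)).
  apply is_RInt_ext; intros t _.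
  change plus with Rplus; rewrite <- re_plus; apply f_equal.
  unfold kap, Cdiv; rewrite Cpow_S, !Cpow_mult_l, Cpow_inv; auto.
  field; repeat split; auto; apply Cpow_nz; auto.
Qed.

Let rem_RInt n :
  is_RInt (fun t => Re (d * F (circ rho t) * ((z / circ rho t) ^ n * kap t))%C) 0 (2 * PI)
    (2 * PI * (Re (d * F z)%C - partial n)).
Proof.
assert (HG := holo_mult _ _ _ _ _ (holo_const R0 d) HF).
generalize (Cauchy_formula R0 rho _ _ z HG Hz (proj2 Hrho)); intros H1.
replace (2 * PI * (Re (d * F z)%C - partial n)) with
  (minus (2 * PI * Re (d * F z)%C) (2 * PI * partial n))
  by (unfold minus, plus, opp; simpl; ring).
generalize (is_RInt_minus (V := R_NormedModule) _ _ _ _ _ _ H1 (partial_RInt n)).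
apply is_RInt_ext; intros t _.
unfold minus, plus, opp; simpl; fold (kap t).
set (A := F (circ rho t)); set (B := Cpow _ n); set (K := kap t).
destruct A, B, K, d; simpl; ring.
Qed.

Let F_bound : exists M, forall t, 0 <= t <= 2 * PI -> Cmod (F (circ rho t)) <= M.
Proof.
pose proof PI2_pos as Hpi.
set (h := fun t => Rabs (Re (F (circ rho t))) + Rabs (Im (F (circ rho t)))).
destruct (continuity_ab_maj h 0 (2 * PI)) as [t0 [Ht0 _]]; [lra| |].
- intros t _; apply continuity_pt_filterlim.
  apply (continuous_plus (V := R_NormedModule) (fun t => Rabs (Re (F (circ rho t)))) (fun t => Rabs (Im (F (circ rho t))))).
  + apply (continuous_comp (fun t => Re (F (circ rho t))) Rabs); [apply continuous_CRe; auto|apply continuous_Rabs].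
  + apply (continuous_comp (fun t => Im (F (circ rho t))) Rabs); [apply continuous_CIm; auto|apply continuous_Rabs].
- exists (h t0); intros t Ht; apply Rle_trans with (h t); auto; apply Cmod_le_Re_Im.
Qed.

(** The remainder integral carries the factor (z / zeta)^n, of modulus q^n with q = |z| / rho < 1;
    the other factors are bounded on the circle by K. *)
Lemma taylor_disc : is_series (fun k => Re (d * z ^ k * taylor_coef F rho k)%C) (Re (d * F z)%C).
Proof.
pose proof PI2_pos as Hpi; pose proof (Cmod_ge_0 z) as H0; pose proof (Cmod_ge_0 d) as Hd.
destruct F_bound as [M HM].
set (q := Cmod z / rho).
assert (Hq : 0 <= q < 1).
{ split; unfold q.
  - apply Rdiv_le_0_compat; lra.
  - apply Rmult_lt_reg_r with rho; [lra|]; unfold Rdiv; rewrite Rmult_assoc, Rinv_l; lra. }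
set (K := Cmod d * M * (rho / (rho - Cmod z))).
assert (HK : forall n, Rabs (partial n - Re (d * F z)%C) <= K * q ^ n).
{ intros n; rewrite Rabs_minus_sym.
  assert (Hr := rem_RInt n).
  assert (Hb : Rabs (2 * PI * (Re (d * F z)%C - partial n)) <= (2 * PI - 0) * (K * q ^ n)).
  { rewrite <- (is_RInt_unique _ _ _ _ Hr).
    apply abs_RInt_le_const; [lra|eexists; exact Hr|].
    intros t Ht; apply Rle_trans with (1 := proj1 (Cmod_ge_Re_Im _)).
    unfold kap; rewrite !Cmod_mult, Cmod_pow, !Cmod_div; auto.
    rewrite !Cmod_circ; [|lra]; fold q; unfold K.
    assert (Hqn : 0 <= q ^ n) by (apply pow_le; lra).
    assert (Hden : rho - Cmod z <= Cmod (circ rho t - z)).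
    { generalize (Cmod_minus_bounds (circ rho t) z); rewrite Cmod_circ; lra. }
    assert (Hfr : rho / Cmod (circ rho t - z) <= rho / (rho - Cmod z)).
    { apply Rmult_le_compat_l; [lra|]; apply Rinv_le_contravar; lra. }
    assert (Hfp : 0 <= rho / Cmod (circ rho t - z)) by (apply Rdiv_le_0_compat; lra).
    specialize (HM t Ht); pose proof (Cmod_ge_0 (F (circ rho t))).
    replace (Cmod d * M * (rho / (rho - Cmod z)) * q ^ n) with ((Cmod d * M) * (q ^ n * (rho / (rho - Cmod z)))) by ring.
    apply Rmult_le_compat.
    - apply Rmult_le_pos; auto.
    - apply Rmult_le_pos; auto.
    - apply Rmult_le_compat_l; auto.
    - apply Rmult_le_compat_l; auto. }
  rewrite Rabs_mult, (Rabs_pos_eq (2 * PI)) in Hb; [|lra].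
  apply Rmult_le_reg_l with (2 * PI); lra. }
(* The n-th partial sum of a series includes the term of index n, hence [partial (S n)]. *)
change (is_lim_seq (fun n => partial (S n)) (Re (d * F z)%C)).
apply (is_lim_seq_incr_1 partial).
apply is_lim_seq_spec; intros eps.
assert (Hl : is_lim_seq (fun n => K * q ^ n) 0).
{ replace (Finite 0) with (Rbar_mult K 0) by (simpl; f_equal; ring).
  apply is_lim_seq_scal_l, is_lim_seq_geom; rewrite Rabs_pos_eq; lra. }
apply is_lim_seq_spec in Hl; generalize (Hl eps); apply filter_imp; intros n Hn.
apply Rle_lt_trans with (1 := HK n).
rewrite Rminus_0_r in Hn; apply Rle_lt_trans with (2 := Hn), Rle_abs.
Qed.

End Taylor.

(** * Uniqueness of power series and Taylor's theorem on the unit disc *)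

Lemma CV_radius_ge_1 (a : nat -> R) :
  (forall x, Rabs x < 1 -> ex_series (fun n => a n * x ^ n)) ->
  forall x, Rabs x < 1 -> Rbar_lt (Rabs x) (CV_radius a).
Proof.
intros H x Hx.
(* At the midpoint y between |x| and 1 the series converges, so its terms tend to 0; beyond the
   radius of convergence they could not. *)
set (y := (Rabs x + 1) / 2).
assert (Hy : Rabs y = y) by (apply Rabs_pos_eq; unfold y; pose proof (Rabs_pos x); lra).
apply Rbar_lt_le_trans with y; [simpl; unfold y; lra|].
apply Rbar_not_lt_le; intros h.
apply (CV_disk_outside a y).
- rewrite Hy; exact h.
- apply ex_series_lim_0, H; rewrite Hy; unfold y; lra.
Qed.

(** Both sequences are the derivatives of h at 0 divided by n!, and these depend only on h near
    0. *)
Lemma power_series_unique (a b : nat -> R) (h : R -> R) (delta : R) : 0 < delta <= 1 ->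
  (forall x, Rabs x < delta -> is_series (fun n => a n * x ^ n) (h x)) ->
  (forall x, Rabs x < delta -> is_series (fun n => b n * x ^ n) (h x)) ->
  forall n, a n = b n.
Proof.
intros Hd.
assert (key : forall a, (forall x, Rabs x < delta -> is_series (fun n => a n * x ^ n) (h x)) ->
  forall n, Derive_n h n 0 = a n * INR (Factorial.fact n)).
{ clear a b; intros a Ha n.
  rewrite <- Derive_n_coef.
  - apply Derive_n_ext_loc.
    exists (mkposreal delta (proj1 Hd)); intros x Hx.
    unfold ball in Hx; simpl in Hx; unfold AbsRing_ball, abs, minus, plus, opp in Hx; simpl in Hx.
    symmetry; apply is_series_unique, Ha.
    replace (x + - 0) with x in Hx by Cring; exact Hx.
  - set (y := delta / 2).
    assert (Hy : Rabs y = y) by (apply Rabs_pos_eq; unfold y; lra).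
    apply Rbar_lt_le_trans with y; [simpl; unfold y; lra|].
    apply Rbar_not_lt_le; intros k.
    apply (CV_disk_outside a y); [rewrite Hy; exact k|].
    apply ex_series_lim_0; eexists; apply Ha; rewrite Hy; unfold y; lra. }
intros Ha Hb n.
apply Rmult_eq_reg_r with (INR (Factorial.fact n)); [|apply INR_fact_neq_0].
rewrite <- (key a Ha), <- (key b Hb); reflexivity.
Qed.

(** The coefficients come from the circle of radius 1/2, while z may require a larger one. For real
    x with |x| < 1/2 both circles expand the same function Re (e F x), so the coefficients agree. *)
Theorem taylor_unit_disc (F F' : C -> C) : holo 1 F F' ->
  exists c : nat -> C, forall z d : C, Cmod z < 1 ->
    is_series (fun k => Re (d * z ^ k * c k)%C) (Re (d * F z)%C).
Proof.
intros HF.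
exists (taylor_coef F (1 / 2)); intros z d Hz.
pose proof (Cmod_ge_0 z) as H0.
set (rho := (1 + Rmax (1 / 2) (Cmod z)) / 2).
assert (Hrho : 1 / 2 < rho < 1 /\ Cmod z < rho).
{ unfold rho; pose proof (Rmax_l (1 / 2) (Cmod z)); pose proof (Rmax_r (1 / 2) (Cmod z)).
  assert (Rmax (1 / 2) (Cmod z) < 1) by (apply Rmax_lub_lt; lra); lra. }
generalize (taylor_disc 1 rho F F' HF ltac:(lra) z d ltac:(lra)).
assert (E : forall e k, Re (e * taylor_coef F rho k)%C = Re (e * taylor_coef F (1 / 2) k)%C).
{ intros e k; revert k.
  apply power_series_unique with (fun x : R => Re (e * F x)%C) (1 / 2); [lra| |]; intros x Hx.
  - generalize (taylor_disc 1 rho F F' HF ltac:(lra) x e ltac:(rewrite Cmod_R; lra)).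
    apply is_series_ext; intros n; rewrite <- RtoC_pow, <- Cmult_assoc, (Cmult_comm (RtoC _)), Cmult_assoc, Re_mult_RtoC; reflexivity.
  - generalize (taylor_disc 1 (1 / 2) F F' HF ltac:(lra) x e ltac:(rewrite Cmod_R; lra)).
    apply is_series_ext; intros n; rewrite <- RtoC_pow, <- Cmult_assoc, (Cmult_comm (RtoC _)), Cmult_assoc, Re_mult_RtoC; reflexivity. }
apply is_series_ext; intros n; apply E.
Qed.

(** * Power series with real coefficients at complex points *)

Lemma is_series_0 : is_series (fun _ : nat => 0) 0.
Proof.
change (is_lim_seq (sum_n (fun _ : nat => 0)) 0).
apply (is_lim_seq_ext (fun _ => 0)); [|apply is_lim_seq_const].
intros n; rewrite sum_n_const; ring.
Qed.

Definition disc_conv (a : nat -> R) : Prop := Rbar_le 1 (CV_radius a).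

Lemma disc_conv_intro (a : nat -> R) :
  (forall x, Rabs x < 1 -> ex_series (fun n => a n * x ^ n)) -> disc_conv a.
Proof.
intros H; unfold disc_conv.
assert (K := CV_radius_ge_1 a H); pose proof (CV_radius_ge_0 a) as H0.
destruct (CV_radius a) as [r| |]; simpl in *; auto.
apply Rnot_lt_le; intros h.
specialize (K r); rewrite Rabs_pos_eq in K; auto; specialize (K h); simpl in K; lra.
Qed.

Lemma disc_conv_abs (a : nat -> R) (r : R) : disc_conv a -> 0 <= r < 1 ->
  ex_series (fun n => Rabs (a n) * r ^ n).
Proof.
intros H Hr.
apply (ex_series_ext (fun n => Rabs (a n * r ^ n))).
- intros n; rewrite Rabs_mult, (Rabs_pos_eq (r ^ n)); auto; apply pow_le; lra.
- apply CV_disk_inside; apply Rbar_lt_le_trans with 1; auto.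
  simpl; rewrite Rabs_pos_eq; lra.
Qed.

Lemma disc_conv_derive (a : nat -> R) : disc_conv a -> disc_conv (PS_derive a).
Proof. unfold disc_conv; rewrite CV_radius_derive; auto. Qed.

(** Real coefficients at a complex point: a quaternionic series on a slice splits into four of
    these, one for each coordinate of its coefficients. *)
Definition cps (a : nat -> R) (z : C) : C :=
  (Series (fun n => a n * Re (z ^ n)%C), Series (fun n => a n * Im (z ^ n)%C)).

Lemma ex_series_cps (a : nat -> R) (z : C) (u : nat -> R) : disc_conv a -> Cmod z < 1 ->
  (forall n, Rabs (u n) <= Cmod z ^ n) -> ex_series (fun n => a n * u n).
Proof.
intros Ha Hz Hu.
apply (ex_series_le (V := R_CompleteNormedModule) _ (fun n => Rabs (a n) * Cmod z ^ n)).
- intros n; change norm with Rabs; rewrite Rabs_mult; apply Rmult_le_compat_l; auto; apply Rabs_pos.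
- apply disc_conv_abs; auto; split; auto; apply Cmod_ge_0.
Qed.

Lemma cps_series (a : nat -> R) (z e : C) : disc_conv a -> Cmod z < 1 ->
  is_series (fun n => a n * Re (e * z ^ n)%C) (Re (e * cps a z)%C).
Proof.
intros Ha Hz.
assert (H1 : is_series (fun n => a n * Re (z ^ n)%C) (Re (cps a z))).
{ apply Series_correct, (ex_series_cps a z); auto.
  intros n; rewrite <- Cmod_pow; apply Cmod_ge_Re_Im. }
assert (H2 : is_series (fun n => a n * Im (z ^ n)%C) (Im (cps a z))).
{ apply Series_correct, (ex_series_cps a z); auto.
  intros n; rewrite <- Cmod_pow; apply Cmod_ge_Re_Im. }
replace (Re (e * cps a z)%C) with (Re e * Re (cps a z) + (- Im e) * Im (cps a z)).
2:{ unfold Re, Im; simpl; ring. }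
apply (is_series_ext (fun n => Re e * (a n * Re (z ^ n)%C) + (- Im e) * (a n * Im (z ^ n)%C))).
  intros n; destruct (z ^ n)%C, e; simpl; ring.
apply (is_series_plus (V := R_NormedModule)); apply (is_series_scal (V := R_NormedModule)); auto.
Qed.

Lemma Cmod_Ci : Cmod Ci = 1.
Proof.
unfold Cmod, Ci; simpl.
replace (0 * (0 * 1) + 1 * (1 * 1)) with 1 by ring; apply sqrt_1.
Qed.

Lemma C_eq_Re (u v : C) : (forall e, Cmod e = 1 -> Re (e * u)%C = Re (e * v)%C) -> u = v.
Proof.
intros H.
generalize (H 1%C Cmod_1) (H (- Ci)%C ltac:(rewrite Cmod_opp; apply Cmod_Ci)).
destruct u, v; simpl; intros; apply injective_projections; simpl; lra.
Qed.

Lemma cps_unique (a : nat -> R) (z l : C) : disc_conv a -> Cmod z < 1 ->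
  (forall e, is_series (fun n => a n * Re (e * z ^ n)%C) (Re (e * l)%C)) -> cps a z = l.
Proof.
intros Ha Hz H; apply C_eq_Re; intros e _.
rewrite <- (is_series_unique _ _ (H e)); symmetry; apply is_series_unique.
apply cps_series; auto.
Qed.

Lemma cps_ext (a b : nat -> R) z : (forall n, a n = b n) -> cps a z = cps b z.
Proof. intros H; unfold cps; f_equal; apply Series_ext; intros; rewrite H; auto. Qed.

(** The second-order Taylor remainder of the n-th power; at n = 0 the truncated [pred] is multiplied
    by 0. *)
Definition rem2 (z w : C) (n : nat) : C :=
  (w ^ n - z ^ n - INR n * z ^ pred n * (w - z))%C.

Lemma rem2_SS (z w : C) (n : nat) :
  rem2 z w (S (S n)) = (w * rem2 z w (S n) + INR (S n) * z ^ n * ((w - z) * (w - z)))%C.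
Proof.
unfold rem2; rewrite (S_INR (S n)), RtoC_plus; simpl pred; rewrite !Cpow_S; ring.
Qed.

(** Induction by [rem2_SS]. The factor is twice the sharp one: it is the one that two applications
    of [PS_derive] produce, so the remainders can be summed against the second derivative of the
    series. *)
Lemma rem2_bound (z w : C) (r : R) (n : nat) : Cmod z <= r -> Cmod w <= r ->
  Cmod (rem2 z w (S (S n))) <= INR (S n) * INR (S (S n)) * r ^ n * Cmod (w - z) ^ 2.
Proof.
intros Hz Hw; pose proof (Cmod_ge_0 z); pose proof (Cmod_ge_0 w).
set (h := Cmod (w - z) ^ 2); assert (Hh : 0 <= h) by apply pow2_ge_0.
assert (Hp : forall k, 0 <= r ^ k) by (intros; apply pow_le; lra).
assert (step : forall k B, Cmod (rem2 z w (S k)) <= B ->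
   Cmod (rem2 z w (S (S k))) <= r * B + INR (S k) * r ^ k * h).
{ intros k B HB; rewrite rem2_SS; apply Rle_trans with (1 := Cmod_triangle _ _).
  rewrite !Cmod_mult, Cmod_R, Cmod_pow, (Rabs_pos_eq (INR (S k))) by apply pos_INR.
  apply Rplus_le_compat.
  - apply Rmult_le_compat; auto; apply Cmod_ge_0.
  - replace (Cmod (w - z) * Cmod (w - z)) with h by (unfold h; ring).
    apply Rmult_le_compat_r; auto; apply Rmult_le_compat_l; [apply pos_INR|].
    apply pow_incr; split; auto. }
induction n as [|n IH].
- eapply Rle_trans; [apply (step 0%nat 0)|].
  + unfold rem2; simpl.
    replace (w * 1 - z * 1 - 1 * 1 * (w - z))%C with (RtoC 0) by ring; rewrite Cmod_0; lra.
  + simpl; lra.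
- eapply Rle_trans; [apply (step (S n)), IH|].
  rewrite !S_INR; pose proof (pos_INR n) as P; simpl pow; fold h.
  specialize (Hp n).
  assert (0 <= r ^ n * h) by (apply Rmult_le_pos; auto).
  assert (0 <= r * (r ^ n * h)) by (apply Rmult_le_pos; lra).
  nra.
Qed.

Lemma cps_rem2 (a : nat -> R) (z w e : C) : disc_conv a -> Cmod z < 1 -> Cmod w < 1 ->
  is_series (fun n => a n * Re (e * rem2 z w n)%C)
    (Re (e * (cps a w - cps a z - cps (PS_derive a) z * (w - z)))%C).
Proof.
intros Ha Hz Hw.
assert (H1 := cps_series a w e Ha Hw).
assert (H2 := cps_series a z e Ha Hz).
assert (H3 := cps_series (PS_derive a) z (e * (w - z))%C (disc_conv_derive a Ha) Hz).
(* The term n = 0 vanishes, and dropping it shifts the index to that of [PS_derive]. *)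
assert (H4 : is_series (fun n => a n * Re (e * (INR n * z ^ pred n * (w - z)))%C)
   (Re (e * (w - z) * cps (PS_derive a) z)%C)).
{ apply (is_series_decr_1 (K := R_AbsRing) (V := R_NormedModule)).
  replace (plus _ _) with (Re (e * (w - z) * cps (PS_derive a) z)%C).
  - revert H3; apply is_series_ext; intros n; unfold PS_derive.
    simpl pred.
    replace (e * (INR (S n) * z ^ n * (w - z)))%C with (e * (w - z) * z ^ n * RtoC (INR (S n)))%C by ring.
    rewrite Re_mult_RtoC; Cring.
  - replace (e * (INR 0 * z ^ pred 0 * (w - z)))%C with (RtoC 0) by (simpl; ring).
    carriers; unfold plus, opp; simpl; ring. }
generalize (is_series_minus (V := R_NormedModule) _ _ _ _
  (is_series_minus (V := R_NormedModule) _ _ _ _ H1 H2) H4); intros H5.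
replace (Re (e * (cps a w - cps a z - cps (PS_derive a) z * (w - z)))%C) with
  (minus (minus (Re (e * cps a w)%C) (Re (e * cps a z)%C)) (Re (e * (w - z) * cps (PS_derive a) z)%C)).
- revert H5; apply is_series_ext; intros n; unfold rem2.
  set (A := Cpow w n); set (B := Cpow z n); set (D := (INR n * z ^ pred n * (w - z))%C).
  carriers; destruct A, B, D, e; unfold minus, plus, opp; simpl; ring.
- carriers; unfold minus, plus, opp; simpl; unfold Re, Im; simpl; ring.
Qed.

Lemma cps_estimate (a : nat -> R) (r : R) : disc_conv a -> 0 <= r < 1 ->
  exists K, 0 <= K /\ forall z w, Cmod z <= r -> Cmod w <= r ->
    Cmod (cps a w - cps a z - cps (PS_derive a) z * (w - z)) <= K * Cmod (w - z) ^ 2.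
Proof.
intros Ha Hr.
set (B := fun n => match n with S (S m) => INR (S m) * INR (S (S m)) * r ^ m | _ => 0 end).
assert (HB : forall n, 0 <= B n).
{ intros [|[|n]]; unfold B; try lra.
  apply Rmult_le_pos; [apply Rmult_le_pos; apply pos_INR|apply pow_le; lra]. }
assert (Hex : ex_series (fun n => Rabs (a n) * B n)).
{ apply (ex_series_incr_n _ 2).
  apply (ex_series_ext (fun n => Rabs (PS_derive (PS_derive a) n) * r ^ n)).
  - intros n; change (2 + n)%nat with (S (S n)); unfold B, PS_derive; rewrite !Rabs_mult.
    rewrite (Rabs_pos_eq (INR (S n))), (Rabs_pos_eq (INR (S (S n)))) by apply pos_INR; Cring.
  - apply disc_conv_abs; auto; do 2 apply disc_conv_derive; auto. }
set (K := Series (fun n => Rabs (a n) * B n)).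
assert (HK : 0 <= K).
{ unfold K; rewrite <- (is_series_unique _ _ is_series_0).
  apply Series_le; auto; intros n; split; [lra|]; apply Rmult_le_pos; auto; apply Rabs_pos. }
(* K bounds the real and the imaginary part separately, whence the factor 2. *)
exists (2 * K); split; [lra|]; intros z w Hz Hw.
set (h := Cmod (w - z) ^ 2); assert (Hh : 0 <= h) by apply pow2_ge_0.
assert (HD : forall n, Cmod (rem2 z w n) <= B n * h).
{ intros [|[|n]]; [| |apply rem2_bound; auto]; unfold B.
  - unfold rem2; simpl; replace (1 - 1 - 0 * 1 * (w - z))%C with (RtoC 0) by ring; rewrite Cmod_0; lra.
  - unfold rem2; simpl; replace (w * 1 - z * 1 - 1 * 1 * (w - z))%C with (RtoC 0) by ring; rewrite Cmod_0; lra. }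
set (E := (cps a w - cps a z - cps (PS_derive a) z * (w - z))%C).
assert (key : forall e, Cmod e = 1 -> Rabs (Re (e * E)%C) <= K * h).
{ intros e He.
  unfold E; rewrite <- (is_series_unique _ _ (cps_rem2 a z w e Ha ltac:(lra) ltac:(lra))).
  assert (Hb : forall n, 0 <= Rabs (a n * Re (e * rem2 z w n)%C) <= Rabs (a n) * B n * h).
  { intros n; split; [apply Rabs_pos|].
    rewrite Rabs_mult, Rmult_assoc; apply Rmult_le_compat_l; [apply Rabs_pos|].
    apply Rle_trans with (2 := HD n).
    apply Rle_trans with (1 := proj1 (Cmod_ge_Re_Im _)); rewrite Cmod_mult, He; lra. }
  assert (Hex2 : ex_series (fun n => Rabs (a n) * B n * h)) by (apply ex_series_scal_r; auto).
  apply Rle_trans with (1 := Series_Rabs _ (ex_series_le (V := R_CompleteNormedModule)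
     (fun n => Rabs (a n * Re (e * rem2 z w n)%C)) _
     (fun n => Rle_trans _ _ _ (Req_le _ _ (Rabs_Rabsolu _)) (proj2 (Hb n))) Hex2)).
  unfold K; rewrite <- Series_scal_r; apply Series_le; auto. }
apply Rle_trans with (1 := Cmod_le_Re_Im E).
generalize (key 1%C Cmod_1) (key (- Ci)%C ltac:(rewrite Cmod_opp; apply Cmod_Ci)).
replace (1 * E)%C with E by ring.
replace (Re (- Ci * E)%C) with (Im E) by (destruct E; simpl; ring).
lra.
Qed.

(** A quadratic error on the disc of radius (1 + |z|) / 2 gives the derivative at z; the derivative
    is continuous because the differentiated series falls under the same argument. *)
Lemma holo_cps (a : nat -> R) : disc_conv a -> holo 1 (cps a) (cps (PS_derive a)).
Proof.
assert (D : forall a z, disc_conv a -> Cmod z < 1 -> cdiff (cps a) z (cps (PS_derive a) z)).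
{ clear a; intros a z Ha Hz; pose proof (Cmod_ge_0 z).
  apply cdiff_of_estimate; intros eps.
  destruct (cps_estimate a ((1 + Cmod z) / 2) Ha ltac:(lra)) as (K & HK & HE).
  apply locally_Cmod.
  assert (Hd : 0 < Rmin ((1 - Cmod z) / 2) (eps / (K + 1))).
  { apply Rmin_glb_lt; [lra|apply Rdiv_lt_0_compat; [apply eps|lra]]. }
  exists (mkposreal _ Hd); simpl; intros w Hw.
  assert (h1 := Rlt_le_trans _ _ _ Hw (Rmin_l _ _)).
  assert (h2 := Rlt_le_trans _ _ _ Hw (Rmin_r _ _)).
  assert (Cmod w <= (1 + Cmod z) / 2).
  { generalize (Cmod_triangle (w - z) z); replace (w - z + z)%C with w by ring; lra. }
  apply Rle_trans with (1 := HE z w ltac:(lra) ltac:(auto)).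
  pose proof (Cmod_ge_0 (w - z)) as P.
  assert (K * Cmod (w - z) <= eps).
  { apply Rle_trans with ((K + 1) * (eps / (K + 1))); [|right; field; lra].
    apply Rmult_le_compat; lra. }
  nra. }
intros Ha z Hz; split; [apply D; auto|].
apply cdiff_continuous with (cps (PS_derive (PS_derive a)) z), D; auto.
apply disc_conv_derive; auto.
Qed.

Lemma cps_0 (a : nat -> R) : disc_conv a -> cps a 0 = RtoC (a O).
Proof.
intros Ha; apply cps_unique; auto; [rewrite Cmod_0; lra|]; intros e.
apply (is_series_decr_1 (K := R_AbsRing) (V := R_NormedModule)).
replace (plus _ _) with 0.
2:{ carriers; simpl; unfold plus, opp, Re, Im; simpl; ring. }
apply (is_series_ext (fun _ => 0)); [|apply is_series_0].
intros n; rewrite Cpow_S, Cmult_0_l, Cmult_0_r; carriers; simpl; ring.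
Qed.

(** * Quaternions and slices *)

Lemma quat_ext (p q : quat) :
  q_re p = q_re q -> q_i p = q_i q -> q_j p = q_j q -> q_k p = q_k q -> p = q.
Proof.
destruct p as [[[p0 p1] p2] p3], q as [[[q0 q1] q2] q3]; unfold q_re, q_i, q_j, q_k; simpl.
intros; subst; reflexivity.
Qed.

Tactic Notation "qunfold" := unfold qadd, qopp, qmul, qconj, qreal, mkq, q_re, q_i, q_j, q_k; cbn [fst snd].
Tactic Notation "qunfold" "in" hyp(H) := unfold qadd, qopp, qmul, qconj, qreal, mkq, q_re, q_i, q_j, q_k in H; cbn [fst snd] in H.
Ltac split4 := split; [|split; [|split]].
(* Section variables survive [destruct], hence the restriction to variables
   occurring in the goal. *)
Ltac qdestruct := repeat match goal with q : quat |- context [?p] => constr_eq p q; destruct q as [[[? ?] ?] ?] end.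
Ltac qring := intros; qdestruct; apply quat_ext; qunfold; ring.

Lemma qmul_assoc p q r : (p * (q * r) = p * q * r)%quat.
Proof. qring. Qed.
Lemma qmul_addr p q r : (p * (q + r) = p * q + p * r)%quat.
Proof. qring. Qed.
Lemma qmul_addl p q r : ((p + q) * r = p * r + q * r)%quat.
Proof. qring. Qed.
Lemma qmul_1l q : (qreal 1 * q = q)%quat.
Proof. qring. Qed.
Lemma qmul_1r q : (q * qreal 1 = q)%quat.
Proof. qring. Qed.
Lemma qreal_comm x q : (qreal x * q = q * qreal x)%quat.
Proof. qring. Qed.
Definition qdot (p q : quat) : R := q_re p * q_re q + q_i p * q_i q + q_j p * q_j q + q_k p * q_k q.

Lemma qnorm_sqr q : qnorm q ^ 2 = qdot q q.
Proof.
unfold qnorm; rewrite pow2_sqrt; unfold qdot; [ring|nra].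
Qed.

Lemma qnorm_ge0 q : 0 <= qnorm q.
Proof. apply sqrt_pos. Qed.

Lemma qnorm_eq p q : qdot p p = qdot q q -> qnorm p = qnorm q.
Proof. unfold qnorm, qdot; intros H; f_equal; lra. Qed.

Lemma qnorm_mul p q : qnorm (p * q)%quat = qnorm p * qnorm q.
Proof.
unfold qnorm; rewrite <- sqrt_mult; try nra.
f_equal; qunfold; ring.
Qed.

Lemma qnorm_0 q : qnorm q = 0 -> q = qreal 0.
Proof.
intros H; assert (E := qnorm_sqr q); rewrite H in E; unfold qdot in E; qunfold in E.
apply quat_ext; qunfold; nra.
Qed.

Lemma qnorm_real x : qnorm (qreal x) = Rabs x.
Proof.
unfold qnorm, qreal; qunfold; rewrite <- sqrt_Rsqr_abs; f_equal; unfold Rsqr; ring.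
Qed.

Lemma qnorm_pos q : q <> qreal 0 -> 0 < qnorm q.
Proof.
intros H; destruct (qnorm_ge0 q) as [h|h]; auto; exfalso; apply H, qnorm_0; auto.
Qed.

Lemma qconj_mul_self q : (qconj q * q)%quat = qreal (qnorm q ^ 2).
Proof. rewrite qnorm_sqr; unfold qdot; qring. Qed.

Lemma qmul_conj_self q : (q * qconj q)%quat = qreal (qnorm q ^ 2).
Proof. rewrite qnorm_sqr; unfold qdot; qring. Qed.

Lemma qinv_l q : q <> qreal 0 -> (qinv q * q)%quat = qreal 1.
Proof.
intros H; apply qnorm_pos in H.
unfold qinv; rewrite <- qmul_assoc, qconj_mul_self.
apply quat_ext; qunfold; field; lra.
Qed.

Lemma qinv_r q : q <> qreal 0 -> (q * qinv q)%quat = qreal 1.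
Proof.
intros H; apply qnorm_pos in H.
unfold qinv; rewrite qreal_comm, qmul_assoc, qmul_conj_self.
apply quat_ext; qunfold; field; lra.
Qed.

Lemma q_re_qinv_mul p q : q_re (qinv p * q)%quat = qdot p q / qnorm p ^ 2.
Proof. unfold qinv, qdot; qunfold; unfold Rdiv; ring. Qed.

Lemma qmul_eq0 p q : (p * q)%quat = qreal 0 -> p = qreal 0 \/ q = qreal 0.
Proof.
intros H; apply (f_equal qnorm) in H.
rewrite qnorm_mul, qnorm_real, Rabs_R0 in H.
apply Rmult_integral in H; destruct H as [h|h]; apply qnorm_0 in h; auto.
Qed.

Lemma imag_unit_iff I : imag_unit I <-> q_re I = 0 /\ q_i I ^ 2 + q_j I ^ 2 + q_k I ^ 2 = 1.
Proof.
unfold imag_unit; split.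
- destruct I as [[[a b] c] d]; intros H; qunfold; qunfold in H.
  injection H; intros.
  destruct (Req_dec a 0) as [h|h]; [split; nra|].
  (* A nonzero real part a forces the vector part to vanish, leaving a^2 = -1. *)
  exfalso; assert (b = 0) by nra; assert (c = 0) by nra; assert (d = 0) by nra; nra.
- intros [h1 h2]; qunfold in h1; qunfold in h2; apply quat_ext; qunfold; rewrite h1; nra.
Qed.

Definition qslice (I : quat) (z : C) : quat := slice_pt I (Re z) (Im z).

Lemma qslice_mul I z w : imag_unit I -> (qslice I z * qslice I w)%quat = qslice I (z * w)%C.
Proof.
intros H; unfold imag_unit in H; unfold qslice, slice_pt.
transitivity (qreal (Re z * Re w) + qreal (Re z * Im w + Im z * Re w) * I + qreal (Im z * Im w) * (I * I))%quat.
- qring.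
- rewrite H; unfold Re, Im; simpl; qring.
Qed.

Lemma qslice_real I x : qslice I (RtoC x) = qreal x.
Proof. unfold qslice, slice_pt, Re, Im; simpl; qring. Qed.

Lemma qpow_qslice I z n : imag_unit I -> qpow (qslice I z) n = qslice I (z ^ n)%C.
Proof.
intros H; induction n as [|n IH]; simpl.
- symmetry; apply (qslice_real I 1).
- rewrite IH; apply qslice_mul; auto.
Qed.

Lemma qnorm_qslice I z : imag_unit I -> qnorm (qslice I z) = Cmod z.
Proof.
intros H; apply imag_unit_iff in H; destruct H as [h1 h2].
unfold qnorm, Cmod, qslice, slice_pt; f_equal.
destruct z as [x y]; unfold Re, Im; simpl fst; simpl snd.
qunfold in h1; qunfold in h2; qunfold; rewrite h1.
transitivity (x ^ 2 + y ^ 2 * (snd (fst (fst I)) ^ 2 + snd (fst I) ^ 2 + snd I ^ 2)); [ring|rewrite h2; ring].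
Qed.

Lemma slice_unit_imag q : imag_unit (slice_unit q).
Proof.
apply imag_unit_iff; unfold slice_unit.
destruct (Req_EM_T (im_norm q) 0) as [h|h]; qunfold; split; auto; try ring.
assert (E : im_norm q ^ 2 = q_i q ^ 2 + q_j q ^ 2 + q_k q ^ 2).
{ unfold im_norm; rewrite pow2_sqrt; [ring|nra]. }
unfold q_i, q_j, q_k in E.
apply Rmult_eq_reg_r with (im_norm q ^ 2); [|apply pow_nonzero; auto].
rewrite E at 2; field; auto.
Qed.

Lemma qslice_slice_unit q : qslice (slice_unit q) (q_re q, im_norm q) = q.
Proof.
unfold qslice, slice_pt, Re, Im, slice_unit; simpl.
destruct (Req_EM_T (im_norm q) 0) as [h|h].
- rewrite h; unfold im_norm in h; apply sqrt_eq_0 in h; [|nra].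
  assert (q_i q = 0) by nra; assert (q_j q = 0) by nra; assert (q_k q = 0) by nra.
  qunfold in H; qunfold in H0; qunfold in H1; apply quat_ext; qunfold; nra.
- apply quat_ext; qunfold; field; auto.
Qed.

Lemma qslice_cover q : in_ball q -> exists I z, imag_unit I /\ Cmod z < 1 /\ q = qslice I z.
Proof.
intros H; exists (slice_unit q), (q_re q, im_norm q); split; [apply slice_unit_imag|].
rewrite qslice_slice_unit; split; auto.
rewrite <- (qnorm_qslice (slice_unit q)), qslice_slice_unit; auto; apply slice_unit_imag.
Qed.

(** * Coordinatewise limits in the quaternions *)

Ltac same_limit :=
  match goal with
  | |- is_series _ ?x -> is_series _ ?y =>
      replace x with y by (unfold qdot, qslice, slice_pt; qunfold; ring)
  | |- is_derive _ _ ?x -> is_derive _ _ ?y =>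
      replace x with y by (qunfold; unfold Re, Im; simpl; ring)
  end.

Notation Qmod := (prod_NormedModule R_AbsRing (prod_NormedModule R_AbsRing
  (prod_NormedModule R_AbsRing R_NormedModule R_NormedModule) R_NormedModule) R_NormedModule).

(** Expansion in the basis 1, i, j, k; it reduces limits, continuity and derivatives in [quat] to
    those of scalar multiples of fixed vectors. *)
Lemma quat_decomp (q : quat) :
  q = plus (G := Qmod) (plus (G := Qmod) (scal (V := Qmod) (q_re q) (mkq 1 0 0 0)) (scal (V := Qmod) (q_i q) (mkq 0 1 0 0)))
       (plus (G := Qmod) (scal (V := Qmod) (q_j q) (mkq 0 0 1 0)) (scal (V := Qmod) (q_k q) (mkq 0 0 0 1))).
Proof.
transitivity (((mkq (q_re q * 1) (q_re q * 0) (q_re q * 0) (q_re q * 0)) +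
   (mkq (q_i q * 0) (q_i q * 1) (q_i q * 0) (q_i q * 0))) +
  ((mkq (q_j q * 0) (q_j q * 0) (q_j q * 1) (q_j q * 0)) +
   (mkq (q_k q * 0) (q_k q * 0) (q_k q * 0) (q_k q * 1))))%quat; [qring|reflexivity].
Qed.

Lemma is_linear_q_re : is_linear (U := Qmod) (V := R_NormedModule) q_re.
Proof.
apply (is_linear_comp (U := Qmod) fst (fun t => fst (fst t))); [apply is_linear_fst|].
apply (is_linear_comp fst fst); apply is_linear_fst.
Qed.
Lemma is_linear_q_i : is_linear (U := Qmod) (V := R_NormedModule) q_i.
Proof.
apply (is_linear_comp (U := Qmod) fst (fun t => snd (fst t))); [apply is_linear_fst|].
apply (is_linear_comp fst snd); [apply is_linear_fst|apply is_linear_snd].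
Qed.
Lemma is_linear_q_j : is_linear (U := Qmod) (V := R_NormedModule) q_j.
Proof.
apply (is_linear_comp (U := Qmod) fst snd); [apply is_linear_fst|apply is_linear_snd].
Qed.
Lemma is_linear_q_k : is_linear (U := Qmod) (V := R_NormedModule) q_k.
Proof. apply (is_linear_snd (U := prod_NormedModule _ _ _)). Qed.

Lemma is_series_linear (pi : quat -> R) (s : nat -> quat) (l : quat) :
  is_linear (U := Qmod) (V := R_NormedModule) pi ->
  is_series (V := Qmod) s l -> is_series (fun n => pi (s n)) (pi l).
Proof.
intros H Hs; unfold is_series in *.
assert (K : filterlim (fun n => pi (sum_n (G := Qmod) s n)) eventually (locally (pi l))).
{ apply (filterlim_comp _ _ _ (sum_n (G := Qmod) s) pi _ _ _ Hs).
  apply (linear_cont (U := Qmod) (V := R_NormedModule) pi l H). }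
revert K; apply filterlim_ext; intros n; induction n as [|n IH].
- rewrite !sum_O; reflexivity.
- rewrite !sum_Sn, (linear_plus _ H), IH; reflexivity.
Qed.

Lemma is_series_quat (s : nat -> quat) (l : quat) :
  is_series (V := Qmod) s l <->
  is_series (fun n => q_re (s n)) (q_re l) /\ is_series (fun n => q_i (s n)) (q_i l) /\
  is_series (fun n => q_j (s n)) (q_j l) /\ is_series (fun n => q_k (s n)) (q_k l).
Proof.
split.
- intros H; repeat split; apply is_series_linear; auto;
  [apply is_linear_q_re|apply is_linear_q_i|apply is_linear_q_j|apply is_linear_q_k].
- intros (H0 & H1 & H2 & H3); rewrite (quat_decomp l).
  apply (is_series_ext (V := Qmod) (fun n => plus (G := Qmod) (plus (G := Qmod) (scal (V := Qmod) (q_re (s n)) (mkq 1 0 0 0)) (scal (V := Qmod) (q_i (s n)) (mkq 0 1 0 0)))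
       (plus (G := Qmod) (scal (V := Qmod) (q_j (s n)) (mkq 0 0 1 0)) (scal (V := Qmod) (q_k (s n)) (mkq 0 0 0 1))))).
    intros n; symmetry; apply quat_decomp.
  assert (S : forall u m e, is_series u m -> is_series (V := Qmod) (fun n => scal (V := Qmod) (u n) e) (scal (V := Qmod) m e)).
  { intros u m e Hu; unfold is_series in *.
    apply (filterlim_ext (fun n => scal (V := Qmod) (sum_n u n) e)).
    - intros n; induction n as [|n IH]; [rewrite !sum_O; reflexivity|].
      rewrite !sum_Sn, <- IH; apply (scal_distr_r (V := Qmod)).
    - apply (filterlim_comp _ _ _ (sum_n u) (fun t => scal (V := Qmod) t e) _ _ _ Hu).
      apply (continuous_scal_l (V := Qmod) (fun t : R => t) e m); apply continuous_id. }
  apply (is_series_plus (V := Qmod)); apply (is_series_plus (V := Qmod)); apply S; auto.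
Qed.

Lemma continuous_quat (U : UniformSpace) (h : U -> quat) (x : U) :
  continuous (fun y => q_re (h y)) x -> continuous (fun y => q_i (h y)) x ->
  continuous (fun y => q_j (h y)) x -> continuous (fun y => q_k (h y)) x ->
  continuous (U := Qmod) h x.
Proof.
intros H0 H1 H2 H3.
apply (continuous_ext (U := Qmod) (fun y => plus (G := Qmod) (plus (G := Qmod) (scal (V := Qmod) (q_re (h y)) (mkq 1 0 0 0)) (scal (V := Qmod) (q_i (h y)) (mkq 0 1 0 0)))
       (plus (G := Qmod) (scal (V := Qmod) (q_j (h y)) (mkq 0 0 1 0)) (scal (V := Qmod) (q_k (h y)) (mkq 0 0 0 1))))).
  intros y; symmetry; apply quat_decomp.
apply (continuous_plus (V := Qmod)); apply (continuous_plus (V := Qmod)); apply (continuous_scal_l (V := Qmod)); auto.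
Qed.

Lemma continuous_quat_linear (U : UniformSpace) (h : U -> quat) (x : U) (pi : quat -> R) :
  is_linear (U := Qmod) (V := R_NormedModule) pi ->
  continuous (U := Qmod) h x -> continuous (fun y => pi (h y)) x.
Proof.
intros H Hh; apply (continuous_comp (V := Qmod) h pi); auto.
apply (linear_cont (U := Qmod) (V := R_NormedModule)); auto.
Qed.

Definition is_derive4 (h : R -> quat) (t : R) (d : quat) : Prop :=
  is_derive (fun s => q_re (h s)) t (q_re d) /\ is_derive (fun s => q_i (h s)) t (q_i d) /\
  is_derive (fun s => q_j (h s)) t (q_j d) /\ is_derive (fun s => q_k (h s)) t (q_k d).

Lemma is_derive4_qDerive h t d : is_derive4 h t d -> qDerive h t = d.
Proof.
intros (H0 & H1 & H2 & H3); unfold qDerive; apply quat_ext; unfold mkq, q_re, q_i, q_j, q_k; simpl;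
  apply is_derive_unique; auto.
Qed.

Lemma is_derive4_ex_derive h t d : is_derive4 h t d -> ex_derive (V := Qmod) h t.
Proof.
intros (H0 & H1 & H2 & H3).
apply (ex_derive_ext (V := Qmod) (fun y => plus (G := Qmod) (plus (G := Qmod) (scal (V := Qmod) (q_re (h y)) (mkq 1 0 0 0)) (scal (V := Qmod) (q_i (h y)) (mkq 0 1 0 0)))
       (plus (G := Qmod) (scal (V := Qmod) (q_j (h y)) (mkq 0 0 1 0)) (scal (V := Qmod) (q_k (h y)) (mkq 0 0 0 1))))).
  intros y; symmetry; apply quat_decomp.
eexists.
apply (is_derive_plus (V := Qmod)); apply (is_derive_plus (V := Qmod)); apply (is_derive_scal_l (V := Qmod)); eauto.
Qed.

Lemma ex_derive_is_derive4 h t : ex_derive (V := Qmod) h t -> is_derive4 h t (qDerive h t).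
Proof.
intros [l Hl].
assert (K : forall pi, is_linear (U := Qmod) (V := R_NormedModule) pi ->
   is_derive (fun s => pi (h s)) t (Derive (fun s => pi (h s)) t)).
{ intros pi Hpi; apply Derive_correct; exists (pi l).
  apply (filterdiff_ext_lin (V := R_NormedModule) _ (fun y => pi (scal (V := Qmod) y l))).
  - apply (filterdiff_comp' (V := Qmod) (W := R_NormedModule) h pi t _ pi Hl).
    apply (filterdiff_linear (U := Qmod) (V := R_NormedModule)); auto.
  - intros y; apply (linear_scal _ Hpi). }
split4; unfold qDerive; simpl; apply K;
  [apply is_linear_q_re|apply is_linear_q_i|apply is_linear_q_j|apply is_linear_q_k].
Qed.

Lemma is_derive4_ext_loc g h t d : locally t (fun s => g s = h s) -> is_derive4 g t d -> is_derive4 h t d.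
Proof.
intros H (H0 & H1 & H2 & H3); split4;
  [revert H0|revert H1|revert H2|revert H3]; apply is_derive_ext_loc; revert H; apply filter_imp; intros s Hs; rewrite Hs; auto.
Qed.

Lemma is_derive4_add g h t d e : is_derive4 g t d -> is_derive4 h t e ->
  is_derive4 (fun s => g s + h s)%quat t (d + e)%quat.
Proof.
intros (H0 & H1 & H2 & H3) (K0 & K1 & K2 & K3); split4; apply (is_derive_plus (V := R_NormedModule)); auto.
Qed.

Lemma lin4_is_derive (a b c e : R) (f g h k : R -> R) t df dg dh dk :
  is_derive f t df -> is_derive g t dg -> is_derive h t dh -> is_derive k t dk ->
  is_derive (fun s => a * f s + b * g s + c * h s + e * k s) t (a * df + b * dg + c * dh + e * dk).
Proof.
intros; apply (is_derive_plus (V := R_NormedModule));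
  [apply (is_derive_plus (V := R_NormedModule)); [apply (is_derive_plus (V := R_NormedModule))|]|]; apply is_derive_scal; auto.
Qed.

Lemma is_derive4_mul_l p h t d : is_derive4 h t d -> is_derive4 (fun s => p * h s)%quat t (p * d)%quat.
Proof.
intros (H0 & H1 & H2 & H3); split4.
- generalize (lin4_is_derive (q_re p) (- q_i p) (- q_j p) (- q_k p) _ _ _ _ _ _ _ _ _ H0 H1 H2 H3).
  same_limit.
  apply is_derive_ext; qunfold; intros; Cring.
- generalize (lin4_is_derive (q_i p) (q_re p) (- q_k p) (q_j p) _ _ _ _ _ _ _ _ _ H0 H1 H2 H3).
  same_limit.
  apply is_derive_ext; qunfold; intros; Cring.
- generalize (lin4_is_derive (q_j p) (q_k p) (q_re p) (- q_i p) _ _ _ _ _ _ _ _ _ H0 H1 H2 H3).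
  same_limit.
  apply is_derive_ext; qunfold; intros; Cring.
- generalize (lin4_is_derive (q_k p) (- q_j p) (q_i p) (q_re p) _ _ _ _ _ _ _ _ _ H0 H1 H2 H3).
  same_limit.
  apply is_derive_ext; qunfold; intros; Cring.
Qed.

Lemma lin4_is_series (a b c e : R) (f g h k : nat -> R) df dg dh dk :
  is_series f df -> is_series g dg -> is_series h dh -> is_series k dk ->
  is_series (fun s => a * f s + b * g s + c * h s + e * k s) (a * df + b * dg + c * dh + e * dk).
Proof.
intros; apply (is_series_plus (V := R_NormedModule));
  [apply (is_series_plus (V := R_NormedModule)); [apply (is_series_plus (V := R_NormedModule))|]|]; apply (is_series_scal (V := R_NormedModule)); auto.
Qed.

Lemma is_series_qmul_l p s l : is_series (V := Qmod) s l ->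
  is_series (V := Qmod) (fun n => p * s n)%quat (p * l)%quat.
Proof.
rewrite !is_series_quat; intros (H0 & H1 & H2 & H3); split4.
- generalize (lin4_is_series (q_re p) (- q_i p) (- q_j p) (- q_k p) _ _ _ _ _ _ _ _ H0 H1 H2 H3).
  same_limit.
  apply is_series_ext; qunfold; intros; Cring.
- generalize (lin4_is_series (q_i p) (q_re p) (- q_k p) (q_j p) _ _ _ _ _ _ _ _ H0 H1 H2 H3).
  same_limit.
  apply is_series_ext; qunfold; intros; Cring.
- generalize (lin4_is_series (q_j p) (q_k p) (q_re p) (- q_i p) _ _ _ _ _ _ _ _ H0 H1 H2 H3).
  same_limit.
  apply is_series_ext; qunfold; intros; Cring.
- generalize (lin4_is_series (q_k p) (- q_j p) (q_i p) (q_re p) _ _ _ _ _ _ _ _ H0 H1 H2 H3).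
  same_limit.
  apply is_series_ext; qunfold; intros; Cring.
Qed.

Lemma is_series_qadd s t l m : is_series (V := Qmod) s l -> is_series (V := Qmod) t m ->
  is_series (V := Qmod) (fun n => s n + t n)%quat (l + m)%quat.
Proof. apply (is_series_plus (V := Qmod)). Qed.

(** * Stem functions *)

Definition qconv (a : nat -> quat) : Prop :=
  disc_conv (fun n => q_re (a n)) /\ disc_conv (fun n => q_i (a n)) /\
  disc_conv (fun n => q_j (a n)) /\ disc_conv (fun n => q_k (a n)).

(** Real and imaginary part of the stem function z |-> sum z^n a_n with values in
    the complexified quaternions. *)
Definition stem_re (a : nat -> quat) (z : C) : quat :=
  mkq (Re (cps (fun n => q_re (a n)) z)) (Re (cps (fun n => q_i (a n)) z))
      (Re (cps (fun n => q_j (a n)) z)) (Re (cps (fun n => q_k (a n)) z)).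

Definition stem_im (a : nat -> quat) (z : C) : quat :=
  mkq (Im (cps (fun n => q_re (a n)) z)) (Im (cps (fun n => q_i (a n)) z))
      (Im (cps (fun n => q_j (a n)) z)) (Im (cps (fun n => q_k (a n)) z)).

Definition qsum (a : nat -> quat) (I : quat) (z : C) : quat :=
  (stem_re a z + I * stem_im a z)%quat.

Lemma is_series_stem_re a z : qconv a -> Cmod z < 1 ->
  is_series (V := Qmod) (fun n => qreal (Re (z ^ n)%C) * a n)%quat (stem_re a z).
Proof.
intros (H0 & H1 & H2 & H3) Hz; apply is_series_quat.
assert (E : forall al, disc_conv al -> is_series (fun n => al n * Re (z ^ n)%C) (Re (cps al z))).
{ intros al Hal; generalize (cps_series al z 1 Hal Hz); rewrite Cmult_1_l.
  apply is_series_ext; intros n; rewrite Cmult_1_l; reflexivity. }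
split4; [generalize (E _ H0)|generalize (E _ H1)|generalize (E _ H2)|generalize (E _ H3)];
  apply is_series_ext; intros n; carriers; qunfold; ring.
Qed.

Lemma is_series_stem_im a z : qconv a -> Cmod z < 1 ->
  is_series (V := Qmod) (fun n => qreal (Im (z ^ n)%C) * a n)%quat (stem_im a z).
Proof.
intros (H0 & H1 & H2 & H3) Hz; apply is_series_quat.
assert (R1 : forall u, Re (- Ci * u)%C = Im u) by (intros [x y]; simpl; ring).
assert (E : forall al, disc_conv al -> is_series (fun n => al n * Im (z ^ n)%C) (Im (cps al z))).
{ intros al Hal; generalize (cps_series al z (- Ci)%C Hal Hz); rewrite R1.
  apply is_series_ext; intros n; rewrite R1; reflexivity. }
split4; [generalize (E _ H0)|generalize (E _ H1)|generalize (E _ H2)|generalize (E _ H3)];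
  apply is_series_ext; intros n; carriers; qunfold; ring.
Qed.

Lemma is_series_qsum a I z : qconv a -> imag_unit I -> Cmod z < 1 ->
  is_series (V := Qmod) (fun n => qpow (qslice I z) n * a n)%quat (qsum a I z).
Proof.
intros Ha HI Hz.
generalize (is_series_qadd _ _ _ _ (is_series_stem_re a z Ha Hz)
  (is_series_qmul_l I _ _ (is_series_stem_im a z Ha Hz))).
apply (is_series_ext (V := Qmod)); intros n.
rewrite qpow_qslice; auto; unfold qslice, slice_pt; qring.
Qed.

Lemma quat_series_unique s l m :
  is_series (V := Qmod) s l -> is_series (V := Qmod) s m -> l = m.
Proof.
rewrite !is_series_quat; intros (A0 & A1 & A2 & A3) (B0 & B1 & B2 & B3).
apply quat_ext; [rewrite <- (is_series_unique _ _ A0)|rewrite <- (is_series_unique _ _ A1)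
  |rewrite <- (is_series_unique _ _ A2)|rewrite <- (is_series_unique _ _ A3)];
  apply is_series_unique; auto.
Qed.

(** * Expansions and the uniqueness of their coefficients *)

Lemma qpow_real x n : qpow (qreal x) n = qreal (x ^ n).
Proof. induction n as [|n IH]; simpl; [reflexivity|rewrite IH; qring]. Qed.

Lemma in_ball_real x : Rabs x < 1 -> in_ball (qreal x).
Proof. unfold in_ball; rewrite qnorm_real; auto. Qed.

Lemma has_expansion_real f a x : has_expansion f a -> Rabs x < 1 ->
  is_series (V := Qmod) (fun n => qreal (x ^ n) * a n)%quat (f (qreal x)).
Proof.
intros H Hx; generalize (H _ (in_ball_real x Hx)); apply (is_series_ext (V := Qmod)); intros n.
rewrite qpow_real; reflexivity.
Qed.

Lemma has_expansion_real4 f a x : has_expansion f a -> Rabs x < 1 ->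
  is_series (fun n => q_re (a n) * x ^ n) (q_re (f (qreal x))) /\
  is_series (fun n => q_i (a n) * x ^ n) (q_i (f (qreal x))) /\
  is_series (fun n => q_j (a n) * x ^ n) (q_j (f (qreal x))) /\
  is_series (fun n => q_k (a n) * x ^ n) (q_k (f (qreal x))).
Proof.
intros H Hx; generalize (has_expansion_real f a x H Hx); rewrite is_series_quat.
intros (A0 & A1 & A2 & A3); split4; [revert A0|revert A1|revert A2|revert A3];
  apply is_series_ext; intros n; carriers; qunfold; ring.
Qed.

(** At real points of the ball the coordinates of the expansion are real power series, and
    convergence there already gives radius of convergence at least 1. *)
Lemma has_expansion_qconv f a : has_expansion f a -> qconv a.
Proof.
intros H; split4; apply disc_conv_intro; intros x Hx;
  destruct (has_expansion_real4 f a x H Hx) as (A0 & A1 & A2 & A3); eexists; eauto.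
Qed.

Lemma in_ball_qslice I z : imag_unit I -> in_ball (qslice I z) <-> Cmod z < 1.
Proof. intros H; unfold in_ball; rewrite qnorm_qslice; tauto. Qed.

Lemma has_expansion_qsum f a I z : has_expansion f a -> imag_unit I -> Cmod z < 1 ->
  f (qslice I z) = qsum a I z.
Proof.
intros H HI Hz; eapply quat_series_unique.
- apply H, in_ball_qslice; auto.
- apply is_series_qsum; auto; eapply has_expansion_qconv; eauto.
Qed.

Lemma has_expansion_of_qsum f a : qconv a ->
  (forall I z, imag_unit I -> Cmod z < 1 -> f (qslice I z) = qsum a I z) -> has_expansion f a.
Proof.
intros Ha H q Hq; destruct (qslice_cover q Hq) as (I & z & HI & Hz & E).
rewrite E, H; auto; apply is_series_qsum; auto.
Qed.

Lemma has_expansion_unique f a b : has_expansion f a -> has_expansion f b -> forall n, a n = b n.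
Proof.
intros Ha Hb n.
assert (H1 : 0 < 1 <= 1) by lra.
apply quat_ext.
- exact (power_series_unique (fun n => q_re (a n)) (fun n => q_re (b n)) (fun x => q_re (f (qreal x))) 1 H1
    (fun x Hx => proj1 (has_expansion_real4 f a x Ha Hx)) (fun x Hx => proj1 (has_expansion_real4 f b x Hb Hx)) n).
- exact (power_series_unique (fun n => q_i (a n)) (fun n => q_i (b n)) (fun x => q_i (f (qreal x))) 1 H1
    (fun x Hx => proj1 (proj2 (has_expansion_real4 f a x Ha Hx))) (fun x Hx => proj1 (proj2 (has_expansion_real4 f b x Hb Hx))) n).
- exact (power_series_unique (fun n => q_j (a n)) (fun n => q_j (b n)) (fun x => q_j (f (qreal x))) 1 H1
    (fun x Hx => proj1 (proj2 (proj2 (has_expansion_real4 f a x Ha Hx)))) (fun x Hx => proj1 (proj2 (proj2 (has_expansion_real4 f b x Hb Hx)))) n).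
- exact (power_series_unique (fun n => q_k (a n)) (fun n => q_k (b n)) (fun x => q_k (f (qreal x))) 1 H1
    (fun x Hx => proj2 (proj2 (proj2 (has_expansion_real4 f a x Ha Hx)))) (fun x Hx => proj2 (proj2 (proj2 (has_expansion_real4 f b x Hb Hx)))) n).
Qed.

(** [coef] chooses some expansion of f; uniqueness along the real axis makes it the given one. *)
Lemma coef_eq f a : has_expansion f a -> forall n, coef f n = a n.
Proof.
intros H; apply has_expansion_unique with f; auto.
unfold coef; apply epsilon_spec; exists a; auto.
Qed.

Lemma has_expansion_ext f a b : (forall n, a n = b n) -> has_expansion f a -> has_expansion f b.
Proof.
intros E H q Hq; generalize (H q Hq); apply (is_series_ext (V := Qmod)); intros n; rewrite E; reflexivity.
Qed.

Lemma has_expansion_ext_fun f g a : (forall q, in_ball q -> f q = g q) -> has_expansion f a -> has_expansion g a.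
Proof. intros E H q Hq; rewrite <- E; auto. Qed.

Lemma has_expansion_qseries a : qconv a -> has_expansion (qseries a) a.
Proof.
intros Ha; apply has_expansion_of_qsum; auto; intros I z HI Hz.
generalize (is_series_qsum a I z Ha HI Hz); rewrite is_series_quat; intros (A0 & A1 & A2 & A3).
apply quat_ext; apply is_series_unique; auto.
Qed.

(** * The slice derivative of a power series *)

Definition qderiv (a : nat -> quat) (n : nat) : quat := (qreal (INR (S n)) * a (S n))%quat.

Lemma qderiv_comps a :
  (forall n, q_re (qderiv a n) = PS_derive (fun n => q_re (a n)) n) /\
  (forall n, q_i (qderiv a n) = PS_derive (fun n => q_i (a n)) n) /\
  (forall n, q_j (qderiv a n) = PS_derive (fun n => q_j (a n)) n) /\
  (forall n, q_k (qderiv a n) = PS_derive (fun n => q_k (a n)) n).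
Proof. split4; intros n; unfold qderiv, PS_derive; qunfold; ring. Qed.

Lemma disc_conv_ext a b : (forall n, a n = b n) -> disc_conv a -> disc_conv b.
Proof. intros E; unfold disc_conv; rewrite (CV_radius_ext a b E); auto. Qed.

Lemma qconv_qderiv a : qconv a -> qconv (qderiv a).
Proof.
intros (H0 & H1 & H2 & H3); destruct (qderiv_comps a) as (E0 & E1 & E2 & E3).
split4; [apply disc_conv_ext with (2 := disc_conv_derive _ H0)|apply disc_conv_ext with (2 := disc_conv_derive _ H1)
 |apply disc_conv_ext with (2 := disc_conv_derive _ H2)|apply disc_conv_ext with (2 := disc_conv_derive _ H3)]; auto.
Qed.

Lemma stem_qderiv a z :
  stem_re (qderiv a) z = mkq (Re (cps (PS_derive (fun n => q_re (a n))) z)) (Re (cps (PS_derive (fun n => q_i (a n))) z))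
    (Re (cps (PS_derive (fun n => q_j (a n))) z)) (Re (cps (PS_derive (fun n => q_k (a n))) z)) /\
  stem_im (qderiv a) z = mkq (Im (cps (PS_derive (fun n => q_re (a n))) z)) (Im (cps (PS_derive (fun n => q_i (a n))) z))
    (Im (cps (PS_derive (fun n => q_j (a n))) z)) (Im (cps (PS_derive (fun n => q_k (a n))) z)).
Proof.
destruct (qderiv_comps a) as (E0 & E1 & E2 & E3).
unfold stem_re, stem_im.
rewrite (cps_ext _ _ z E0), (cps_ext _ _ z E1), (cps_ext _ _ z E2), (cps_ext _ _ z E3); auto.
Qed.

Lemma cps_curve al g1 g2 t d1 d2 : disc_conv al -> Cmod (g1 t, g2 t) < 1 ->
  is_derive g1 t d1 -> is_derive g2 t d2 ->
  is_derive (fun s => Re (cps al (g1 s, g2 s))) t (Re (cps (PS_derive al) (g1 t, g2 t) * (d1, d2))%C) /\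
  is_derive (fun s => Im (cps al (g1 s, g2 s))) t (Im (cps (PS_derive al) (g1 t, g2 t) * (d1, d2))%C).
Proof.
intros Hal Hz H1 H2; apply is_derive_cdiff_comp; auto.
apply (holo_cps al Hal); auto.
Qed.

(** A curve [g] in the disc is pushed forward by the stem function; [d1 + i d2] is its velocity. *)
Lemma stem_curve a g1 g2 t d1 d2 : qconv a -> Cmod (g1 t, g2 t) < 1 ->
  is_derive g1 t d1 -> is_derive g2 t d2 ->
  is_derive4 (fun s => stem_re a (g1 s, g2 s)) t
    (qreal d1 * stem_re (qderiv a) (g1 t, g2 t) - qreal d2 * stem_im (qderiv a) (g1 t, g2 t))%quat /\
  is_derive4 (fun s => stem_im a (g1 s, g2 s)) t
    (qreal d2 * stem_re (qderiv a) (g1 t, g2 t) + qreal d1 * stem_im (qderiv a) (g1 t, g2 t))%quat.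
Proof.
intros (H0 & H1 & H2 & H3) Hz K1 K2.
destruct (stem_qderiv a (g1 t, g2 t)) as [E1 E2]; rewrite E1, E2.
generalize (cps_curve _ g1 g2 t d1 d2 H0 Hz K1 K2) (cps_curve _ g1 g2 t d1 d2 H1 Hz K1 K2)
 (cps_curve _ g1 g2 t d1 d2 H2 Hz K1 K2) (cps_curve _ g1 g2 t d1 d2 H3 Hz K1 K2).
intros (A0 & B0) (A1 & B1) (A2 & B2) (A3 & B3).
split; split4.
- revert A0; same_limit; auto.
- revert A1; same_limit; auto.
- revert A2; same_limit; auto.
- revert A3; same_limit; auto.
- revert B0; same_limit; auto.
- revert B1; same_limit; auto.
- revert B2; same_limit; auto.
- revert B3; same_limit; auto.
Qed.

(** Left multiplication by x + y I acts on the pair (u, v) as x + i y acts on u + i v. *)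
Lemma slice_pt_mul_stem I x y u v : imag_unit I ->
  (slice_pt I x y * (u + I * v) =
   (qreal x * u - qreal y * v) + I * (qreal y * u + qreal x * v))%quat.
Proof.
intros HI; unfold imag_unit in HI; unfold slice_pt.
assert (S : forall r w, (I * (qreal r * w) = qreal r * (I * w))%quat).
{ intros r w; rewrite qmul_assoc, <- qreal_comm, <- qmul_assoc; reflexivity. }
assert (N : (qreal y * I * (I * v) = - (qreal y * v))%quat).
{ rewrite <- qmul_assoc, (qmul_assoc I I), HI, qmul_assoc; clear; qring. }
rewrite !qmul_addl, !qmul_addr, N, !S, <- qmul_assoc.
generalize (qreal x * u)%quat (qreal y * v)%quat (qreal x * (I * v))%quat (qreal y * (I * u))%quat.
clear; qring.
Qed.

(** The velocity enters as a left factor from the slice; the velocities 1 and i will give the two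
    partial derivatives. *)
Lemma qsum_curve a I g1 g2 t d1 d2 : qconv a -> imag_unit I -> Cmod (g1 t, g2 t) < 1 ->
  is_derive g1 t d1 -> is_derive g2 t d2 ->
  is_derive4 (fun s => qsum a I (g1 s, g2 s)) t (qslice I (d1, d2) * qsum (qderiv a) I (g1 t, g2 t))%quat.
Proof.
intros Ha HI Hz K1 K2.
destruct (stem_curve a g1 g2 t d1 d2 Ha Hz K1 K2) as [A B].
assert (E : (qslice I (d1, d2) * qsum (qderiv a) I (g1 t, g2 t))%quat =
 ((qreal d1 * stem_re (qderiv a) (g1 t, g2 t) - qreal d2 * stem_im (qderiv a) (g1 t, g2 t)) +
  I * (qreal d2 * stem_re (qderiv a) (g1 t, g2 t) + qreal d1 * stem_im (qderiv a) (g1 t, g2 t)))%quat).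
{ apply slice_pt_mul_stem; auto. }
rewrite E; apply is_derive4_add; auto; apply is_derive4_mul_l; auto.
Qed.

Lemma locally_disc (z : C) : Cmod z < 1 -> locally z (fun w => Cmod w < 1).
Proof.
intros Hz; apply locally_Cmod.
assert (Hd : 0 < 1 - Cmod z) by lra.
exists (mkposreal _ Hd); simpl; intros w Hw.
replace w with ((w - z) + z)%C by ring.
apply Rle_lt_trans with (1 := Cmod_triangle _ _); lra.
Qed.

Lemma locally_curve (P : C -> Prop) g1 g2 t d1 d2 : locally (g1 t, g2 t) P ->
  is_derive g1 t d1 -> is_derive g2 t d2 -> locally t (fun s => P (g1 s, g2 s)).
Proof.
intros HP H1 H2.
assert (Hc : continuous (fun s => (g1 s, g2 s) : C) t).
{ apply continuous_Cpair.
  - apply (ex_derive_continuous (V := R_NormedModule) g1); eexists; eauto.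
  - apply (ex_derive_continuous (V := R_NormedModule) g2); eexists; eauto. }
exact (Hc P HP).
Qed.

Section SliceDerivative.

Variables (f : quat -> quat) (a : nat -> quat).
Hypothesis Hf : has_expansion f a.

Lemma expansion_curve I g1 g2 t d1 d2 : imag_unit I -> Cmod (g1 t, g2 t) < 1 ->
  is_derive g1 t d1 -> is_derive g2 t d2 ->
  is_derive4 (fun s => f (slice_pt I (g1 s) (g2 s))) t
    (qslice I (d1, d2) * qsum (qderiv a) I (g1 t, g2 t))%quat.
Proof.
intros HI Hz K1 K2.
apply is_derive4_ext_loc with (fun s => qsum a I (g1 s, g2 s)).
- generalize (locally_curve _ _ _ _ _ _ (locally_disc _ Hz) K1 K2); apply filter_imp; intros s Hs.
  symmetry; apply (has_expansion_qsum f a I (g1 s, g2 s)); auto.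
- apply qsum_curve; auto; apply has_expansion_qconv with f; auto.
Qed.

Lemma expansion_dx I x y : imag_unit I -> Cmod (x, y) < 1 ->
  is_derive4 (fun s => f (slice_pt I s y)) x (qsum (qderiv a) I (x, y)).
Proof.
intros HI Hz.
assert (E : qsum (qderiv a) I (x, y) = (qslice I (1%R, 0%R) * qsum (qderiv a) I (x, y))%quat).
{ replace (qslice I (1%R, 0%R)) with (qreal 1) by (symmetry; apply (qslice_real I 1)).
  rewrite qmul_1l; reflexivity. }
rewrite E; exact (expansion_curve I (fun s => s) (fun _ => y) x 1 0 HI Hz (is_derive_id x) (is_derive_const y x)).
Qed.

Lemma expansion_dy I x y : imag_unit I -> Cmod (x, y) < 1 ->
  is_derive4 (fun s => f (slice_pt I x s)) y (I * qsum (qderiv a) I (x, y))%quat.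
Proof.
intros HI Hz.
assert (E : I = qslice I (0%R, 1%R)) by (unfold qslice, slice_pt, Re, Im; simpl; qring).
rewrite E at 1; exact (expansion_curve I (fun _ => x) (fun s => s) y 0 1 HI Hz (is_derive_const x y) (is_derive_id y)).
Qed.

Lemma continuous_qsum b I z : qconv b -> Cmod z < 1 -> continuous (U := Qmod) (qsum b I) z.
Proof.
intros (H0 & H1 & H2 & H3) Hz.
assert (K : forall al, disc_conv al -> continuous (fun w => Re (cps al w)) z /\ continuous (fun w => Im (cps al w)) z).
{ intros al Hal.
  assert (continuous (cps al) z) by (eapply cdiff_continuous; apply (holo_cps al Hal); auto).
  split; [apply continuous_CRe|apply continuous_CIm]; auto. }
destruct (K _ H0), (K _ H1), (K _ H2), (K _ H3).
apply (continuous_plus (V := Qmod) (stem_re b) (fun w => I * stem_im b w)%quat).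
- apply continuous_quat; auto.
- assert (L : forall c0 c1 c2 c3,
    continuous (fun w => c0 * q_re (stem_im b w) + c1 * q_i (stem_im b w) + c2 * q_j (stem_im b w) + c3 * q_k (stem_im b w)) z).
  { intros; apply (continuous_plus (V := R_NormedModule));
      [apply (continuous_plus (V := R_NormedModule)); [apply (continuous_plus (V := R_NormedModule))|]|];
      apply (continuous_scal_r (V := R_NormedModule)); auto. }
  apply continuous_quat.
  + generalize (L (q_re I) (- q_i I) (- q_j I) (- q_k I)); apply continuous_ext; intros w; carriers; qunfold; ring.
  + generalize (L (q_i I) (q_re I) (- q_k I) (q_j I)); apply continuous_ext; intros w; carriers; qunfold; ring.
  + generalize (L (q_j I) (q_k I) (q_re I) (- q_i I)); apply continuous_ext; intros w; carriers; qunfold; ring.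
  + generalize (L (q_k I) (- q_j I) (q_i I) (q_re I)); apply continuous_ext; intros w; carriers; qunfold; ring.
Qed.

Lemma has_expansion_slice_regular : slice_regular f.
Proof.
assert (Ha := has_expansion_qconv f a Hf); assert (Hd := qconv_qderiv a Ha).
intros I HI x y Hxy.
assert (Hz : Cmod (x, y) < 1) by (apply (in_ball_qslice I (x, y)); auto).
assert (Dx := expansion_dx I x y HI Hz); assert (Dy := expansion_dy I x y HI Hz).
split; [apply is_derive4_ex_derive with (1 := Dx)|].
split; [apply is_derive4_ex_derive with (1 := Dy)|].
split; [|split].
- apply (continuous_ext_loc (U := Qmod) _ (qsum (qderiv a) I)); [|apply continuous_qsum; auto].
  generalize (locally_disc _ Hz); apply filter_imp; intros [u v] Hw.
  symmetry; apply is_derive4_qDerive, expansion_dx; auto.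
- apply (continuous_ext_loc (U := Qmod) _ (fun w => I * qsum (qderiv a) I w)%quat).
  + generalize (locally_disc _ Hz); apply filter_imp; intros [u v] Hw.
    symmetry; apply is_derive4_qDerive, expansion_dy; auto.
  + assert (K := continuous_qsum (qderiv a) I (x, y) Hd Hz).
    assert (L : forall c0 c1 c2 c3, continuous (fun w => c0 * q_re (qsum (qderiv a) I w) +
       c1 * q_i (qsum (qderiv a) I w) + c2 * q_j (qsum (qderiv a) I w) + c3 * q_k (qsum (qderiv a) I w)) (x, y)).
    { intros; apply (continuous_plus (V := R_NormedModule));
      [apply (continuous_plus (V := R_NormedModule)); [apply (continuous_plus (V := R_NormedModule))|]|];
        apply (continuous_scal_r (V := R_NormedModule)); apply continuous_quat_linear; auto;
        [apply is_linear_q_re|apply is_linear_q_i|apply is_linear_q_j|apply is_linear_q_k]. }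
    apply continuous_quat.
    * generalize (L (q_re I) (- q_i I) (- q_j I) (- q_k I)); apply continuous_ext; intros w; carriers; qunfold; ring.
    * generalize (L (q_i I) (q_re I) (- q_k I) (q_j I)); apply continuous_ext; intros w; carriers; qunfold; ring.
    * generalize (L (q_j I) (q_k I) (q_re I) (- q_i I)); apply continuous_ext; intros w; carriers; qunfold; ring.
    * generalize (L (q_k I) (- q_j I) (q_i I) (q_re I)); apply continuous_ext; intros w; carriers; qunfold; ring.
- unfold slice_dx, slice_dy.
  rewrite (is_derive4_qDerive _ _ _ Dx), (is_derive4_qDerive _ _ _ Dy), qmul_assoc, HI; qring.
Qed.

Lemma slice_derivative_qsum q : in_ball q ->
  slice_derivative f q = qsum (qderiv a) (slice_unit q) (q_re q, im_norm q).
Proof.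
intros Hq; unfold slice_derivative, slice_dx, slice_dy.
assert (HI := slice_unit_imag q).
assert (Hz : Cmod (q_re q, im_norm q) < 1).
{ apply (in_ball_qslice (slice_unit q)); auto; rewrite qslice_slice_unit; auto. }
rewrite (is_derive4_qDerive _ _ _ (expansion_dx _ _ _ HI Hz)),
  (is_derive4_qDerive _ _ _ (expansion_dy _ _ _ HI Hz)), qmul_assoc, HI.
generalize (qsum (qderiv a) (slice_unit q) (q_re q, im_norm q)); clear; intros; qdestruct.
apply quat_ext; qunfold; field.
Qed.

Lemma has_expansion_slice_derivative : has_expansion (slice_derivative f) (qderiv a).
Proof.
intros q Hq; rewrite slice_derivative_qsum; auto.
assert (HI := slice_unit_imag q).
assert (E := qslice_slice_unit q).
assert (Hz : Cmod (q_re q, im_norm q) < 1).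
{ apply (in_ball_qslice (slice_unit q)); auto; rewrite E; auto. }
generalize (is_series_qsum (qderiv a) _ _ (qconv_qderiv a (has_expansion_qconv f a Hf)) HI Hz).
apply (is_series_ext (V := Qmod)); intros n; rewrite E; reflexivity.
Qed.

End SliceDerivative.

Definition qshift (a : nat -> quat) (n : nat) : quat :=
  match n with O => qreal 0 | S m => a m end.

Lemma has_expansion_shift f a : has_expansion f a -> has_expansion (fun q => q * f q)%quat (qshift a).
Proof.
intros H q Hq.
apply (is_series_decr_1 (K := R_AbsRing) (V := Qmod)).
match goal with |- is_series _ ?x => replace x with (q * f q)%quat end.
- apply (is_series_ext (V := Qmod) (fun n => q * (qpow q n * a n))%quat).
    intros n; simpl; apply qmul_assoc.
  apply is_series_qmul_l; auto.
- change ((q * f q)%quat = (q * f q - (qreal 1 * qreal 0))%quat); qring.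
Qed.

Lemma has_expansion_add f g a b : has_expansion f a -> has_expansion g b ->
  has_expansion (fun q => f q + g q)%quat (fun n => a n + b n)%quat.
Proof.
intros H1 H2 q Hq; generalize (is_series_qadd _ _ _ _ (H1 q Hq) (H2 q Hq)).
apply (is_series_ext (V := Qmod)); intros n; symmetry; apply qmul_addr.
Qed.

Lemma has_expansion_fun_unique f g a : has_expansion f a -> has_expansion g a ->
  forall q, in_ball q -> f q = g q.
Proof. intros H1 H2 q Hq; eapply quat_series_unique; [apply H1|apply H2]; auto. Qed.

(** * Slice regular functions are power series *)

Lemma is_series_qdot e s l : is_series (V := Qmod) s l -> is_series (fun n => qdot e (s n)) (qdot e l).
Proof. rewrite is_series_quat; intros (H0 & H1 & H2 & H3); apply lin4_is_series; auto. Qed.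

Lemma is_derive_qdot e h t d : is_derive4 h t d -> is_derive (fun s => qdot e (h s)) t (qdot e d).
Proof. intros (H0 & H1 & H2 & H3); apply lin4_is_derive; auto. Qed.

Lemma continuous_qdot (U : UniformSpace) e (h : U -> quat) x :
  continuous (U := Qmod) h x -> continuous (fun y => qdot e (h y)) x.
Proof.
intros H; unfold qdot.
apply (continuous_plus (V := R_NormedModule));
  [apply (continuous_plus (V := R_NormedModule)); [apply (continuous_plus (V := R_NormedModule))|]|];
  apply (continuous_scal_r (V := R_NormedModule)); apply continuous_quat_linear; auto;
  [apply is_linear_q_re|apply is_linear_q_i|apply is_linear_q_j|apply is_linear_q_k].
Qed.

Lemma continuous_qmul_l (U : UniformSpace) p (h : U -> quat) x :
  continuous (U := Qmod) h x -> continuous (U := Qmod) (fun y => p * h y)%quat x.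
Proof.
intros H.
assert (L := fun e => continuous_qdot _ e h x H).
apply continuous_quat.
- generalize (L (mkq (q_re p) (- q_i p) (- q_j p) (- q_k p))); apply continuous_ext; intros w; carriers; unfold qdot; qunfold; ring.
- generalize (L (mkq (q_i p) (q_re p) (- q_k p) (q_j p))); apply continuous_ext; intros w; carriers; unfold qdot; qunfold; ring.
- generalize (L (mkq (q_j p) (q_k p) (q_re p) (- q_i p))); apply continuous_ext; intros w; carriers; unfold qdot; qunfold; ring.
- generalize (L (mkq (q_k p) (- q_j p) (q_i p) (q_re p))); apply continuous_ext; intros w; carriers; unfold qdot; qunfold; ring.
Qed.

Lemma qmul_0r q : (q * qreal 0 = qreal 0)%quat.
Proof. qring. Qed.

Lemma qsub_eq0 p q : (p - q = qreal 0)%quat -> p = q.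
Proof.
intros H; transitivity ((p - q) + q)%quat; [qring|rewrite H; qring].
Qed.

(** A complex coordinate: multiplication by [I] on the left becomes multiplication
    by the imaginary unit of [C]. *)
Definition qcoord (e I q : quat) : C := (qdot e q, - qdot e (I * q)%quat).

Lemma differentiable_Cmod (u : R -> R -> R) (x y lx ly : R) (eps : posreal) :
  differentiable_pt_lim u x y lx ly ->
  locally (x, y) (fun w : C => Rabs (u (Re w) (Im w) - u x y - (lx * (Re w - x) + ly * (Im w - y)))
     <= eps * Cmod (w - (x, y))).
Proof.
intros H; specialize (H eps); apply locally_2d_locally in H.
revert H; apply filter_imp; intros [s t] Hw; simpl in *.
apply Rle_trans with (1 := Hw), Rmult_le_compat_l; [apply Rlt_le, eps|].
destruct (Cmod_ge_Re_Im ((s, t) - (x, y))%C) as [h1 h2]; simpl in h1, h2.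
apply Rmax_lub; auto.
Qed.

Lemma differentiable_of_partial (u ux : R -> R -> R) (x y uy : R) :
  locally (x, y) (fun w : C => is_derive (fun s => u s (Im w)) (Re w) (ux (Re w) (Im w))) ->
  is_derive (fun s => u x s) y uy ->
  continuous (fun w : C => ux (Re w) (Im w)) (x, y) ->
  differentiable_pt_lim u x y (ux x y) uy.
Proof.
intros H1 H2 H3; apply filterdiff_differentiable_pt_lim.
exact (is_derive_filterdiff u x y ux uy H1 H2 H3).
Qed.

Section Expansion.

Variable f : quat -> quat.
Hypothesis Hf : slice_regular f.

(** The Cauchy-Riemann equation multiplied on the left by 2 I says that the derivative in y is I
    times the derivative in x. *)
Lemma slice_regular_derive I x y : imag_unit I -> Cmod (x, y) < 1 ->
  is_derive4 (fun s => f (slice_pt I s y)) x (slice_dx f I x y) /\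
  is_derive4 (fun s => f (slice_pt I x s)) y (I * slice_dx f I x y)%quat /\
  continuous (U := Qmod) (fun z : R * R => slice_dx f I (fst z) (snd z)) (x, y).
Proof.
intros HI Hz.
destruct (Hf I HI x y) as (D1 & D2 & C1 & _ & CR).
{ apply (in_ball_qslice I (x, y)); auto. }
apply ex_derive_is_derive4 in D1; apply ex_derive_is_derive4 in D2.
split; [exact D1|split; [|exact C1]].
replace (I * slice_dx f I x y)%quat with (slice_dy f I x y); [exact D2|].
set (dx := slice_dx f I x y) in *; set (dy := slice_dy f I x y) in *.
assert (E : (dx + I * dy)%quat = qreal 0).
{ transitivity (qreal 2 * (qreal (1 / 2) * (dx + I * dy)))%quat.
  - rewrite qmul_assoc; replace (qreal 2 * qreal (1 / 2))%quat with (qreal 1).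
      rewrite qmul_1l; reflexivity.
    apply quat_ext; qunfold; field.
  - rewrite CR; clear; qring. }
assert (E2 : (I * (dx + I * dy))%quat = (I * dx - dy)%quat).
{ unfold imag_unit in HI; rewrite qmul_addr, qmul_assoc, HI.
  generalize (I * dx)%quat; clearbody dy; clear; qring. }
rewrite E, qmul_0r in E2; symmetry in E2; apply qsub_eq0 in E2; auto.
Qed.

(** Because [qcoord e I] turns left multiplication by I into multiplication by i, f restricted to
    the slice becomes a scalar holomorphic function. Letting e vary takes the place of splitting the
    quaternions over the slice. *)
Lemma holo_qcoord e I : imag_unit I ->
  holo 1 (fun z => qcoord e I (f (qslice I z))) (fun z => qcoord e I (slice_dx f I (Re z) (Im z))).
Proof.
intros HI z Hz.
destruct z as [x y].
assert (D := fun w (Hw : Cmod w < 1) => slice_regular_derive I (Re w) (Im w) HI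
  ltac:(replace (Re w, Im w) with w by (destruct w; reflexivity); exact Hw)).
destruct (D (x, y) Hz) as (D1 & D2 & C1); simpl in D1, D2, C1.
assert (HII : (I * I)%quat = qreal (-1)) by exact HI.
assert (Hneg : forall q, qdot e (I * (I * q))%quat = - qdot e q).
{ intros q; rewrite qmul_assoc, HII; unfold qdot; qunfold; ring. }
assert (C2 : forall e', continuous (fun w : C => qdot e' (slice_dx f I (Re w) (Im w))) (x, y)).
{ intros e'; apply continuous_qdot; exact C1. }
assert (C3 : continuous (U := Qmod) (fun w : C => I * slice_dx f I (Re w) (Im w))%quat (x, y)).
{ apply continuous_qmul_l; exact C1. }
split.
- apply cdiff_of_estimate; intros eps.
  assert (He : 0 < eps / 2) by (destruct eps; simpl; lra).
  assert (A1 : differentiable_pt_lim (fun s t => qdot e (f (slice_pt I s t))) x y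
    (qdot e (slice_dx f I x y)) (qdot e (I * slice_dx f I x y)%quat)).
  { apply (differentiable_of_partial _ (fun s t => qdot e (slice_dx f I s t))).
    - generalize (locally_disc _ Hz); apply filter_imp; intros w Hw.
      apply is_derive_qdot; apply (D w Hw).
    - apply is_derive_qdot; exact D2.
    - apply continuous_qdot; exact C1. }
  assert (A2 : differentiable_pt_lim (fun s t => qdot e (I * f (slice_pt I s t))%quat) x y
    (qdot e (I * slice_dx f I x y)%quat) (qdot e (I * (I * slice_dx f I x y))%quat)).
  { apply (differentiable_of_partial _ (fun s t => qdot e (I * slice_dx f I s t)%quat)).
    - generalize (locally_disc _ Hz); apply filter_imp; intros w Hw.
      apply is_derive_qdot, is_derive4_mul_l; apply (D w Hw).
    - apply is_derive_qdot, is_derive4_mul_l; exact D2.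
    - apply continuous_qdot; exact C3. }
  generalize (filter_and _ _ (differentiable_Cmod _ _ _ _ _ (mkposreal _ He) A1)
    (differentiable_Cmod _ _ _ _ _ (mkposreal _ He) A2)).
  apply filter_imp; intros w [h1 h2]; simpl in h1, h2.
  apply Rle_trans with (1 := Cmod_le_Re_Im _).
  set (M := Cmod (w - (x, y))) in *.
  rewrite Hneg in h2.
  replace (eps * M) with (eps / 2 * M + eps / 2 * M) by field.
  apply Rplus_le_compat.
  + eapply Rle_trans; [|exact h1]; right; f_equal.
    unfold qcoord, qslice, Re, Im; simpl; unfold Re, Im; ring.
  + rewrite <- Rabs_Ropp; eapply Rle_trans; [|exact h2]; right; f_equal.
    unfold qcoord, qslice, Re, Im; simpl; unfold Re, Im; ring.
- apply continuous_Cpair; [apply C2|].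
  apply (continuous_opp (V := R_NormedModule)), continuous_qdot; exact C3.
Qed.

(** The last two clauses describe the coefficients through values on the real axis, which all slices
    share; this ties the expansions on different slices together. *)
Lemma slice_regular_coord e I : imag_unit I -> exists c : nat -> C,
  (forall z, Cmod z < 1 -> is_series (fun n => Re (z ^ n * c n)%C) (qdot e (f (qslice I z)))) /\
  (forall x, Rabs x < 1 -> is_series (fun n => Re (c n) * x ^ n) (qdot e (f (qreal x)))) /\
  (forall x, Rabs x < 1 -> is_series (fun n => Im (c n) * x ^ n) (- qdot e (I * f (qreal x))%quat)).
Proof.
intros HI; destruct (taylor_unit_disc _ _ (holo_qcoord e I HI)) as [c Hc].
exists c; split; [|split].
- intros z Hz; generalize (Hc z 1%C Hz); rewrite Cmult_1_l; simpl Re at 2.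
  apply is_series_ext; intros n; rewrite Cmult_1_l; reflexivity.
- intros x Hx; generalize (Hc x 1%C ltac:(rewrite Cmod_R; auto)); rewrite Cmult_1_l, qslice_real.
  apply is_series_ext; intros n; rewrite Cmult_1_l, <- RtoC_pow, Cmult_comm, Re_mult_RtoC; reflexivity.
- intros x Hx; generalize (Hc x (- Ci)%C ltac:(rewrite Cmod_R; auto)); rewrite qslice_real.
  replace (Re (- Ci * qcoord e I (f (qreal x)))%C) with (- qdot e (I * f (qreal x))%quat) by (simpl; ring).
  apply is_series_ext; intros n; rewrite <- RtoC_pow, <- Cmult_assoc, (Cmult_comm (RtoC _)), Cmult_assoc, Re_mult_RtoC.
  carriers; destruct (c n); simpl; ring.
Qed.

Lemma slice_regular_real_axis : exists a : nat -> quat, forall x, Rabs x < 1 ->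
  is_series (V := Qmod) (fun n => qreal (x ^ n) * a n)%quat (f (qreal x)).
Proof.
assert (HI : imag_unit (mkq 0 1 0 0)) by (apply imag_unit_iff; qunfold; split; ring).
destruct (slice_regular_coord (mkq 1 0 0 0) _ HI) as (c0 & _ & H0 & _).
destruct (slice_regular_coord (mkq 0 1 0 0) _ HI) as (c1 & _ & H1 & _).
destruct (slice_regular_coord (mkq 0 0 1 0) _ HI) as (c2 & _ & H2 & _).
destruct (slice_regular_coord (mkq 0 0 0 1) _ HI) as (c3 & _ & H3 & _).
exists (fun n => mkq (Re (c0 n)) (Re (c1 n)) (Re (c2 n)) (Re (c3 n))); intros x Hx.
apply is_series_quat; split4; [generalize (H0 x Hx)|generalize (H1 x Hx)|generalize (H2 x Hx)|generalize (H3 x Hx)];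
  same_limit;
  apply is_series_ext; intros n; carriers; qunfold; ring.
Qed.

(** The [a n] come from the real axis. For each slice and each e, uniqueness there identifies the
    complex coefficient [c n] with [qcoord e I (a n)], and Re (z^n c n) is then the inner product of
    e with (x + y I)^n a n. *)
Theorem slice_regular_expansion : exists a : nat -> quat, has_expansion f a.
Proof.
destruct slice_regular_real_axis as [a Ha]; exists a; intros q Hq.
destruct (qslice_cover q Hq) as (I & z & HI & Hz & E); subst q.
assert (Hle : 0 < 1 <= 1) by lra.
assert (key : forall e, is_series (fun n => qdot e (qpow (qslice I z) n * a n)%quat) (qdot e (f (qslice I z)))).
{ intros e; destruct (slice_regular_coord e I HI) as (c & Hz1 & Hx1 & Hx2).
  assert (E1 : forall n, Re (c n) = qdot e (a n)).
  { apply (power_series_unique _ _ (fun x => qdot e (f (qreal x))) 1 Hle Hx1); intros x Hx.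
    generalize (is_series_qdot e _ _ (Ha x Hx)); apply is_series_ext; intros n; carriers; unfold qdot; qunfold; ring. }
  assert (E2 : forall n, Im (c n) = - qdot e (I * a n)%quat).
  { apply (power_series_unique _ _ (fun x => - qdot e (I * f (qreal x))%quat) 1 Hle Hx2); intros x Hx.
    generalize (is_series_opp (V := R_NormedModule) _ _ (is_series_qdot e _ _ (is_series_qmul_l I _ _ (Ha x Hx)))).
    apply is_series_ext; intros n; carriers; unfold opp; simpl; unfold qdot; qunfold; ring. }
  generalize (Hz1 z Hz); apply is_series_ext; intros n.
  rewrite qpow_qslice; auto.
  replace (Re (z ^ n * c n)%C) with (Re (z ^ n)%C * Re (c n) - Im (z ^ n)%C * Im (c n)) by reflexivity.
  rewrite E1, E2; generalize (z ^ n)%C (a n); intros w b; clear.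
  carriers; unfold qdot, qslice, slice_pt; qdestruct; destruct w; unfold Re, Im; simpl fst; simpl snd; qunfold; ring. }
apply is_series_quat; split4;
  [generalize (key (mkq 1 0 0 0))|generalize (key (mkq 0 1 0 0))|generalize (key (mkq 0 0 1 0))|generalize (key (mkq 0 0 0 1))];
  (same_limit;
  apply is_series_ext; intros n; generalize (qpow (qslice I z) n * a n)%quat; clear; intros w;
  carriers; unfold qdot; qdestruct; qunfold; ring).
Qed.

End Expansion.

(** * The regular quotient *)

Lemma qdot_mul_l p u v : qdot (p * u) (p * v) = qdot p p * qdot u v.
Proof. unfold qdot; qdestruct; qunfold; ring. Qed.

Lemma qdot_self_pos q : q <> qreal 0 -> 0 < qdot q q.
Proof. intros H; apply qnorm_pos in H; rewrite <- qnorm_sqr; apply pow_lt; auto. Qed.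

(** Below [b + i c] is the value of the stem function of [phi] at [z]; so [phi] is
    [b + I c] at [qslice I z].  Its complexified square norm is: *)
Definition stem_norm (b c : quat) : C := (qdot b b - qdot c c, 2 * qdot b c).

(** The value at [qslice I z] of the regular conjugate of [phi]. *)
Definition stem_conj (b c I : quat) : quat := (qconj b + I * qconj c)%quat.

(** The regular product of phi^c and phi. Since conj b b, conj c c and conj c b + conj b c are real,
    the result, which is the symmetrization, lies in the slice of I. *)
Lemma stem_conj_norm b c I : imag_unit I ->
  (stem_conj b c I * b + I * (stem_conj b c I * c))%quat = qslice I (stem_norm b c).
Proof.
intros HI; unfold stem_conj.
transitivity ((qconj b * b + (I * I) * (qconj c * c)) + I * (qconj c * b + qconj b * c))%quat.
- rewrite !qmul_addl, !qmul_addr, <- !qmul_assoc.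
  generalize (qconj b * b)%quat (I * (qconj c * b))%quat (I * (qconj b * c))%quat (I * (I * (qconj c * c)))%quat.
  clear; qring.
- unfold imag_unit in HI; rewrite HI.
  replace (qconj c * b + qconj b * c)%quat with (qreal (2 * qdot b c)) by (clear; unfold qdot; qring).
  rewrite !qconj_mul_self, !qnorm_sqr, <- qreal_comm.
  unfold qslice, slice_pt, stem_norm, Re, Im; simpl fst; simpl snd.
  generalize (qdot b b) (qdot c c) (2 * qdot b c); clear; qring.
Qed.

Lemma stem_conj_nz b c I : imag_unit I -> stem_norm b c <> 0 -> stem_conj b c I <> qreal 0.
Proof.
intros HI HN H0; apply HN, Cmod_eq_0.
rewrite <- (qnorm_qslice I) by auto.
rewrite <- (stem_conj_norm b c I HI), H0.
replace (qreal 0 * b + I * (qreal 0 * c))%quat with (qreal 0) by (clear; qring).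
rewrite qnorm_real; apply Rabs_R0.
Qed.

Lemma imag_unit_scaled k w : 0 < k -> q_re w = 0 -> qdot w w = k * k -> imag_unit (qreal (- / k) * w)%quat.
Proof.
intros Hk E3 E4; apply imag_unit_iff; destruct w as [[[w0 w1] w2] w3].
unfold qdot in E4; qunfold in E3; qunfold in E4; subst w0; qunfold; split; [ring|].
transitivity (/ k * / k * (0 * 0 + w1 * w1 + w2 * w2 + w3 * w3)); [ring|].
rewrite E4; field; lra.
Qed.

(** A vanishing norm means |b| = |c| with b orthogonal to c. If c <> 0, then - b c^(-1) is an
    imaginary unit I with b + I c = 0; if c = 0, then b = 0 as well. *)
Lemma stem_norm_nz b c : (forall I, imag_unit I -> (b + I * c)%quat <> qreal 0) -> stem_norm b c <> 0.
Proof.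
intros H HN; unfold stem_norm in HN; injection HN; intros E2 E1.
assert (dec : c = qreal 0 \/ c <> qreal 0).
{ destruct (Req_dec (qnorm c) 0) as [h|h]; [left; apply qnorm_0; auto|right].
  intros k; apply h; rewrite k, qnorm_real; apply Rabs_R0. }
destruct dec as [h|h].
- subst c.
  assert (b = qreal 0).
  { apply qnorm_0; assert (qnorm b ^ 2 = 0) by (rewrite qnorm_sqr; revert E1; unfold qdot; qunfold; lra).
    pose proof (qnorm_ge0 b); nra. }
  subst b; apply (H (mkq 0 1 0 0)); [apply imag_unit_iff; qunfold; split; ring|qring].
- pose proof (qdot_self_pos c h) as Hc.
  set (I := (qreal (- / qdot c c) * (b * qconj c))%quat).
  apply (H I).
  + assert (E3 : q_re (b * qconj c)%quat = 0) by (revert E2; clear; unfold qdot; qdestruct; qunfold; lra).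
    assert (E4 : qdot (b * qconj c) (b * qconj c) = qdot c c * qdot c c).
    { transitivity (qdot b b * qdot c c); [clear; unfold qdot; qdestruct; qunfold; ring|].
      replace (qdot b b) with (qdot c c) by lra; reflexivity. }
    apply imag_unit_scaled; auto.
  + unfold I; rewrite <- qmul_assoc, <- (qmul_assoc b), qconj_mul_self, qnorm_sqr.
    set (k := qdot c c) in *; clearbody k; clear - Hc; destruct b as [[[b0 b1] b2] b3].
    apply quat_ext; qunfold; field; lra.
Qed.

(** The units [I] and [I'] related by [stem_conj b c I * I' = I * stem_conj b c I]
    are those for which the regular quotient at [qslice I z] is the pointwise
    quotient at [qslice I' z]. *)
Lemma stem_twist_exists b c I : imag_unit I -> stem_norm b c <> 0 ->
  exists I', imag_unit I' /\ (stem_conj b c I * I' = I * stem_conj b c I)%quat.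
Proof.
intros HI HN; assert (H0 := stem_conj_nz b c I HI HN).
set (p := stem_conj b c I) in *.
exists (qinv p * I * p)%quat; split.
- unfold imag_unit in *.
  transitivity (qinv p * (I * ((p * qinv p) * (I * p))))%quat; [rewrite <- !qmul_assoc; reflexivity|].
  rewrite qinv_r, qmul_1l, (qmul_assoc I I), HI, qmul_assoc, <- qreal_comm, <- qmul_assoc, qinv_l by auto.
  clear; qring.
- rewrite !qmul_assoc, qinv_r, qmul_1l by auto; reflexivity.
Qed.

(** With p = b + I' c the unit is p^(-1) I' p. The relation to be solved reads conj b I' + conj c =
    I (conj b - conj c I'), that is conj p I' = I conj p, and conj p is a real multiple of
    p^(-1). *)
Lemma stem_twist_inverse b c I' : imag_unit I' -> (b + I' * c)%quat <> qreal 0 ->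
  exists I, imag_unit I /\ (stem_conj b c I * I' = I * stem_conj b c I)%quat.
Proof.
intros HI H0; set (p := (b + I' * c)%quat) in *.
exists (qinv p * I' * p)%quat.
set (I := (qinv p * I' * p)%quat).
assert (HII : imag_unit I).
{ unfold I, imag_unit in *.
  transitivity (qinv p * (I' * ((p * qinv p) * (I' * p))))%quat; [rewrite <- !qmul_assoc; reflexivity|].
  rewrite qinv_r, qmul_1l, (qmul_assoc I' I'), HI, qmul_assoc, <- qreal_comm, <- qmul_assoc, qinv_l by auto.
  clear; qring. }
split; auto.
assert (E : (I * qconj p = qconj p * I')%quat).
{ unfold I, qinv; rewrite <- !qmul_assoc, qmul_conj_self, (qmul_assoc (qconj p)).
  apply qnorm_pos in H0; generalize (qconj p * I')%quat; intros [[[u0 u1] u2] u3].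
  apply quat_ext; qunfold; field; lra. }
assert (Ep : qconj p = (qconj b - qconj c * I')%quat).
{ unfold p; apply imag_unit_iff in HI; destruct HI as [h _]; revert h; clear; intros h.
  qdestruct; qunfold in h; subst; qring. }
assert (E2 : (qconj p * I' = qconj b * I' + qconj c)%quat).
{ rewrite Ep; unfold imag_unit in HI; rewrite qmul_addl.
  transitivity (qconj b * I' - qconj c * (I' * I'))%quat.
  - rewrite (qmul_assoc (qconj c)); generalize (qconj b * I')%quat (qconj c * I')%quat; clear; qring.
  - rewrite HI; generalize (qconj b * I')%quat; clear; qring. }
unfold stem_conj; apply qsub_eq0.
transitivity ((qconj b * I' + qconj c) - I * (qconj b - qconj c * I'))%quat.
- unfold imag_unit in HII; rewrite !qmul_addl, !qmul_addr, (qmul_assoc I I), HII.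
  replace (I * - (qconj c * I'))%quat with (- (I * qconj c * I'))%quat.
  2: generalize (qconj c) as cc; clear; qring.
  generalize (qconj b * I')%quat (I * qconj c * I')%quat (I * qconj b)%quat; clear; qring.
- rewrite <- E2, <- Ep, E; generalize (qconj p * I')%quat; clear; qring.
Qed.

(** The real and the [I]-part of a quaternion, such that [Re ((x + y I) K)] is the
    real part of the complex number [(x + i y) * lam I K]. *)
Definition lam (I K : quat) : C := (q_re K, - q_re (I * K)%quat).

Lemma q_re_slice_mul I z K : q_re (qslice I z * K)%quat = Re (z * lam I K)%C.
Proof. unfold lam, qslice, slice_pt, Re, Im; simpl fst; simpl snd; qunfold; ring. Qed.

(** The value at [qslice I z] of the regular product of phi^c with a function whose stem is be + i
    ga at z. *)
Definition stem_prod (b c be ga I : quat) : quat :=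
  ((qconj b * be - qconj c * ga) + I * (qconj c * be + qconj b * ga))%quat.

Lemma stem_prod_conj b c be ga I : imag_unit I ->
  (stem_conj b c I * be + I * (stem_conj b c I * ga))%quat = stem_prod b c be ga I.
Proof.
intros HI; unfold stem_conj, stem_prod.
transitivity ((qconj b * be + (I * I) * (qconj c * ga)) + I * (qconj c * be + qconj b * ga))%quat.
- rewrite !qmul_addl, !qmul_addr, <- !qmul_assoc.
  generalize (qconj b * be)%quat (I * (qconj c * be))%quat (I * (qconj b * ga))%quat (I * (I * (qconj c * ga)))%quat.
  clear; qring.
- unfold imag_unit in HI; rewrite HI.
  generalize (qconj b * be)%quat (qconj c * ga)%quat (I * (qconj c * be + qconj b * ga))%quat.
  clear; qring.
Qed.

(** Multiplying by p = [stem_conj b c I] on the left scales numerator and denominator by |p|^2. By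
    the twist relation p turns [qslice I' z] into [qslice I z] on passing it, and p (b + I' c)
    becomes the norm N in the slice of I, where the quotient is a complex one. *)
Lemma stem_quotient b c be ga I I' z : imag_unit I -> imag_unit I' -> stem_norm b c <> 0 ->
  (stem_conj b c I * I' = I * stem_conj b c I)%quat ->
  qdot (b + I' * c) (qslice I' z * (be + I' * ga)) / qnorm (b + I' * c)%quat ^ 2 =
  Re (z * (lam I (stem_prod b c be ga I) * / stem_norm b c))%C.
Proof.
intros HI HI' HN Htw.
assert (H0 := stem_conj_nz b c I HI HN).
assert (E1 := stem_conj_norm b c I HI).
assert (E2 := stem_prod_conj b c be ga I HI).
set (p := stem_conj b c I) in *; set (N := stem_norm b c) in *; set (K := stem_prod b c be ga I) in *.
assert (F1 : (p * (b + I' * c) = qslice I N)%quat).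
{ rewrite <- E1, qmul_addr, (qmul_assoc p I'), Htw, <- qmul_assoc; reflexivity. }
assert (F2 : (p * (be + I' * ga) = K)%quat).
{ rewrite <- E2, qmul_addr, (qmul_assoc p I'), Htw, <- qmul_assoc; reflexivity. }
assert (F3 : (p * qslice I' z = qslice I z * p)%quat).
{ unfold qslice, slice_pt; rewrite qmul_addr, qmul_addl, !(qmul_assoc p), <- !(qreal_comm _ p), <- !qmul_assoc, Htw; reflexivity. }
assert (F4 : (p * (qslice I' z * (be + I' * ga)) = qslice I z * K)%quat).
{ rewrite qmul_assoc, F3, <- qmul_assoc, F2; reflexivity. }
rewrite qnorm_sqr.
assert (Hp := qdot_self_pos p H0).
transitivity (qdot (p * (b + I' * c)) (p * (qslice I' z * (be + I' * ga))) / qdot (p * (b + I' * c)) (p * (b + I' * c))).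
{ assert (Hnz : qdot (b + I' * c) (b + I' * c) <> 0).
  { intros e; apply HN, Cmod_eq_0; rewrite <- (qnorm_qslice I) by auto.
    rewrite <- F1, qnorm_mul.
    replace (qnorm (b + I' * c)%quat) with 0; [ring|].
    symmetry; apply Rsqr_0_uniq; rewrite Rsqr_pow2, qnorm_sqr; auto. }
  rewrite !qdot_mul_l; field; split; [exact Hnz|lra]. }
rewrite F1, F4.
assert (G1 : qdot (qslice I N) (qslice I N) = Cmod N ^ 2) by (rewrite <- qnorm_sqr, qnorm_qslice; auto).
assert (G2 : qdot (qslice I N) (qslice I z * K) = Re (Cconj N * z * lam I K)%C).
{ rewrite <- q_re_slice_mul, <- qslice_mul, <- qmul_assoc by auto.
  replace (qslice I (Cconj N)) with (qconj (qslice I N)).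
  - generalize (qslice I z * K)%quat (qslice I N); clear; intros; unfold qdot; qunfold; ring.
  - apply imag_unit_iff in HI; destruct HI as [h _]; revert h; clear; intros h.
    unfold qslice, slice_pt; destruct N; unfold Re, Im; simpl fst; simpl snd.
    qdestruct; qunfold in h; subst; qring. }
rewrite G1, G2.
assert (HM : Cmod N ^ 2 <> 0) by (apply pow_nonzero; intros e; apply Cmod_eq_0 in e; auto).
unfold Rdiv; rewrite <- Re_mult_RtoC; apply f_equal.
rewrite RtoC_inv, Cmod2_conj; auto.
field; split; auto.
intros e; apply HN; rewrite <- (Cconj_conj N), e; apply injective_projections; simpl; ring.
Qed.

Lemma lam_add_mul I X Y : imag_unit I ->
  lam I (X + I * Y)%quat = (q_re X + q_re (I * Y)%quat, q_re Y - q_re (I * X)%quat).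
Proof.
intros HI; unfold imag_unit in HI; unfold lam.
rewrite qmul_addr, (qmul_assoc I I), HI.
apply injective_projections; simpl fst; simpl snd; generalize (I * X)%quat (I * Y)%quat; clear; intros; qunfold; ring.
Qed.

(** * Holomorphy of the regular logarithmic derivative *)

Section StemHolomorphic.

Variables (b : nat -> quat) (I : quat).
Hypotheses (Hb : qconv b) (HI : imag_unit I).

Let B0 := cps (fun n => q_re (b n)).
Let B1 := cps (fun n => q_i (b n)).
Let B2 := cps (fun n => q_j (b n)).
Let B3 := cps (fun n => q_k (b n)).
Let D0 := cps (PS_derive (fun n => q_re (b n))).
Let D1 := cps (PS_derive (fun n => q_i (b n))).
Let D2 := cps (PS_derive (fun n => q_j (b n))).
Let D3 := cps (PS_derive (fun n => q_k (b n))).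

Lemma stem_norm_cps z : stem_norm (stem_re b z) (stem_im b z) =
  (B0 z * B0 z + B1 z * B1 z + B2 z * B2 z + B3 z * B3 z)%C.
Proof.
unfold stem_norm, stem_re, stem_im; fold B0 B1 B2 B3.
generalize (B0 z) (B1 z) (B2 z) (B3 z); intros [? ?] [? ?] [? ?] [? ?]; unfold qdot; qunfold.
apply injective_projections; simpl; ring.
Qed.

(** With the unit fixed, no complex conjugates remain: the expression is a polynomial in eight
    holomorphic functions. *)
Lemma lam_stem_prod_cps z :
  lam I (stem_prod (stem_re b z) (stem_im b z) (stem_re (qderiv b) z) (stem_im (qderiv b) z) I) =
  (B0 z * D0 z + B1 z * D1 z + B2 z * D2 z + B3 z * D3 z +
   (Ci * q_i I) * (B0 z * D1 z + (-1) * (B1 z * D0 z) + (-1) * (B2 z * D3 z) + B3 z * D2 z) +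
   (Ci * q_j I) * (B0 z * D2 z + B1 z * D3 z + (-1) * (B2 z * D0 z) + (-1) * (B3 z * D1 z)) +
   (Ci * q_k I) * (B0 z * D3 z + (-1) * (B1 z * D2 z) + B2 z * D1 z + (-1) * (B3 z * D0 z)))%C.
Proof.
destruct (stem_qderiv b z) as [E1 E2]; rewrite E1, E2; clear E1 E2.
unfold stem_re, stem_im; fold B0 B1 B2 B3 D0 D1 D2 D3.
generalize (B0 z) (B1 z) (B2 z) (B3 z) (D0 z) (D1 z) (D2 z) (D3 z); intros.
intros; unfold stem_prod; rewrite lam_add_mul by auto.
apply imag_unit_iff in HI; destruct HI as [h0 _].
destruct I as [[[i0 i1] i2] i3]; qunfold in h0; subst i0.
repeat match goal with w : C |- _ => destruct w end.
qunfold; apply injective_projections; simpl; ring.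
Qed.

(** The component in the slice of I of the regular quotient of phi' by phi; the division is complex
    because the symmetrization lies in that slice. *)
Definition stem_log_deriv (z : C) : C :=
  (lam I (stem_prod (stem_re b z) (stem_im b z) (stem_re (qderiv b) z) (stem_im (qderiv b) z) I)
   * / stem_norm (stem_re b z) (stem_im b z))%C.

Lemma holo_stem_log_deriv :
  (forall z, Cmod z < 1 -> stem_norm (stem_re b z) (stem_im b z) <> 0) ->
  exists P', holo 1 (fun z => 1 + z * stem_log_deriv z)%C P'.
Proof.
intros HN; destruct Hb as (H0 & H1 & H2 & H3).
assert (hb0 := holo_cps _ H0); assert (hb1 := holo_cps _ H1).
assert (hb2 := holo_cps _ H2); assert (hb3 := holo_cps _ H3).
assert (hd0 := holo_cps _ (disc_conv_derive _ H0)); assert (hd1 := holo_cps _ (disc_conv_derive _ H1)).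
assert (hd2 := holo_cps _ (disc_conv_derive _ H2)); assert (hd3 := holo_cps _ (disc_conv_derive _ H3)).
fold B0 in hb0; fold B1 in hb1; fold B2 in hb2; fold B3 in hb3.
fold D0 in hb0, hd0; fold D1 in hb1, hd1; fold D2 in hb2, hd2; fold D3 in hb3, hd3.
eexists; apply (holo_ext 1 (fun z => 1 + z * (
  (B0 z * D0 z + B1 z * D1 z + B2 z * D2 z + B3 z * D3 z +
   (Ci * q_i I) * (B0 z * D1 z + (-1) * (B1 z * D0 z) + (-1) * (B2 z * D3 z) + B3 z * D2 z) +
   (Ci * q_j I) * (B0 z * D2 z + B1 z * D3 z + (-1) * (B2 z * D0 z) + (-1) * (B3 z * D1 z)) +
   (Ci * q_k I) * (B0 z * D3 z + (-1) * (B1 z * D2 z) + B2 z * D1 z + (-1) * (B3 z * D0 z)))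
   * / (B0 z * B0 z + B1 z * B1 z + B2 z * B2 z + B3 z * B3 z)))%C).
{ intros z _; unfold stem_log_deriv; rewrite lam_stem_prod_cps, stem_norm_cps; reflexivity. }
repeat first [ eassumption | apply holo_const | apply holo_id | apply holo_plus | apply holo_mult | apply holo_inv ].
intros z Hz; rewrite <- stem_norm_cps; auto.
Qed.

End StemHolomorphic.

(** * Growth *)

Lemma qsum_0 a I : qconv a -> qsum a I 0 = a O.
Proof.
intros (H0 & H1 & H2 & H3).
unfold qsum, stem_re, stem_im; rewrite !cps_0 by auto.
unfold Re, Im; simpl; generalize (a O); clear; qring.
Qed.

Lemma has_expansion_0 f a : has_expansion f a -> f (qreal 0) = a O.
Proof.
intros H.
assert (HI : imag_unit (mkq 0 1 0 0)) by (apply imag_unit_iff; qunfold; split; ring).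
rewrite <- (qsum_0 a (mkq 0 1 0 0)) by (eapply has_expansion_qconv; eauto).
rewrite <- (has_expansion_qsum f a), qslice_real; auto; rewrite Cmod_0; lra.
Qed.

Section Growth.

Variable b : nat -> quat.
Hypothesis Hb : qconv b.

(** Re (phi^(-1) q phi') at q = [qslice I z]; for g = q phi and q <> 0 one has Re (g^(-1) q g') = 1
    + [log_deriv I z]. *)
Definition log_deriv (I : quat) (z : C) : R :=
  qdot (qsum b I z) (qslice I z * qsum (qderiv b) I z) / qnorm (qsum b I z) ^ 2.

Hypothesis Hnz : forall I z, imag_unit I -> Cmod z < 1 -> qsum b I z <> qreal 0.
Hypothesis Hpos : forall I z, imag_unit I -> Cmod z < 1 -> 0 <= 1 + log_deriv I z.

(** J is chosen so that its twist at z is I, and Harnack's inequality is applied on the fixed slice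
    of J. At any other point w the twist of J is some J' depending on w, and positivity is that of
    the pointwise quotient at J'. *)
Lemma log_deriv_bounds I z : imag_unit I -> Cmod z < 1 ->
  1 - Cmod z <= (1 + Cmod z) * (1 + log_deriv I z) /\
  (1 - Cmod z) * (1 + log_deriv I z) <= 1 + Cmod z.
Proof.
intros HI' Hz.
assert (HN : forall w, Cmod w < 1 -> stem_norm (stem_re b w) (stem_im b w) <> 0).
{ intros w Hw; apply stem_norm_nz; intros J HJ; apply Hnz; auto. }
destruct (stem_twist_inverse (stem_re b z) (stem_im b z) I HI' (Hnz I z HI' Hz)) as (J & HJ & Htw).
destruct (holo_stem_log_deriv b J Hb HJ HN) as [P' HP].
assert (Re1 : forall w, Re (1 + w * stem_log_deriv b J w)%C = 1 + Re (w * stem_log_deriv b J w)%C)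
  by (intros; reflexivity).
destruct (Harnack _ _ z HP) as [h1 h2]; auto.
- intros w Hw; rewrite Re1.
  destruct (stem_twist_exists (stem_re b w) (stem_im b w) J HJ (HN w Hw)) as (J' & HJ' & Htw').
  unfold stem_log_deriv; rewrite <- (stem_quotient _ _ _ _ J J' w HJ HJ' (HN w Hw) Htw').
  apply (Hpos J' w); auto.
- revert h1 h2; rewrite !Re1, Cmult_0_l.
  replace (Re (z * stem_log_deriv b J z)%C) with (log_deriv I z).
  2:{ unfold stem_log_deriv; rewrite <- (stem_quotient _ _ _ _ J I z HJ HI' (HN z Hz) Htw); reflexivity. }
  simpl (Re 0); lra.
Qed.

Lemma is_derive_qdot_self h t d : is_derive4 h t d ->
  is_derive (fun s => qdot (h s) (h s)) t (2 * qdot (h t) d).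
Proof.
intros (H0 & H1 & H2 & H3).
replace (2 * qdot (h t) d) with
 ((q_re d * q_re (h t) + q_re (h t) * q_re d) + (q_i d * q_i (h t) + q_i (h t) * q_i d) +
  (q_j d * q_j (h t) + q_j (h t) * q_j d) + (q_k d * q_k (h t) + q_k (h t) * q_k d)) by (unfold qdot; ring).
unfold qdot; apply (is_derive_plus (V := R_NormedModule));
  [apply (is_derive_plus (V := R_NormedModule)); [apply (is_derive_plus (V := R_NormedModule))|]|];
  apply (is_derive_mult (K := R_AbsRing)); auto; intros; apply Rmult_comm.
Qed.

Hypothesis Hb0 : b O = qreal 1.

Lemma growth I z : imag_unit I -> Cmod z < 1 ->
  1 / (1 + Cmod z) ^ 2 <= qnorm (qsum b I z) <= 1 / (1 - Cmod z) ^ 2.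
Proof.
intros HI Hz.
assert (H0 := Cmod_ge_0 z).
destruct (Req_dec (Cmod z) 0) as [e|e].
{ assert (z = 0) by (apply Cmod_eq_0; auto); subst z.
  rewrite qsum_0, Hb0, qnorm_real, Cmod_0, Rabs_R1 by auto; lra. }
set (r := Cmod z) in *.
assert (Hr : 0 < r) by lra.
set (o := (z / r)%C).
assert (Hrc : RtoC r <> 0) by (intros k; apply RtoC_inj in k; auto).
assert (Ho : Cmod o = 1).
{ unfold o; rewrite Cmod_div, Cmod_R, Rabs_pos_eq by (auto; lra); fold r; field; auto. }
set (g := fun s => qsum b I (s * Re o, s * Im o)).
assert (Es : forall s, ((s * Re o, s * Im o) : C) = (s * o)%C).
{ intros s; apply injective_projections; unfold Re, Im; simpl; ring. }
assert (Hs : forall s, 0 <= s < 1 -> Cmod (s * Re o, s * Im o) = s).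
{ intros s h; rewrite Es, Cmod_mult, Ho, Cmod_R, Rabs_pos_eq; lra. }
set (G := fun s => qdot (g s) (g s)).
set (G' := fun s => 2 * qdot (g s) (qslice I o * qsum (qderiv b) I (s * Re o, s * Im o)%R)%quat).
assert (Hlin : forall k s : R, is_derive (fun s => s * k) s k) by (intros; auto_derive; auto; ring).
assert (HG : forall s, 0 <= s < 1 -> is_derive G s (G' s)).
{ intros s h; unfold G, G'.
  apply (is_derive_qdot_self g).
  replace (qslice I o) with (qslice I (Re o, Im o)) by reflexivity.
  apply (qsum_curve b I (fun s => s * Re o) (fun s => s * Im o)); auto.
  rewrite Hs; lra. }
assert (HGp : forall s, 0 <= s < 1 -> 0 < G s).
{ intros s h; apply qdot_self_pos, Hnz; auto; rewrite Hs; lra. }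
(* [log_deriv] at the point s o contains the radius s, whereas G' contains only the direction o. *)
assert (HA : forall s, 0 <= s < 1 -> s * G' s = 2 * log_deriv I (s * Re o, s * Im o) * G s).
{ intros s h; unfold log_deriv; rewrite qnorm_sqr; fold (g s); fold (G s).
  replace (qslice I (s * Re o, s * Im o)) with (qreal s * qslice I o)%quat.
  2:{ rewrite Es, <- qslice_mul, qslice_real; auto. }
  specialize (HGp s h); unfold G'.
  rewrite <- qmul_assoc.
  generalize (qslice I o * qsum (qderiv b) I (s * Re o, s * Im o)%R)%quat; intros w.
  replace (qdot (g s) (qreal s * w)) with (s * qdot (g s) w) by (unfold qdot; generalize (g s); clear; intros; qunfold; ring).
  field; lra. }
(* The bound (1 - s) / (1 + s) for 1 + A amounts to (1 + s) A >= - 2 s, while s G' = 2 A G; hence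
   the constant 4, the exponent of 1 + s further down. *)
assert (Hlow : forall s, 0 < s < 1 -> 0 <= (1 + s) * G' s + 4 * G s).
{ intros s h; destruct (log_deriv_bounds I (s * Re o, s * Im o) HI) as [k _]; [rewrite Hs; lra|].
  rewrite Hs in k by lra; specialize (HA s ltac:(lra)); specialize (HGp s ltac:(lra)).
  set (A := log_deriv I _) in *.
  apply Rmult_le_reg_l with s; [lra|].
  replace (s * ((1 + s) * G' s + 4 * G s)) with ((1 + s) * (s * G' s) + 4 * s * G s) by ring.
  rewrite HA; nra. }
assert (Hup : forall s, 0 < s < 1 -> (1 - s) * G' s - 4 * G s <= 0).
{ intros s h; destruct (log_deriv_bounds I (s * Re o, s * Im o) HI) as [_ k]; [rewrite Hs; lra|].
  rewrite Hs in k by lra; specialize (HA s ltac:(lra)); specialize (HGp s ltac:(lra)).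
  set (A := log_deriv I _) in *.
  apply Rmult_le_reg_l with s; [lra|].
  replace (s * ((1 - s) * G' s - 4 * G s)) with ((1 - s) * (s * G' s) - 4 * s * G s) by ring.
  rewrite HA; nra. }
assert (G0 : G 0 = 1).
{ unfold G, g; replace ((0 * Re o, 0 * Im o) : C) with (RtoC 0) by (apply injective_projections; simpl; ring).
  rewrite qsum_0, Hb0 by auto; unfold qdot; qunfold; ring. }
assert (Gr : G r = qnorm (qsum b I z) ^ 2).
{ rewrite qnorm_sqr; unfold G, g; rewrite Es.
  replace (r * o)%C with z; auto; unfold o; field; auto. }
assert (MV : forall (u u' : R -> R), (forall s, 0 <= s < 1 -> is_derive u s (u' s)) ->
   exists c, 0 < c < r /\ u r - u 0 = u' c * r).
{ intros u u' Hu.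
  destruct (MVT_cor2 u u' 0 r Hr) as (c & E & Hc).
  - intros c Hc; apply is_derive_Reals, Hu; lra.
  - exists c; split; auto; rewrite E; ring. }
set (m := qnorm (qsum b I z)) in *.
assert (Hm : 0 <= m) by apply qnorm_ge0.
split.
- destruct (MV (fun s => (1 + s) ^ 4 * G s) (fun s => (1 + s) ^ 3 * ((1 + s) * G' s + 4 * G s))) as (c & Hc & E).
  { intros s h.
    replace ((1 + s) ^ 3 * ((1 + s) * G' s + 4 * G s)) with (4 * (1 + s) ^ 3 * G s + (1 + s) ^ 4 * G' s) by ring.
    apply (is_derive_mult (K := R_AbsRing) (fun s => (1 + s) ^ 4) G); [|apply HG; auto|intros; apply Rmult_comm].
    auto_derive; auto; ring. }
  rewrite G0, Gr in E.
  assert (0 <= (1 + c) ^ 3 * ((1 + c) * G' c + 4 * G c)).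
  { apply Rmult_le_pos; [apply pow_le; lra|apply Hlow; lra]. }
  assert (E2 : 1 <= ((1 + r) ^ 2 * m) ^ 2) by nra.
  assert (E3 : 1 <= (1 + r) ^ 2 * m).
  { assert (0 <= (1 + r) ^ 2 * m) by (apply Rmult_le_pos; [apply pow_le; lra|auto]). nra. }
  apply Rmult_le_reg_l with ((1 + r) ^ 2); [apply pow_lt; lra|].
  replace ((1 + r) ^ 2 * (1 / (1 + r) ^ 2)) with 1 by (field; lra); auto.
- destruct (MV (fun s => (1 - s) ^ 4 * G s) (fun s => (1 - s) ^ 3 * ((1 - s) * G' s - 4 * G s))) as (c & Hc & E).
  { intros s h.
    replace ((1 - s) ^ 3 * ((1 - s) * G' s - 4 * G s)) with (- 4 * (1 - s) ^ 3 * G s + (1 - s) ^ 4 * G' s) by ring.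
    apply (is_derive_mult (K := R_AbsRing) (fun s => (1 - s) ^ 4) G); [|apply HG; auto|intros; apply Rmult_comm].
    auto_derive; auto; ring. }
  rewrite G0, Gr in E.
  assert (0 <= (1 - c) ^ 3 * (4 * G c - (1 - c) * G' c)).
  { apply Rmult_le_pos; [apply pow_le; lra|]; specialize (Hup c ltac:(lra)); lra. }
  assert (E2 : ((1 - r) ^ 2 * m) ^ 2 <= 1) by nra.
  assert (E3 : (1 - r) ^ 2 * m <= 1).
  { assert (0 <= (1 - r) ^ 2 * m) by (apply Rmult_le_pos; [apply pow_le; lra|auto]). nra. }
  apply Rmult_le_reg_l with ((1 - r) ^ 2); [apply pow_lt; lra|].
  replace ((1 - r) ^ 2 * (1 / (1 - r) ^ 2)) with 1 by (field; lra); auto.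
Qed.

End Growth.

(** With phi = f' and g = q phi, a zero of phi would be a zero of g and thus lie at 0, where phi
    takes the value g'(0) = 1; so phi has no zeros. *)
Lemma starlike_growth (f : quat -> quat) : slice_regular f ->
  slice_starlike (fun q => (q * slice_derivative f q)%quat) ->
  forall q, in_ball q ->
    1 / (1 + qnorm q) ^ 2 <= qnorm (slice_derivative f q) <= 1 / (1 - qnorm q) ^ 2.
Proof.
intros Hf [[_ [Hz H1]] Hst].
destruct (slice_regular_expansion f Hf) as [a Ha].
assert (Hphi := has_expansion_slice_derivative f a Ha).
set (phi := slice_derivative f) in *; set (b := qderiv a) in *.
assert (Hb := has_expansion_qconv _ _ Hphi).
assert (Hg := has_expansion_shift phi b Hphi).
set (g := fun q => (q * phi q)%quat) in *.
assert (Hg' := has_expansion_slice_derivative g _ Hg).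
assert (Hphi' := has_expansion_slice_derivative phi b Hphi).
assert (Eg : forall q, in_ball q -> slice_derivative g q = (phi q + q * slice_derivative phi q)%quat).
{ apply (has_expansion_fun_unique _ _ _ Hg').
  apply (has_expansion_ext _ (fun n => b n + qshift (qderiv b) n)%quat).
  (* On coefficients, g' = phi + q phi' reads (n + 1) b n = b n + n b n. *)
  - intros [|n]; unfold qderiv, qshift; [|rewrite (S_INR (S n))]; simpl INR; generalize (b 0%nat); [|generalize (b (S n))];
      clear; intros; apply quat_ext; qunfold; ring.
  - apply has_expansion_add; auto; apply has_expansion_shift; auto. }
assert (B0 : in_ball (qreal 0)) by (unfold in_ball; rewrite qnorm_real, Rabs_R0; lra).
assert (P0 : phi (qreal 0) = qreal 1).
{ rewrite <- H1, Eg; auto; generalize (phi (qreal 0)) (slice_derivative phi (qreal 0)); clear; qring. }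
assert (HI0 : imag_unit (mkq 0 1 0 0)) by (apply imag_unit_iff; qunfold; split; ring).
assert (Hb0 : b 0%nat = qreal 1).
{ rewrite <- P0; symmetry; apply has_expansion_0; auto. }
assert (Hnz : forall I z, imag_unit I -> Cmod z < 1 -> qsum b I z <> qreal 0).
{ intros I z HI Hzz; rewrite <- (has_expansion_qsum phi b) by auto; intros e.
  assert (Hq : in_ball (qslice I z)) by (apply in_ball_qslice; auto).
  assert (E : qslice I z = qreal 0).
  { apply Hz; auto; rewrite e; apply qmul_0r. }
  rewrite E, P0 in e; apply (f_equal q_re) in e; unfold qreal in e; qunfold in e; lra. }
assert (Hpos : forall I z, imag_unit I -> Cmod z < 1 -> 0 <= 1 + log_deriv b I z).
{ intros I z HI Hzz.
  assert (Hq : in_ball (qslice I z)) by (apply in_ball_qslice; auto).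
  assert (Hn := Hnz I z HI Hzz).
  unfold log_deriv.
  rewrite <- (has_expansion_qsum phi b) in * by auto.
  rewrite <- (has_expansion_qsum _ _ _ _ Hphi') by auto.
  set (q := qslice I z) in *.
  destruct (Req_dec (qnorm q) 0) as [h|h].
  (* Starlikeness speaks of q <> 0; at q = 0 the factor q makes the logarithmic derivative
     vanish. *)
  - apply qnorm_0 in h; rewrite h.
    replace (qdot (phi (qreal 0)) (qreal 0 * slice_derivative phi (qreal 0))) with 0; [lra|].
    generalize (phi (qreal 0)) (slice_derivative phi (qreal 0)); clear; intros; unfold qdot; qunfold; ring.
  - assert (Hq0 : q <> qreal 0) by (intros k; apply h; rewrite k, qnorm_real; apply Rabs_R0).
    specialize (Hst q Hq Hq0); rewrite Eg in Hst by auto.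
    (* Both g = q phi and q g' have the left factor q, so |q|^2 cancels from the quotient. *)
    unfold g in Hst; rewrite <- qmul_assoc, q_re_qinv_mul, qnorm_sqr, !qdot_mul_l in Hst.
    rewrite qnorm_sqr.
    assert (k1 := qdot_self_pos q Hq0); assert (k2 := qdot_self_pos _ Hn).
    set (X := slice_derivative phi q) in *.
    replace (qdot (phi q) (phi q + q * X)) with (qdot (phi q) (phi q) + qdot (phi q) (q * X)) in Hst
      by (generalize (phi q) (q * X)%quat; clear; intros; unfold qdot; qunfold; ring).
    left; eapply Rlt_le_trans; [exact Hst|right].
    field; split; lra. }
intros q Hq; destruct (qslice_cover q Hq) as (I & z & HI & Hzz & E).
rewrite E, (has_expansion_qsum phi b), qnorm_qslice by auto.
apply growth; auto.
Qed.

(** * The extremal functions *)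

Definition qconst (k : quat) (n : nat) : quat := match n with O => k | _ => qreal 0 end.

Lemma is_series_quat_0 : is_series (V := Qmod) (fun _ : nat => qreal 0) (qreal 0).
Proof. apply is_series_quat; split4; apply is_series_0. Qed.

Lemma has_expansion_const k : has_expansion (fun _ => k) (qconst k).
Proof.
intros q _; apply (is_series_decr_1 (K := R_AbsRing) (V := Qmod)).
match goal with |- is_series _ ?x => replace x with (qreal 0) end.
- apply (is_series_ext (V := Qmod) (fun _ => qreal 0)); [|apply is_series_quat_0].
  intros n; symmetry; apply qmul_0r.
- change (qreal 0 = k - qreal 1 * k)%quat; clear; qring.
Qed.

Lemma has_expansion_scal x f a : has_expansion f a ->
  has_expansion (fun q => qreal x * f q)%quat (fun n => qreal x * a n)%quat.
Proof.
intros H q Hq; generalize (is_series_qmul_l (qreal x) _ _ (H q Hq)).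
apply (is_series_ext (V := Qmod)); intros n.
rewrite !qmul_assoc, (qreal_comm x (qpow q n)); reflexivity.
Qed.

Lemma qseries_eq g s c : has_expansion g c -> (forall n, c n = s n) ->
  has_expansion (qseries s) c /\ forall q, in_ball q -> qseries s q = g q.
Proof.
intros H E.
assert (Hs := has_expansion_ext g c s E H).
assert (K := has_expansion_qseries s (has_expansion_qconv g s Hs)).
split.
- apply has_expansion_ext with s; auto.
- apply has_expansion_fun_unique with s; auto.
Qed.

Lemma qnorm_comp_le q : Rabs (q_re q) <= qnorm q /\ Rabs (q_i q) <= qnorm q /\
  Rabs (q_j q) <= qnorm q /\ Rabs (q_k q) <= qnorm q.
Proof.
unfold qnorm; split4; rewrite <- sqrt_Rsqr_abs; apply sqrt_le_1_alt; unfold Rsqr; nra.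
Qed.

Lemma disc_conv_dominated (al : nat -> R) : disc_conv al -> forall be, (forall n, Rabs (be n) <= Rabs (al n)) -> disc_conv be.
Proof.
intros Hal be H; apply disc_conv_intro; intros x Hx.
apply (ex_series_le (V := R_CompleteNormedModule) _ (fun n => Rabs (al n) * Rabs x ^ n)).
- intros n; change norm with Rabs; rewrite Rabs_mult, <- RPow_abs; apply Rmult_le_compat_r; auto.
  apply pow_le, Rabs_pos.
- apply disc_conv_abs; auto; split; auto; apply Rabs_pos.
Qed.

Lemma disc_conv_1 : disc_conv (fun _ => 1).
Proof.
apply disc_conv_intro; intros x Hx; exists (/ (1 - x)).
apply (is_series_ext (fun n => x ^ n)); [intros; carriers; ring|apply is_series_geom; auto].
Qed.

Lemma qconv_dominated (al : nat -> R) a : disc_conv al -> (forall n, qnorm (a n) <= Rabs (al n)) -> qconv a.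
Proof.
intros Hal H; split4; apply disc_conv_dominated with (1 := Hal); intros n; apply Rle_trans with (2 := H n); apply qnorm_comp_le.
Qed.

Lemma qnorm_qpow q n : qnorm (qpow q n) = qnorm q ^ n.
Proof.
induction n as [|n IH]; simpl; [rewrite qnorm_real; apply Rabs_R1|rewrite qnorm_mul, IH; reflexivity].
Qed.

Section Extremal.

Variable u : quat.
Hypothesis Hu : qnorm u = 1.

(** The regular reciprocal of 1 - q u, written as a geometric series. *)
Let geom : quat -> quat := qseries (qpow u).

Let geom_exp : has_expansion geom (qpow u).
Proof.
apply has_expansion_qseries, (qconv_dominated (fun _ => 1)); [apply disc_conv_1|].
intros n; rewrite qnorm_qpow, Hu, pow1, Rabs_R1; lra.
Qed.

Let lin (k : quat) (n : nat) : quat := (qconst (qreal 1) n + qshift (qconst k) n)%quat.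

Let lin_exp k : has_expansion (fun q => qreal 1 + q * k)%quat (lin k).
Proof.
apply has_expansion_add; [apply has_expansion_const|apply has_expansion_shift, has_expansion_const].
Qed.

Let f0 : quat -> quat := (fun p => qreal 1 - p * u)%quat.

Let f0_coef n : coef f0 n = lin (- u)%quat n.
Proof.
apply coef_eq; apply has_expansion_ext_fun with (2 := lin_exp (- u)%quat).
intros q _; unfold f0; generalize u; clear; qring.
Qed.

Let conj_exp : has_expansion (regular_conj f0) (lin (- qconj u)%quat) /\
  forall q, in_ball q -> regular_conj f0 q = (qreal 1 + q * - qconj u)%quat.
Proof.
apply (qseries_eq _ (fun n => qconj (coef f0 n)) _ (lin_exp (- qconj u)%quat)).
intros n; rewrite f0_coef; unfold lin; destruct n as [|[|n]]; simpl; generalize u; clear; qring.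
Qed.

(** Coefficients of 1 - 2 q Re u + q^2, the regular product of 1 - q u and 1 - q conj u; the last
    one is |u|^2 = 1. *)
Let sym_coef (n : nat) : quat :=
  (qconst (qreal 1) n + qshift (fun n => qconst (qreal (- (2 * q_re u))) n + qshift (qconst (qreal 1)) n) n)%quat.

Let sym_sum n : sym_coef n =
  sum_n (G := Qmod) (fun k => coef f0 k * coef (regular_conj f0) (n - k))%quat n.
Proof.
assert (Ec := coef_eq _ _ (proj1 conj_exp)).
assert (E1 : qdot u u = 1) by (rewrite <- qnorm_sqr, Hu; ring).
rewrite (sum_n_ext (G := Qmod) _ (fun k => lin (- u)%quat k * lin (- qconj u)%quat (n - k))%quat)
  by (intros; rewrite f0_coef, Ec; reflexivity).
unfold sym_coef, lin.
destruct n as [|[|[|n]]].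
- rewrite sum_O; simpl; generalize u; clear; qring.
- rewrite sum_Sn, sum_O; simpl; change (plus (G := Qmod)) with qadd; generalize u; clear; qring.
- rewrite !sum_Sn, sum_O; simpl; change (plus (G := Qmod)) with qadd.
  revert E1; generalize u; clear; intros v; unfold qdot; intros E1; qdestruct; qunfold in E1; apply quat_ext; qunfold; lra.
(* For n >= 3 one of the indices k and n - k is at least 2, where a linear factor has coefficient
   0. *)
- rewrite (sum_n_ext_loc (G := Qmod) _ (fun _ => zero)).
  + unfold sum_n; rewrite sum_n_m_const_zero; simpl; change (zero : Qmod) with (qreal 0); generalize u; clear; qring.
  + intros k Hk; change (zero : Qmod) with (qreal 0).
    destruct k as [|[|k]].
    * simpl; generalize u; clear; qring.
    * replace (S (S (S n)) - 1)%nat with (S (S n)) by lia; simpl; generalize u; clear; qring.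
    * simpl (qconst (qreal 1) (S (S k))); simpl (qshift (qconst (- u)%quat) (S (S k))).
      generalize (qconst (qreal 1) (S (S (S n)) - S (S k)) + qshift (qconst (- qconj u)%quat) (S (S (S n)) - S (S k)))%quat.
      generalize u; clear; qring.
Qed.

Let sym_eq q : in_ball q ->
  symmetrization f0 q = (qreal 1 + q * (qreal (- (2 * q_re u)) + q * qreal 1))%quat.
Proof.
assert (Hexp : has_expansion (fun q => qreal 1 + q * (qreal (- (2 * q_re u)) + q * qreal 1))%quat sym_coef).
{ apply has_expansion_add; [apply has_expansion_const|].
  apply (has_expansion_shift (fun q => qreal (- (2 * q_re u)) + q * qreal 1)%quat).
  apply (has_expansion_add (fun _ => qreal (- (2 * q_re u))) (fun q => q * qreal 1)%quat).
  - apply has_expansion_const.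
  - apply (has_expansion_shift (fun _ => qreal 1)), has_expansion_const. }
revert q; apply (proj2 (qseries_eq _
  (fun n => sum_n (G := Qmod) (fun k => coef f0 k * coef (regular_conj f0) (n - k))%quat n) _ Hexp sym_sum)).
Qed.

(** The symmetrization has real coefficients, so its pointwise product with a series is the regular
    one; beyond degree 1 the claim is u^2 - 2 (Re u) u + 1 = 0. *)
Let sym_geom q : in_ball q -> (symmetrization f0 q * geom q)%quat = (qreal 1 + q * - qconj u)%quat.
Proof.
intros Hq; rewrite sym_eq by auto.
transitivity (geom q + q * (qreal (- (2 * q_re u)) * geom q + q * geom q))%quat.
- rewrite qmul_addl, qmul_1l, <- qmul_assoc, qmul_addl, qmul_1r; reflexivity.
- revert q Hq; apply (has_expansion_fun_unique _ _ (lin (- qconj u)%quat)); [|apply lin_exp].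
  apply (has_expansion_ext _ (fun n => qpow u n +
    qshift (fun n => qreal (- (2 * q_re u)) * qpow u n + qshift (qpow u) n) n)%quat).
  + assert (E1 : qdot u u = 1) by (rewrite <- qnorm_sqr, Hu; ring).
    intros [|[|n]]; unfold lin; simpl.
    * generalize u; clear; qring.
    * generalize u; clear; qring.
    * transitivity ((u * u + qreal (- (2 * q_re u)) * u + qreal 1) * qpow u n)%quat.
      -- rewrite !qmul_addl, <- !qmul_assoc, qmul_1l.
         generalize (u * (u * qpow u n))%quat (qreal (- (2 * q_re u)) * (u * qpow u n))%quat (qpow u n); generalize u; clear; qring.
      -- replace (u * u + qreal (- (2 * q_re u)) * u + qreal 1)%quat with (qreal 0).
           generalize (qpow u n); generalize u; clear; qring.
         revert E1; generalize u; clear; intros v; unfold qdot; intros E1; qdestruct; qunfold in E1; apply quat_ext; qunfold; lra.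
  + apply has_expansion_add; auto.
    apply (has_expansion_shift (fun q => qreal (- (2 * q_re u)) * geom q + q * geom q)%quat).
    apply has_expansion_add; [apply has_expansion_scal; auto|apply has_expansion_shift; auto].
Qed.

(** By [sym_geom] a zero q of the symmetrization would satisfy q conj u = 1, against |q| < 1 = |u|.
    So [qinv] is a true inverse on the ball, and the regular reciprocal is [geom]. *)
Lemma extremal_expansion : has_expansion (extremal u) (qshift (qpow u)).
Proof.
apply has_expansion_ext_fun with (2 := has_expansion_shift _ _ geom_exp).
intros q Hq; unfold extremal, regular_recip; fold f0.
apply f_equal; rewrite (proj2 conj_exp q Hq), <- (sym_geom q Hq).
rewrite qmul_assoc, qinv_l, qmul_1l; auto.
intros e; assert (E := sym_geom q Hq); rewrite e in E.
assert (E2 : (q * qconj u)%quat = qreal 1).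
{ apply (f_equal (fun w => qreal 1 - w)%quat) in E.
  transitivity (qreal 1 - (qreal 1 + q * - qconj u))%quat; [generalize u; clear; qring|].
  rewrite <- E; generalize (geom q) u; clear; qring. }
apply (f_equal qnorm) in E2; rewrite qnorm_mul, qnorm_real, Rabs_R1 in E2.
replace (qnorm (qconj u)) with (qnorm u) in E2 by (apply qnorm_eq; unfold qdot; qunfold; ring).
rewrite Hu in E2; unfold in_ball in Hq; lra.
Qed.

End Extremal.

(** * Closed forms of the series with coefficients 1, n + 1 and (n + 1)^2 *)

Lemma cps_shift al z : disc_conv al -> Cmod z < 1 ->
  cps (fun n => match n with O => 0 | S m => al m end) z = (z * cps al z)%C /\
  disc_conv (fun n => match n with O => 0 | S m => al m end).
Proof.
intros Ha Hz.
assert (Hd : disc_conv (fun n => match n with O => 0 | S m => al m end)).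
{ apply disc_conv_ext with (PS_incr_1 al); [intros [|n]; reflexivity|].
  unfold disc_conv; rewrite CV_radius_incr_1; auto. }
split; auto.
apply cps_unique; auto; intros e.
apply (is_series_decr_1 (K := R_AbsRing) (V := R_NormedModule)).
match goal with |- is_series _ ?x => replace x with (Re (e * z * cps al z)%C) end.
- generalize (cps_series al z (e * z)%C Ha Hz); apply is_series_ext; intros n.
  rewrite Cpow_S, Cmult_assoc; reflexivity.
- rewrite Cmult_assoc; carriers; unfold plus, opp; simpl; ring.
Qed.

Lemma cps_comb al be k m z : disc_conv al -> disc_conv be -> Cmod z < 1 ->
  disc_conv (fun n => k * al n + m * be n) ->
  cps (fun n => k * al n + m * be n) z = (k * cps al z + m * cps be z)%C.
Proof.
intros Ha Hb Hz Hab; apply cps_unique; auto; intros e.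
replace (Re (e * (k * cps al z + m * cps be z))%C) with
  (k * Re (e * cps al z)%C + m * Re (e * cps be z)%C).
2:{ unfold Re; simpl; ring. }
apply (is_series_ext (fun n => k * (al n * Re (e * z ^ n)%C) + m * (be n * Re (e * z ^ n)%C))).
  intros n; carriers; ring.
apply (is_series_plus (V := R_NormedModule)); apply (is_series_scal (V := R_NormedModule)); apply cps_series; auto.
Qed.

Definition ones (n : nat) : R := 1.
(** For the extremal f, [succs] and [squares] are the real factors of u^n in the coefficients of f'
    and of (q f')'. *)
Definition succs (n : nat) : R := INR (S n).
Definition squares (n : nat) : R := INR (S n) * INR (S n).

Lemma disc_conv_succs : disc_conv succs.
Proof.
apply disc_conv_ext with (PS_derive ones).
- intros n; unfold PS_derive, ones, succs; ring.
- apply disc_conv_derive, disc_conv_1.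
Qed.

Lemma disc_conv_squares : disc_conv squares.
Proof.
apply disc_conv_dominated with (PS_derive (PS_derive ones)).
- do 2 apply disc_conv_derive; apply disc_conv_1.
- intros n; unfold PS_derive, ones, squares.
  rewrite (S_INR (S n)), (S_INR n); pose proof (pos_INR n).
  rewrite !Rabs_pos_eq; nra.
Qed.

Lemma one_minus_nz z : Cmod z < 1 -> (1 - z)%C <> 0.
Proof.
intros Hz e; assert (E : z = 1%C) by (replace z with (1 - (1 - z))%C by ring; rewrite e; ring).
rewrite E, Cmod_1 in Hz; lra.
Qed.

(** Multiplication by 1 - z takes first differences of the coefficients. *)
Lemma cps_difference al be z : disc_conv al -> disc_conv be -> Cmod z < 1 ->
  (forall n, al n - match n with O => 0 | S m => al m end = be n) ->
  ((1 - z) * cps al z)%C = cps be z.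
Proof.
intros Ha Hb Hz E.
destruct (cps_shift al z Ha Hz) as [E1 D].
assert (E2 : forall n, be n = 1 * al n + (-1) * match n with O => 0 | S m => al m end).
{ intros n; rewrite <- E; ring. }
rewrite (cps_ext _ _ z E2), cps_comb, E1; auto.
- ring.
- apply disc_conv_ext with (2 := Hb); auto.
Qed.

Definition delta0 (n : nat) : R := match n with O => 1 | _ => 0 end.

Lemma disc_conv_delta0 : disc_conv delta0.
Proof.
apply disc_conv_dominated with (1 := disc_conv_1); intros [|n]; unfold delta0; [lra|].
rewrite Rabs_R0; apply Rabs_pos.
Qed.

Lemma cps_delta0 z : Cmod z < 1 -> cps delta0 z = 1%C.
Proof.
intros Hz; apply cps_unique; auto; [apply disc_conv_delta0|intros e].
apply (is_series_decr_1 (K := R_AbsRing) (V := R_NormedModule)).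
match goal with |- is_series _ ?x => replace x with 0 end.
- apply (is_series_ext (fun _ => 0)); [|apply is_series_0].
  intros n; unfold delta0; carriers; ring.
- carriers; unfold plus, opp; simpl; ring.
Qed.

Lemma cps_ones z : Cmod z < 1 -> cps ones z = (/ (1 - z))%C.
Proof.
intros Hz; assert (Hn := one_minus_nz z Hz).
assert (E : ((1 - z) * cps ones z)%C = 1%C).
{ transitivity (cps delta0 z); [|apply cps_delta0; auto]; apply cps_difference; auto; [apply disc_conv_1|apply disc_conv_delta0|].
  intros [|n]; unfold ones, delta0; ring. }
transitivity ((1 - z) * cps ones z * / (1 - z))%C; [field; auto|rewrite E; ring].
Qed.

Lemma cps_succs z : Cmod z < 1 -> cps succs z = (/ ((1 - z) * (1 - z)))%C.
Proof.
intros Hz; assert (Hn := one_minus_nz z Hz).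
assert (E : ((1 - z) * cps succs z)%C = (/ (1 - z))%C).
{ transitivity (cps ones z); [|apply cps_ones; auto]; apply cps_difference; auto; [apply disc_conv_succs|apply disc_conv_1|].
  intros [|n]; unfold ones, succs; [simpl; ring|rewrite (S_INR (S n)); ring]. }
transitivity ((1 - z) * cps succs z * / (1 - z))%C; [field; auto|rewrite E; field; auto].
Qed.

(** First differences: (n + 1)^2 - n^2 = 2 (n + 1) - 1. The closed form is arranged as a multiple of
    [cps succs z] to exhibit the factor (1 + z) / (1 - z), whose real part is positive. *)
Lemma cps_squares z : Cmod z < 1 -> cps squares z = (cps succs z * ((1 + z) / (1 - z)))%C.
Proof.
intros Hz; assert (Hn := one_minus_nz z Hz).
assert (D : disc_conv (fun n => 2 * succs n + (-1) * ones n)).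
{ apply disc_conv_dominated with (1 := disc_conv_squares); intros n; unfold succs, ones, squares.
  rewrite S_INR; pose proof (pos_INR n); rewrite !Rabs_pos_eq; nra. }
assert (E : ((1 - z) * cps squares z)%C = (2 * cps succs z + (-1) * cps ones z)%C).
{ rewrite <- (cps_comb succs ones 2 (-1) z disc_conv_succs disc_conv_1 Hz D).
  apply cps_difference; auto; [apply disc_conv_squares|].
  intros [|n]; unfold ones, succs, squares; [simpl; ring|rewrite (S_INR (S n)); ring]. }
rewrite cps_ones, cps_succs in * by auto.
transitivity ((1 - z) * cps squares z * / (1 - z))%C; [field; auto|].
rewrite E; field; auto.
Qed.

Lemma Re_Koebe z : Cmod z < 1 -> 0 < Re ((1 + z) / (1 - z))%C.
Proof.
intros Hz; assert (Hn := one_minus_nz z Hz).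
assert (Hm : 0 < Cmod (1 - z) ^ 2) by (apply pow_lt, Cmod_gt_0; auto).
assert (Hzz : Cmod z ^ 2 < 1) by (pose proof (Cmod_ge_0 z); nra).
replace (Re ((1 + z) / (1 - z))%C) with ((1 - Cmod z ^ 2) / Cmod (1 - z) ^ 2).
- apply Rdiv_lt_0_compat; lra.
- rewrite !Cmod2_alt in *; destruct z as [x y]; unfold Re, Im in *; simpl in *.
  field; nra.
Qed.

(** For [A = z v] and [B = conj z * v] this is the product of [qslice I z] and
    [qslice J v], so left powers of the former against powers of the latter are
    reduced to two series in the slice of [J]. *)
Definition twoslice (I J : quat) (A B : C) : quat :=
  (qslice J (RtoC (1 / 2) * (A + B))%C + I * qslice J (Ci * RtoC (1 / 2) * (B + (-1) * A))%C)%quat.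

Lemma qslice_scal J x v : qslice J (RtoC x * v)%C = (qreal x * qslice J v)%quat.
Proof. unfold qslice, slice_pt, Re, Im; simpl; generalize (fst v) (snd v); clear; qring. Qed.

Lemma twoslice_mul I J z v : twoslice I J (z * v)%C (Cconj z * v)%C = (qslice I z * qslice J v)%quat.
Proof.
unfold twoslice.
replace (RtoC (1 / 2) * (z * v + Cconj z * v))%C with (RtoC (Re z) * v)%C.
2:{ destruct z, v; apply injective_projections; simpl; field. }
replace (Ci * RtoC (1 / 2) * (Cconj z * v + (-1) * (z * v)))%C with (RtoC (Im z) * v)%C.
2:{ destruct z, v; apply injective_projections; simpl; field. }
rewrite !qslice_scal; generalize (qslice J v); unfold qslice, slice_pt; generalize (Re z) (Im z); clear; qring.
Qed.

Definition cdot (A B : C) : R := Re A * Re B + Im A * Im B.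

(* With [s] the cosine of the angle between [I] and [J], inner products are convex
   combinations of the ones in the slice of [J]. *)
Lemma qdot_twoslice I J A B A' B' : imag_unit I -> imag_unit J ->
  qdot (twoslice I J A B) (twoslice I J A' B') =
  (1 + qdot I J) / 2 * cdot A A' + (1 - qdot I J) / 2 * cdot B B'.
Proof.
intros HI HJ; apply imag_unit_iff in HI; apply imag_unit_iff in HJ.
destruct HI as [i0 i1], HJ as [j0 j1].
unfold twoslice.
set (P := (RtoC (1 / 2) * (A + B))%C); set (Q := (Ci * RtoC (1 / 2) * (B + (-1) * A))%C).
set (P' := (RtoC (1 / 2) * (A' + B'))%C); set (Q' := (Ci * RtoC (1 / 2) * (B' + (-1) * A'))%C).
assert (S : forall X Y, qdot (qslice J X) (qslice J Y) = cdot X Y).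
{ intros X Y; transitivity (Re X * Re Y + Im X * Im Y * (q_i J ^ 2 + q_j J ^ 2 + q_k J ^ 2)).
  - unfold qdot, qslice, slice_pt; qunfold in j0; qunfold; rewrite j0; ring.
  - rewrite j1; unfold cdot; ring. }
assert (T : forall X Y, qdot (qslice J X) (I * qslice J Y) = qdot I J * (Im X * Re Y - Re X * Im Y)).
{ intros X Y; unfold qdot, qslice, slice_pt; qunfold in j0; qunfold in i0; qunfold; rewrite i0, j0; ring. }
assert (D : forall a b c d, qdot (a + b) (c + d) = qdot a c + qdot b d + qdot a d + qdot c b).
{ clear; intros; unfold qdot; qunfold; ring. }
assert (I1 : qdot I I = 1) by (unfold qdot; rewrite <- i1, i0; ring).
rewrite D, qdot_mul_l, I1, !S, !T.
generalize (qdot I J); intros s; unfold P, Q, P', Q', cdot; clear.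
destruct A, B, A', B'; unfold Re, Im; simpl; field.
Qed.

Lemma qdot_units I J : imag_unit I -> imag_unit J -> -1 <= qdot I J <= 1.
Proof.
intros HI HJ; apply imag_unit_iff in HI; apply imag_unit_iff in HJ.
destruct HI as [i0 i1], HJ as [j0 j1]; unfold qdot; rewrite i0, j0.
assert (0 <= (q_i I - q_i J) ^ 2 + (q_j I - q_j J) ^ 2 + (q_k I - q_k J) ^ 2) by (repeat apply Rplus_le_le_0_compat; apply pow2_ge_0).
assert (0 <= (q_i I + q_i J) ^ 2 + (q_j I + q_j J) ^ 2 + (q_k I + q_k J) ^ 2) by (repeat apply Rplus_le_le_0_compat; apply pow2_ge_0).
split; nra.
Qed.

Definition is_cseries (s : nat -> C) (l : C) : Prop :=
  forall e, is_series (fun n => Re (e * s n)%C) (Re (e * l)%C).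

Lemma is_cseries_cps al w : disc_conv al -> Cmod w < 1 -> is_cseries (fun n => RtoC (al n) * w ^ n)%C (cps al w).
Proof.
intros Ha Hw e; generalize (cps_series al w e Ha Hw); apply is_series_ext; intros n.
replace (e * (RtoC (al n) * w ^ n))%C with (e * w ^ n * RtoC (al n))%C by ring.
rewrite Re_mult_RtoC; Cring.
Qed.

Lemma is_cseries_scal c s l : is_cseries s l -> is_cseries (fun n => c * s n)%C (c * l)%C.
Proof.
intros H e; rewrite Cmult_assoc; generalize (H (e * c)%C); apply is_series_ext; intros n.
rewrite Cmult_assoc; reflexivity.
Qed.

Lemma is_cseries_plus s t l m : is_cseries s l -> is_cseries t m -> is_cseries (fun n => s n + t n)%C (l + m)%C.
Proof.
intros H1 H2 e; rewrite Cmult_plus_distr_l, re_plus.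
generalize (is_series_plus (V := R_NormedModule) _ _ _ _ (H1 e) (H2 e)); apply is_series_ext; intros n.
rewrite Cmult_plus_distr_l, re_plus; reflexivity.
Qed.

Lemma is_series_qslice J s l : is_cseries s l ->
  is_series (V := Qmod) (fun n => qslice J (s n)) (qslice J l).
Proof.
intros H.
assert (K : forall x y, is_series (fun n => x * Re (s n) + y * Im (s n)) (x * Re l + y * Im l)).
{ intros x y; generalize (H (x, - y)).
  replace (Re ((x, (- y)%R) * l)%C) with (x * Re l + y * Im l) by (unfold Re, Im; simpl; ring).
  apply is_series_ext; intros n; carriers; unfold Re, Im; simpl; ring. }
apply is_series_quat; split4.
- generalize (K 1 (q_re J)); same_limit;
  apply is_series_ext; intros n; carriers; unfold qslice, slice_pt; qunfold; ring.
- generalize (K 0 (q_i J)); same_limit;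
  apply is_series_ext; intros n; carriers; unfold qslice, slice_pt; qunfold; ring.
- generalize (K 0 (q_j J)); same_limit;
  apply is_series_ext; intros n; carriers; unfold qslice, slice_pt; qunfold; ring.
- generalize (K 0 (q_k J)); same_limit;
  apply is_series_ext; intros n; carriers; unfold qslice, slice_pt; qunfold; ring.
Qed.

(** Powers of z and v commute in [C], so z^n v^n and conj z^n v^n are powers of the fixed numbers z
    v and conj z v, although the quaternions [qslice I z] and [qslice J v] need not commute. *)
Lemma is_series_twoslice al I J z v : disc_conv al -> imag_unit I -> imag_unit J -> Cmod z < 1 -> Cmod v = 1 ->
  is_series (V := Qmod) (fun n => qpow (qslice I z) n * (qreal (al n) * qpow (qslice J v) n))%quat
    (twoslice I J (cps al (z * v)%C) (cps al (Cconj z * v)%C)).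
Proof.
intros Ha HI HJ Hz Hv.
assert (H1 := is_cseries_cps al (z * v)%C Ha ltac:(rewrite Cmod_mult, Hv; lra)).
assert (H2 := is_cseries_cps al (Cconj z * v)%C Ha ltac:(rewrite Cmod_mult, Cmod_conj, Hv; lra)).
apply (is_series_ext (V := Qmod) (fun n => twoslice I J (RtoC (al n) * (z * v) ^ n)%C (RtoC (al n) * (Cconj z * v) ^ n)%C)).
- intros n; rewrite !qpow_qslice by auto.
  rewrite !Cpow_mult_l, <- Cpow_conj, !Cmult_assoc.
  replace (RtoC (al n) * Cconj (z ^ n))%C with (Cconj (RtoC (al n) * z ^ n))%C.
  2:{ rewrite Cmult_conj; f_equal; apply injective_projections; simpl; ring. }
  rewrite twoslice_mul, qslice_scal, qmul_assoc, (qreal_comm (al n) (qslice I _)); reflexivity.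
- unfold twoslice; apply is_series_qadd; [|apply is_series_qmul_l]; apply is_series_qslice, is_cseries_scal, is_cseries_plus; auto.
  apply is_cseries_scal; auto.
Qed.

(** * Starlikeness and modulus of the extremal function *)

Section ExtremalStarlike.

Variables (J : quat) (v : C).
Hypotheses (HJ : imag_unit J) (Hv : Cmod v = 1).

Let u : quat := qslice J v.

Let Hu : qnorm u = 1.
Proof. unfold u; rewrite qnorm_qslice; auto. Qed.

Let phi : quat -> quat := slice_derivative (extremal u).

Let phi_exp : has_expansion phi (fun n => qreal (succs n) * qpow u n)%quat.
Proof.
generalize (has_expansion_slice_derivative _ _ (extremal_expansion u Hu)).
apply has_expansion_ext; intros n; reflexivity.
Qed.

Lemma extremal_derivative I z : imag_unit I -> Cmod z < 1 ->
  phi (qslice I z) = twoslice I J (cps succs (z * v)%C) (cps succs (Cconj z * v)%C).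
Proof.
intros HI Hz; eapply quat_series_unique.
- apply phi_exp, in_ball_qslice; auto.
- apply is_series_twoslice; auto; apply disc_conv_succs.
Qed.

Let g : quat -> quat := (fun q => q * phi q)%quat.

Let g_exp : has_expansion g (qshift (fun n => qreal (succs n) * qpow u n)%quat).
Proof. apply has_expansion_shift; auto. Qed.

Let g'_exp : has_expansion (slice_derivative g) (fun n => qreal (squares n) * qpow u n)%quat.
Proof.
generalize (has_expansion_slice_derivative _ _ g_exp).
apply has_expansion_ext; intros n; unfold qderiv, qshift, squares, succs.
rewrite qmul_assoc; apply (f_equal (fun w => w * qpow u n)%quat); apply quat_ext; qunfold; ring.
Qed.

Let g'_twoslice I z : imag_unit I -> Cmod z < 1 ->
  slice_derivative g (qslice I z) = twoslice I J (cps squares (z * v)%C) (cps squares (Cconj z * v)%C).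
Proof.
intros HI Hz; eapply quat_series_unique.
- apply g'_exp, in_ball_qslice; auto.
- apply is_series_twoslice; auto; apply disc_conv_squares.
Qed.

Lemma cdot_self_cps w : Cmod w < 1 -> 0 < cdot (cps succs w) (cps succs w).
Proof.
intros Hw; assert (Hn := one_minus_nz w Hw).
replace (cdot _ _) with (Cmod (cps succs w) ^ 2) by (rewrite Cmod2_alt; unfold cdot; ring).
apply pow_lt, Cmod_gt_0; rewrite cps_succs by auto; intros e.
assert (E : (/ ((1 - w) * (1 - w)) * ((1 - w) * (1 - w)))%C = 1%C) by (field; auto).
rewrite e, Cmult_0_l in E; apply RtoC_inj in E; lra.
Qed.

(** With S = [cps succs w] the inner product is |S|^2 times the positive real part of (1 + w) / (1 -
    w). *)
Lemma cdot_cps_squares w : Cmod w < 1 -> 0 < cdot (cps succs w) (cps squares w).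
Proof.
intros Hw; rewrite cps_squares by auto.
assert (H1 := cdot_self_cps w Hw); assert (H2 := Re_Koebe w Hw).
revert H1 H2; generalize (cps succs w) ((1 + w) / (1 - w))%C; intros [a b] [c d]; unfold cdot, Re, Im; simpl.
intros H1 H2; replace (a * (a * c - b * d) + b * (a * d + b * c)) with ((a * a + b * b) * c) by ring.
apply Rmult_lt_0_compat; auto.
Qed.

Lemma convex_pos s x y : -1 <= s <= 1 -> 0 < x -> 0 < y -> 0 < (1 + s) / 2 * x + (1 - s) / 2 * y.
Proof.
intros Hs Hx Hy; destruct (Rle_lt_dec s 0).
- assert (0 <= (1 + s) / 2 * x) by (apply Rmult_le_pos; lra).
  assert (0 < (1 - s) / 2 * y) by (apply Rmult_lt_0_compat; lra); lra.
- assert (0 < (1 + s) / 2 * x) by (apply Rmult_lt_0_compat; lra).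
  assert (0 <= (1 - s) / 2 * y) by (apply Rmult_le_pos; lra); lra.
Qed.

(** The left factor q cancels, so the sign is that of the inner product of f' and g' with g = q f'.
    By [qdot_twoslice] this is a convex combination of two positive inner products in the slice of
    J. *)
Lemma extremal_starlike : slice_starlike (fun q => q * slice_derivative (extremal u) q)%quat.
Proof.
change (slice_starlike g).
assert (W : forall z, Cmod z < 1 -> Cmod (z * v)%C < 1 /\ Cmod (Cconj z * v)%C < 1).
{ intros z Hz; rewrite !Cmod_mult, Cmod_conj, Hv; lra. }
assert (Hphi : forall q, in_ball q -> 0 < qdot (phi q) (phi q)).
{ intros q Hq; destruct (qslice_cover q Hq) as (I & z & HI & Hz & E); subst q.
  rewrite extremal_derivative, qdot_twoslice by auto.
  apply convex_pos; [apply qdot_units; auto| |]; apply cdot_self_cps; apply W; auto. }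
assert (Hpos : forall q, in_ball q -> 0 < qdot (phi q) (slice_derivative g q)).
{ intros q Hq; destruct (qslice_cover q Hq) as (I & z & HI & Hz & E); subst q.
  rewrite extremal_derivative, g'_twoslice, qdot_twoslice by auto.
  apply convex_pos; [apply qdot_units; auto| |]; apply cdot_cps_squares; apply W; auto. }
split; [split; [|split]|].
- apply (has_expansion_slice_regular g _ g_exp).
- intros q Hq; split.
  + intros e; apply qmul_eq0 in e; destruct e as [e|e]; auto.
    exfalso; specialize (Hphi q Hq); rewrite e in Hphi; unfold qdot in Hphi; unfold qreal in Hphi; qunfold in Hphi; lra.
  + intros e; unfold g; rewrite e; generalize (phi (qreal 0)); clear; qring.
- rewrite (has_expansion_0 _ _ g'_exp); unfold squares; simpl; apply quat_ext; qunfold; ring.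
- intros q Hq Hq0.
  specialize (Hphi q Hq); specialize (Hpos q Hq); assert (k := qdot_self_pos q Hq0).
  rewrite <- qmul_assoc, q_re_qinv_mul, qnorm_sqr; unfold g at 1 3 4; rewrite !qdot_mul_l.
  apply Rdiv_lt_0_compat; apply Rmult_lt_0_compat; auto.
Qed.

(** On the slice of J itself the cosine is 1, so the weight of conj z v is 0 and only z v
    contributes. *)
Lemma extremal_derivative_norm z : Cmod z < 1 ->
  qnorm (slice_derivative (extremal u) (qslice J z)) = 1 / Cmod (1 - z * v)%C ^ 2.
Proof.
intros Hz; fold phi; rewrite extremal_derivative by auto.
assert (Hw : Cmod (z * v)%C < 1) by (rewrite Cmod_mult, Hv; lra).
assert (Hn := one_minus_nz _ Hw); assert (Hp := proj1 (Cmod_gt_0 _) Hn).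
transitivity (Cmod (cps succs (z * v)%C)).
- apply Rsqr_inj; [apply qnorm_ge0|apply Cmod_ge_0|rewrite !Rsqr_pow2, qnorm_sqr, qdot_twoslice by auto].
  assert (E : qdot J J = 1) by (apply imag_unit_iff in HJ; destruct HJ as [h1 h2]; unfold qdot; rewrite h1, <- h2; ring).
  rewrite E, Cmod2_alt; unfold cdot; field.
- rewrite cps_succs, Cmod_inv, Cmod_mult by (auto using Cmult_neq_0); field; lra.
Qed.

End ExtremalStarlike.

(** The sign eps treats both estimates at once: v = eps conj z / |z| makes z v = eps |z|, where |1 -
    z v| is smallest for eps = 1 and largest for eps = -1. *)
Lemma extremal_witness (eps : R) (q0 : quat) : eps = 1 \/ eps = -1 -> in_ball q0 -> q0 <> qreal 0 ->
  exists u : quat, qnorm u = 1 /\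
    slice_regular (extremal u) /\
    slice_starlike (fun q => (q * slice_derivative (extremal u) q)%quat) /\
    qnorm (slice_derivative (extremal u) q0) = 1 / (1 - eps * qnorm q0) ^ 2.
Proof.
intros He Hq0 Hnz.
destruct (qslice_cover q0 Hq0) as (J & z & HJ & Hz & E); subst q0.
rewrite qnorm_qslice by auto.
assert (Hr : 0 < Cmod z) by (rewrite <- (qnorm_qslice J) by auto; apply qnorm_pos; auto).
assert (Hrc : RtoC (Cmod z) <> 0) by (intros e; apply RtoC_inj in e; lra).
set (v := (RtoC eps * (Cconj z / Cmod z))%C).
assert (Hv : Cmod v = 1).
{ unfold v; rewrite Cmod_mult, Cmod_div, Cmod_conj, !Cmod_R, (Rabs_pos_eq (Cmod z)) by (auto; lra).
  destruct He; subst eps; rewrite ?Rabs_R1, ?(Rabs_left (-1)) by lra; field; lra. }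
assert (Ezv : (1 - z * v)%C = RtoC (1 - eps * Cmod z)).
{ unfold v; rewrite RtoC_minus, RtoC_mult.
  replace (z * (eps * (Cconj z / Cmod z)))%C with (eps * ((z * Cconj z) / Cmod z))%C by (field; auto).
  rewrite <- Cmod2_conj, RtoC_pow; field; auto. }
assert (Hu : qnorm (qslice J v) = 1) by (rewrite qnorm_qslice; auto).
exists (qslice J v); split; [|split; [|split]]; auto.
- apply (has_expansion_slice_regular _ _ (extremal_expansion _ Hu)).
- apply extremal_starlike; auto.
- rewrite extremal_derivative_norm, Ezv, Cmod_R, Rabs_pos_eq; auto.
  destruct He; subst eps; lra.
Qed.

Theorem theorem1p4 :
  (forall f : quat -> quat,
     slice_regular f ->
     slice_starlike (fun q => (q * slice_derivative f q)%quat) ->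
     forall q : quat, in_ball q ->
       1 / (1 + qnorm q) ^ 2 <= qnorm (slice_derivative f q) <=
       1 / (1 - qnorm q) ^ 2) /\
  (forall q0 : quat, in_ball q0 -> q0 <> qreal 0 ->
     (exists u : quat, qnorm u = 1 /\
        slice_regular (extremal u) /\
        slice_starlike (fun q => (q * slice_derivative (extremal u) q)%quat) /\
        qnorm (slice_derivative (extremal u) q0) = 1 / (1 + qnorm q0) ^ 2) /\
     (exists u : quat, qnorm u = 1 /\
        slice_regular (extremal u) /\
        slice_starlike (fun q => (q * slice_derivative (extremal u) q)%quat) /\
        qnorm (slice_derivative (extremal u) q0) = 1 / (1 - qnorm q0) ^ 2)).
Proof.
split; [exact starlike_growth|].
intros q0 Hq0 Hnz; split.
- replace (1 + qnorm q0) with (1 - -1 * qnorm q0) by ring.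
  apply extremal_witness; auto.
- replace (1 - qnorm q0) with (1 - 1 * qnorm q0) by ring.
  apply extremal_witness; auto.
Qed.
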